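(* Let $0\le p_-<p_+\le\infty$ and let $\mathcal{F}$ be a family of pairs $(f,g)$ of non-negative measurable functions on $\mathbb{R}^n$. Suppose that for some $p_0,q_0\in(0,\infty)$ such that $p_-\le p_0\le p_+$ and $\frac1{q_0}-\frac1{p_0}+\frac1{p_+}\ge 0$, and all weights $w$ such that $w^{p_0}\in A_{\frac{p_0}{p_-}}\cap RH_{\left(\frac{p_+}{p_0}\right)'}$, $$\left(\int_{\mathbb{R}^n}f^{q_0}w^{q_0}\,dx\right)^{\frac1{q_0}}\le C\left(\int_{\mathbb{R}^n}g^{p_0}w^{p_0}\,dx\right)^{\frac1{p_0}}$$ for all $(f,g)\in\mathcal{F}$ such that $\|f\|_{L^{q_0}(w^{q_0})}<\infty$, where the constant $C$ depends on $n$, $p_0$, $q_0$, $[w^{p_0}]_{A_{p_0/p_-}}$, $[w^{p_0}]_{RH_{(p_+/p_0)'}}$. Then for every $p,q$ such that $p_-<p<p_+$, $0<q<\infty$ and $\frac1p-\frac1q=\frac1{p_0}-\frac1{q_0}$, and every weight $w$ such that $w^p\in A_{\frac{p}{p_-}}\cap RH_{\left(\frac{p_+}{p}\right)'}$, $$\left(\int_{\mathbb{R}^n}f^{q}w^{q}\,dx\right)^{\frac1{q}}\le C\left(\int_{\mathbb{R}^n}g^{p}w^{p}\,dx\right)^{\frac1{p}}$$ for all $(f,g)\in\mathcal{F}$ such that $\|f\|_{L^q(w^q)}<\infty$, and $C$ depends on $n$, $p$, $q$, $[w^p]_{A_{p/p_-}}$, $[w^p]_{RH_{(p_+/p)'}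}$.
   Context: Norms: for $0<r<\infty$ and a weight $v$, $\|f\|_{L^r(v)}=\left(\int_{\mathbb{R}^n}|f|^r v\,dx\right)^{1/r}$ (possibly $+\infty$; only a quasi-norm if $r<1$). Weights: a weight is a measurable function $v$ on $\mathbb{R}^n$ with $0<v(x)<\infty$ a.e. All suprema below are over cubes $Q\subset\mathbb{R}^n$ with sides parallel to the axes, and $\langle v\rangle_Q=|Q|^{-1}\int_Q v\,dx$. For $1<p<\infty$, $v\in A_p$ if $[v]_{A_p}=\sup_Q\langle v\rangle_Q\,\langle v^{1-p'}\rangle_Q^{\,p-1}<\infty$. Also $v\in A_1$ if $[v]_{A_1}=\sup_Q\langle v\rangle_Q\,\operatorname{ess\,sup}_{x\in Q}v(x)^{-1}<\infty$. Set $A_\infty=\bigcup_{1\le p<\infty}A_p$. For $1<s<\infty$, a locally integrable weight $v$ is in $RH_s$ if $[v]_{RH_s}=\sup_Q\langle v^s\rangle_Q^{1/s}\langle v\rangle_Q^{-1}<\infty$. Also $v\in RH_\infty$ if $[v]_{RH_\infty}=\sup_Q\left(\operatorname{ess\,sup}_{x\in Q}v(x)\right)\langle v\rangle_Q^{-1}<\infty$. Set $RH_1=\bigcup_{1<s\le\infty}RH_s$; it is known that $RH_1=A_\infty$. Conventions: $p'$ is the conjugate exponent, $\frac1p+\frac1{p'}=1$; $\frac1\infty=0$, $\frac10=\infty$, $1'=\infty$, $\infty'=1$. Thus a Muckenhoupt class with index $\frac{p}{0}$ is $A_\infty$, and a reverse Hölder class with index $\left(\frac{\infty}{p}\right)'$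 is $RH_1=A_\infty$, while index $\left(\frac{p}{p}\right)'=1'$ gives $RH_\infty$. For $v\in A_\infty=RH_1$ the constant $[v]_{A_\infty}=[v]_{RH_1}$ is the usual $A_\infty$ constant $\sup_Q\left(\int_Q v\right)^{-1}\int_Q M(v\chi_Q)\,dx$, $M$ the Hardy–Littlewood maximal operator. Constants: ''C depends on'' given quantities means that $C$ may depend on $n$, the underlying exponents/parameters (such as $p_\pm,p_0,q_0,p,q$) and the indicated weight constants, but not otherwise on the specific weight nor on the functions in $\mathcal{F}$ (so for fixed parameters, one $C$ works for all weights whose indicated constants are at most a given bound). *)

(* Defs.v *)
From HB Require Import structures.
From mathcomp Require Import all_boot all_order all_algebra.
From mathcomp Require Import all_classical all_reals all_analysis.
From mathcomp Require Import measurable_realfun.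

Set Implicit Arguments.
Unset Strict Implicit.
Unset Printing Implicit Defensive.

Import Order.TTheory GRing.Theory Num.Theory.
Import numFieldNormedType.Exports.

Local Open Scope classical_set_scope.
Local Open Scope ring_scope.
Local Open Scope ereal_scope.

(* Lebesgue measure on R^n: the product of n copies of the one-dimensional
   measure lives on the Borel sets of n.-tuple R; its completion lives on the
   sigma-algebra of all Lebesgue measurable sets. *)
Section borel_lebesgue.
Context {R : realType}.

Local Notation borelR := (measurableTypeR R).

Definition tuple_cons n (xt : borelR * n.-tuple borelR) : n.+1.-tuple borelR :=
  [tuple of xt.1 :: xt.2].

Lemma measurable_tuple_cons n : measurable_fun setT (@tuple_cons n).
Proof. exact: measurable_cons. Qed.

Section step.
Context n (m : {sigma_finite_measure set (n.-tuple borelR) -> \bar R}).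

Definition lebesgue_step : set (n.+1.-tuple borelR) -> \bar R :=
  pushforward (lebesgue_measure \x m) (@tuple_cons n).

Let mcons := @measurable_tuple_cons n.

Let step0 : lebesgue_step set0 = 0.
Proof. exact: measure0. Qed.

Let step_ge0 A : 0 <= lebesgue_step A.
Proof. exact: measure_ge0. Qed.

Let step_sigma_additive : semi_sigma_additive lebesgue_step.
Proof. exact: measure_semi_sigma_additive. Qed.

HB.instance Definition _ := isMeasure.Build _ _ _ lebesgue_step
  step0 step_ge0 step_sigma_additive.

Let step_sigma_finite : sigma_finite setT lebesgue_step.
Proof.
have /sigma_finiteP[F [TF ndF Foo]] := sigma_finiteT (@lebesgue_measure R).
have /sigma_finiteP[G [TG ndG Goo]] := sigma_finiteT m.
pose f (t : n.+1.-tuple borelR) := (thead t, [tuple of behead t]).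
have mf : measurable_fun setT f.
  by apply: measurable_fun_pair;
    [exact: measurable_tnth|exact: measurable_behead].
exists (fun k => f @^-1` (F k `*` G k)).
  rewrite -preimage_bigcup -[LHS](preimage_setT f) -setXTT TF TG; congr preimage.
  apply/seteqP; split=> [[x y] [/= [k _ Fkx] [l _ Gly]]|[x y] [k _ /= [Fx Gy]]].
    exists (maxn k l) => //; split.
    - by move: x Fkx; exact/subsetPset/ndF/leq_maxl.
    - by move: y Gly; exact/subsetPset/ndG/leq_maxr.
  by split; exists k.
move=> k; have [mF Fk] := Foo k; have [mG Gk] := Goo k; split.
  by rewrite -[X in measurable X]setTI; apply: mf => //; exact: measurableX.
rewrite /lebesgue_step /pushforward -comp_preimage.
rewrite (_ : f \o @tuple_cons n = id); last first.
  by apply/funext => -[x t]; rewrite /f/= theadE; congr pair; exact: val_inj.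
by rewrite preimage_id product_measure1E// lte_mul_pinfty// ge0_fin_numE.
Qed.

HB.instance Definition _ := Measure_isSigmaFinite.Build _ _ _ lebesgue_step
  step_sigma_finite.
End step.

Fixpoint borel_lebesgue n :
    {sigma_finite_measure set (n.-tuple borelR) -> \bar R} :=
  match n with
  | 0 => \d_[tuple]
  | n'.+1 => lebesgue_step (borel_lebesgue n')
  end.

End borel_lebesgue.
Arguments borel_lebesgue : clear implicits.

Definition Rn (R : realType) (n : nat) : Type :=
  caratheodory_type (borel_lebesgue R n)^*%mu.

HB.instance Definition _ R n := Measurable.copy (Rn R n)
  (caratheodory_type (borel_lebesgue R n)^*%mu).

Definition lebesgue_n (R : realType) (n : nat) : set (Rn R n) -> \bar R :=
  @completed_measure_extension _ _ _ (borel_lebesgue R n).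

Arguments lebesgue_n : clear implicits.

HB.instance Definition _ R n := Measure.copy (lebesgue_n R n)
  (@completed_measure_extension _ _ _ (borel_lebesgue R n)).

Section weights.
Context {R : realType} {n : nat}.

Local Notation E := (Rn R n).
Local Notation mu := (lebesgue_n R n).

Implicit Types (Q : set E) (v w f g : E -> \bar R).

Definition cube (a : n.-tuple R) (l : R) : set E :=
  [set x : n.-tuple R | forall i, (tnth a i <= tnth x i <= tnth a i + l)%R].

Definition cubes : set (set E) :=
  [set Q | exists a l, (0 < l)%R /\ Q = cube a l].

Definition avg v Q : \bar R := (mu Q)^-1 * \int[mu]_(x in Q) v x.

Definition ess_sup_on Q v : \bar R :=
  ereal_inf [set y | {ae mu, forall x, Q x -> v x <= y}].

Definition weight v : Prop :=
  measurable_fun setT v /\ {ae mu, forall x, 0 < v x < +oo}.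

Definition locally_int v : Prop := forall Q, cubes Q -> mu.-integrable Q v.

Definition wnorm (r : R) v f : \bar R :=
  (\int[mu]_x (`|f x| `^ r * v x)) `^ r^-1.

(* The supremum is over all cubes containing x, not only those centered at x. *)
Definition maximal v (x : E) : \bar R :=
  ereal_sup [set avg (fun y => `|v y|) Q | Q in [set Q | cubes Q /\ Q x]].

Definition Ainfty_const v : \bar R :=
  ereal_sup [set (\int[mu]_(x in Q) v x)^-1 *
                 \int[mu]_(x in Q) maximal (v \_ Q) x | Q in cubes].

Definition Ap_const_fin (p : R) v : \bar R :=
  if p == 1%R then
    ereal_sup [set avg v Q * ess_sup_on Q (fun x => (v x)^-1) | Q in cubes]
  else
    ereal_sup [set avg v Q *
      (avg (fun x => v x `^ (1 - fine (hoelder_conjugate p%:E))) Q) `^ (p - 1)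
      | Q in cubes].

Definition RHs_const_gt1 (s : \bar R) v : \bar R :=
  if s is r%:E then
    ereal_sup [set (avg (fun x => v x `^ r) Q) `^ r^-1 * (avg v Q)^-1
      | Q in cubes]
  else ereal_sup [set ess_sup_on Q v * (avg v Q)^-1 | Q in cubes].

(* In the four definitions below the exponent ranges over [1, +oo]. *)
Definition Ap_const (p : \bar R) v : \bar R :=
  if p is r%:E then Ap_const_fin r v else Ainfty_const v.

Definition RHs_const (s : \bar R) v : \bar R :=
  if s == 1 then Ainfty_const v else RHs_const_gt1 s v.

(* Membership in A_oo and RH_1 is membership in the union of the A_r, r < +oo,
   resp. of the RH_t, t > 1; the A_oo constant plays no role in it. *)
Definition Ap (p : \bar R) v : Prop :=
  weight v /\
  if p is r%:E then Ap_const_fin r v < +oo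
  else exists2 r : R, (1 <= r)%R & Ap_const_fin r v < +oo.

Definition RHs (s : \bar R) v : Prop :=
  [/\ weight v, locally_int v &
    if s == 1 then exists2 t, 1 < t & RHs_const_gt1 t v < +oo
    else RHs_const_gt1 s v < +oo].

(* The (p, q) inequality of the limited range (pm, pp) for the family F: the
   number C K1 K2 serves for all weights whose two characteristics are bounded
   by K1 and K2. For r in [pm, pp], r / pm is +oo when pm = 0, and
   hoelder_conjugate (pp / r) is 1 when pp = +oo and +oo when pp = r. *)
Definition limited_range_bound (pm : R) (pp : \bar R) (p q : R)
    (F : set ((E -> \bar R) * (E -> \bar R))) (C : R -> R -> R) : Prop :=
  forall K1 K2 : R, (0 < C K1 K2)%R /\
  forall w, weight w ->
    let wp := fun x => w x `^ p in
    let wq := fun x => w x `^ q in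
    let a := p%:E / pm%:E in
    let s := hoelder_conjugate (pp / p%:E) in
    Ap a wp -> RHs s wp ->
    Ap_const a wp <= K1%:E -> RHs_const s wp <= K2%:E ->
    forall f g, F (f, g) -> wnorm q wq f < +oo ->
      wnorm q wq f <= (C K1 K2)%:E * wnorm p wp g.

Definition nonneg_measurable_pairs (F : set ((E -> \bar R) * (E -> \bar R))) :=
  forall f g, F (f, g) ->
    [/\ measurable_fun setT f, measurable_fun setT g,
      (forall x, 0 <= f x) & forall x, 0 <= g x].

End weights.

(* Main.v *)
(* Write X(a, b) for the weights w such that, on every cube, the L^(1/a) mean of w
   times the L^(1/b) mean of 1/w is bounded, an exponent 0 standing for L^oo. By
   Hoelder's inequality, w^p is in A_(p/p_-) and RH_((p_+/p)') if and only if w is in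
   X(1/p - 1/p_+, 1/p_- - 1/p). Passing from p to p_0 therefore means moving
   t = |1/p - 1/p_0| from one of the two exponents to the other. The Rubio de Francia
   algorithm provides kap with kap^(1/t) integrable, above a prescribed function k,
   such that w / kap (if p_0 > p) or w kap (if p_0 < p) is in the new class; the
   function k is a power of f w, or a sum of powers of f w and g w, chosen so that the
   hypothesis for p_0 gives back the inequality for p by Hoelder's inequality.

   If p_- = 0, the class A_oo is first replaced by some A_r with r and the A_r constant
   controlled by the given constants: the reverse Hoelder or the Fujii-Wilson constant
   makes the weight of a small part of a cube at most half of that of the cube, and a
   stopping time argument on dyadic cells concludes. Conversely the A_oo constants
   required by the hypothesis are bounded by Muckenhoupt's theorem. *)
From HB Require Import structures.
Require Import Defs.
From mathcomp Require Import all_boot all_order all_algebra.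
From mathcomp Require Import all_classical all_reals all_analysis.
From mathcomp Require Import measurable_realfun.
From mathcomp Require Import ring lra.

Set Implicit Arguments.
Unset Strict Implicit.
Unset Printing Implicit Defensive.

Import Order.TTheory GRing.Theory Num.Theory.
Import numFieldNormedType.Exports.

Local Open Scope classical_set_scope.
Local Open Scope ring_scope.
Local Open Scope ereal_scope.

(** * Boxes and dyadic cells in R^n *)

Section boxes.
Context {R : realType}.
Local Notation borelR := (measurableTypeR R).

(** The class X(a, b) is stable under exchanging w with 1/w and a with b, so moving t in either
    direction is one lemma, and every estimate also holds for the dual weight. Since p is strictly
    between p_- and p_+, both exponents are positive where Muckenhoupt's theorem is applied; only
    those for p_0 may vanish, and then stand for A_1 or RH_oo. The constants have to be explicit in
    the bounds of the characteristics. For p_- = 0 even the exponent b depends on these bounds, so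
    it cannot be fixed in advance. Two obstacles shape the measure theory. A supremum over all cubes
    is not visibly measurable, so the work is done with a countable family of cubes and the
    comparison is made only where characteristics enter or leave. Lebesgue measurable sets are
    reached through Borel hulls, so differentiation rests on outer approximation by unions of
    half-open dyadic cells, which split exactly into disjoint cells. The geometry of cubes is
    confined to two records, [cube_basis] and [dyadic_basis]; the analysis takes place on an
    abstract measure space. *)

Definition box n (A : 'I_n -> set R) : set (n.-tuple R) :=
  [set x | forall i, A i (tnth x i)].

Lemma measurable_box n (A : 'I_n -> set borelR) :
  (forall i, measurable (A i)) ->
  measurable (box A : set (n.-tuple borelR)).
Proof.
move=> mA.
rewrite (_ : box A = \bigcap_(i in [set: 'I_n])
   ((fun x : n.-tuple borelR => tnth x i) @^-1` (A i))); last first.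
  by apply/seteqP; split=> x /= h; [move=> i _; exact: h|move=> i; exact: h].
apply: fin_bigcap_measurable => // i _.
by rewrite -[X in measurable X]setTI; exact: measurable_tnth.
Qed.

Lemma borel_lebesgue_box n (A : 'I_n -> set borelR) (l : \bar R) :
  (forall i, measurable (A i)) ->
  (forall i, lebesgue_measure (A i) = l) ->
  borel_lebesgue R n (box A) = l ^+ n.
Proof.
elim: n A => [|n IH] A mA lA.
  rewrite /= diracE mem_set ?expe0 //; by move=> [].
rewrite expeS /= /lebesgue_step /pushforward.
rewrite (_ : _ @^-1` _ = A ord0 `*` box (fun i => A (lift ord0 i))); last first.
  apply/seteqP; split=> -[x t] /=.
    move=> h; split; first by have := h ord0; rewrite (tnth_nth x).
    by move=> i; have := h (lift ord0 i); rewrite !(tnth_nth x) /=.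
  move=> -[h0 h] i; case: (unliftP ord0 i) => [j ->|->].
    by have := h j; rewrite !(tnth_nth x).
  by rewrite (tnth_nth x).
rewrite product_measure1E //; last by apply: measurable_box => i; exact: mA.
congr (_ * _); first exact: lA.
apply: IH => i; first by exact: mA.
exact: lA.
Qed.

Lemma borel_measurable_Rn n (B : set (n.-tuple borelR)) :
  measurable B -> measurable (B : set (Rn R n)).
Proof.
move=> mB; apply: (@sub_caratheodory _ _ _ (borel_lebesgue R n)).
have : <<s measurable >> B by exact: sub_sigma_algebra.
exact.
Qed.

Lemma lebesgue_n_borel n (B : set (n.-tuple borelR)) :
  measurable B -> lebesgue_n R n B = borel_lebesgue R n B.
Proof. by move=> mB; exact: (measurable_mu_extE (borel_lebesgue R n)). Qed.

Lemma lebesgue_n_box n (A : 'I_n -> set borelR) (l : \bar R) :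
  (forall i, measurable (A i)) ->
  (forall i, lebesgue_measure (A i) = l) ->
  lebesgue_n R n (box A) = l ^+ n.
Proof.
move=> mA lA; have mB := measurable_box mA.
by rewrite (lebesgue_n_borel mB); exact: borel_lebesgue_box.
Qed.

(** The measure of [S] is an infimum over countable Borel covers, so intersecting covers whose
    excess is at most [k.+1%:R^-1] gives a Borel hull. Statements about Lebesgue measurable sets are
    thereby reduced to Borel sets and null sets. *)
Lemma sub_borel_eq_mu n (S : set (Rn R n)) : measurable S ->
  lebesgue_n R n S < +oo ->
  exists B : set (n.-tuple borelR),
    [/\ measurable B, S `<=` B & lebesgue_n R n (B `\` S) = 0].
Proof.
move=> mS Soo.
have Sfin : lebesgue_n R n S \is a fin_num by rewrite ge0_fin_numE.
have cov (k : nat) : exists B : set (n.-tuple borelR), [/\ measurable B, S `<=` B &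
    lebesgue_n R n B <= lebesgue_n R n S + (k.+1%:R^-1)%:E].
  have e0 : (0 < k.+1%:R^-1 :> R)%R by rewrite invr_gt0.
  have [_ [F [mF SF] <-] h] := lb_ereal_inf_adherent e0 Sfin.
  exists (\bigcup_i F i); split => //; first exact: bigcupT_measurable.
  rewrite lebesgue_n_borel ?(le_trans _ (ltW h))//; last exact: bigcupT_measurable.
  apply: (@measure_sigma_subadditive _ _ _ (borel_lebesgue R n)) => //.
  exact: bigcupT_measurable.
pose B k := projT1 (cid (cov k)).
have BP k : [/\ measurable (B k), S `<=` B k &
    lebesgue_n R n (B k) <= lebesgue_n R n S + (k.+1%:R^-1)%:E].
  exact: (projT2 (cid (cov k))).
have mB : measurable (\bigcap_k B k).
  by apply: bigcapT_measurable => k; have [] := BP k.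
have SB : S `<=` \bigcap_k B k.
  by move=> x Sx k _; have [_ + _] := BP k; exact.
exists (\bigcap_k B k); split => //.
have mB' := borel_measurable_Rn mB.
apply/eqP; rewrite eq_le measure_ge0 andbT.
apply/lee_addgt0Pr => e e0; rewrite add0e.
pose k := Num.truncn e^-1.
have ke : (k.+1%:R^-1 <= e :> R)%R.
  rewrite -[leRHS]invrK lef_pV2 ?posrE ?invr_gt0 ?ltr0Sn//.
  by apply/ltW; rewrite truncnS_gt.
have [mBk SBk lek] := BP k.
apply: (@le_trans _ _ (lebesgue_n R n (B k `\` S))).
  apply: le_measure; rewrite ?inE.
  - exact: measurableD.
  - by apply: measurableD => //; exact: borel_measurable_Rn.
  - by apply: setSD => x; apply.
have Bkoo : lebesgue_n R n (B k) < +oo.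
  by apply: (le_lt_trans lek); rewrite lte_add_pinfty// ltry.
have := @measureD _ _ _ (lebesgue_n R n) (B k) S (borel_measurable_Rn mBk) mS Bkoo.
rewrite (setIidr SBk) => ->.
rewrite leeBlDr// (le_trans lek)// addeC leeD2r// lee_fin//.
Qed.

End boxes.

(** * Nested partitions, stopping cells and cell-open sets *)

Section dcells.
Context (T I : Type) (idx : nat -> T -> I).

(* A nested sequence of countable partitions, given by the index of the cell of
   generation [k] that contains a point. *)
Definition dcell k x : set T := [set y | idx k y = idx k x].

Local Notation cell := dcell.

Lemma dcell_eq k x y : cell k x y -> cell k y = cell k x.
Proof. by rewrite /dcell /= => ->. Qed.

(** Openness for the topology generated by the cells. Over nested countable partitions such a set is
    exactly a countable disjoint union of cells, with no boundary to discard. *)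
Definition gopen (U : set T) := forall x, U x -> exists k, cell k x `<=` U.

Lemma gopen_cell_stop (U : set T) k x y : cell k x y -> cell k x `<=` U -> cell k y `<=` U.
Proof. by move=> xy; rewrite (dcell_eq xy). Qed.

End dcells.

Section stopping.
Context d (T : measurableType d) (R : realType) (mu : {measure set T -> \bar R}).
Context (I : countType) (idx : nat -> T -> I).

Local Notation cell := (dcell idx).

Definition nested_cells := (forall k x y, idx k.+1 y = idx k.+1 x -> idx k y = idx k x) /\
  (forall k x, measurable (cell k x)).

Lemma dcell_nest k m x : nested_cells -> (k <= m)%N -> cell m x `<=` cell k x.
Proof.
move=> [h _] /subnKC <-; elim: (m - k)%N => [|j IH]; first by rewrite addn0.
by rewrite addnS; apply: subset_trans IH => y; exact: h.
Qed.

Hypothesis HI : nested_cells.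

Variable P : nat -> set T.
Hypothesis Pcell : forall k x y, cell k x y -> P k x -> P k y.

Let S k : set T := [set x | P k x /\ forall j, (j < k)%N -> ~ P j x].

(** The stopping cells in a single sequence: [m] codes a generation and a cell index, and a number
    that codes no pair contributes the empty set. *)
Let piece (m : nat) : set T :=
  if @pickle_inv (nat * I)%type m is Some (k, J) then
    [set x | S k x /\ idx k x = (J : I)] else set0.

Let S_cell k x y : cell k x y -> S k x -> S k y.
Proof.
move=> xy [Px nP]; split; first exact: Pcell xy Px.
move=> j jk Pj; apply: (nP j jk); apply: Pcell Pj.
rewrite (dcell_eq (y:=y) (x:=x)); first by [].
exact: (dcell_nest HI (ltnW jk)) xy.
Qed.

Let pieceP m : piece m = set0 \/ exists k x, S k x /\ piece m = cell k x.
Proof.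
rewrite /piece; case: (pickle_inv m) => [[k J]|]; last by left.
have [->|/set0P[x [Sx Jx]]] := eqVneq [set x | S k x /\ idx k x = J] set0.
  by left.
right; exists k, x; split => //; apply/seteqP; split => y /=.
  by move=> [_ Jy]; exact: etrans Jy (esym Jx).
move=> xy; split; first exact: S_cell xy Sx.
exact: etrans xy Jx.
Qed.

Let bigcup_piece : \bigcup_k P k = \bigcup_m piece m.
Proof.
apply/seteqP; split => x [m _].
  move=> Pm; have ex : exists k, `[< P k x >] by exists m; apply/asboolP.
  case: (ex_minnP ex) => k /asboolP Pkx minP.
  exists (pickle (k, idx k x)) => //.
  rewrite /piece pickleK_inv /=; split => //; split => // j jk Pj.
  by have := minP j; rewrite leqNgt jk => /(_ (asboolT Pj)).
rewrite /piece; case: (pickle_inv m) => [[k J]|//] [[Pk _] _].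
by exists k.
Qed.

Let trivIset_piece : trivIset setT piece.
Proof.
move=> m m' _ _ [x []]; rewrite /piece.
case em : (pickle_inv m) => [[k J]|//]; case em' : (pickle_inv m') => [[k' J']|//].
move=> -[[Pk nP] Jk] [[Pk' nP'] Jk'].
have kk' : k = k'.
  apply/eqP; rewrite eqn_leq leqNgt [X in _ && X]leqNgt; apply/andP; split.
    by apply/negP => h; exact: nP h Pk'.
  by apply/negP => h; exact: nP' h Pk.
subst k'; have JJ' : J = J' by rewrite -Jk -Jk'.
subst J'; have := @pickle_invK (nat * I)%type m.
have := @pickle_invK (nat * I)%type m'.
by rewrite em em' /= JJ' => <- <-.
Qed.

Let measurable_piece m : measurable (piece m).
Proof.
case: (pieceP m) => [->|[k [x [_ ->]]]]; first exact: measurable0.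
exact: HI.2.
Qed.

Lemma measurable_stop : measurable (\bigcup_k P k).
Proof. by rewrite bigcup_piece; exact: bigcupT_measurable. Qed.

(** The union of all [P k] is a countable disjoint union of the cells at which [P] holds for the
    first time, so integrals over it are compared cell by cell. This is the form of the
    Calderon-Zygmund decomposition used throughout. *)
Lemma stop_integral_le (f1 f2 : T -> \bar R) :
  measurable_fun setT f1 -> measurable_fun setT f2 ->
  (forall x, 0 <= f1 x) -> (forall x, 0 <= f2 x) ->
  (forall k x, P k x -> (forall j, (j < k)%N -> ~ P j x) ->
    \int[mu]_(y in cell k x) f1 y <= \int[mu]_(y in cell k x) f2 y) ->
  \int[mu]_(y in \bigcup_k P k) f1 y <= \int[mu]_(y in \bigcup_k P k) f2 y.
Proof.
move=> m1 m2 f10 f20 H; rewrite bigcup_piece !ge0_integral_bigcup//=.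
- apply: lee_nneseries => m _; first by move=> _; exact: integral_ge0.
  case: (pieceP m) => [->|[k [x [[Px nP] ->]]]]; first by rewrite !integral_set0.
  exact: H.
- exact: measurable_funTS.
- exact: measurable_funTS.
Qed.

End stopping.

Section grid_open_sets.
Context d (T : measurableType d) (R : realType).
Context (I : countType) (idx : nat -> T -> I).
Hypothesis HI : nested_cells idx.
Local Notation cell := (dcell idx).

Local Notation gopen := (gopen idx).

Lemma gopenE U : gopen U -> U = \bigcup_k [set x | cell k x `<=` U].
Proof.
move=> oU; apply/seteqP; split => x; first by move=> /oU[k kU]; exists k.
by move=> [k _]; apply.
Qed.

Lemma measurable_gopen U : gopen U -> measurable U.
Proof.
move=> /gopenE ->; apply: (measurable_stop HI) => k x y.
exact: gopen_cell_stop.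
Qed.

Lemma gopenI U V : gopen U -> gopen V -> gopen (U `&` V).
Proof.
move=> oU oV x [/oU[k kU] /oV[m mV]]; exists (maxn k m) => y hy; split.
  by apply: kU; apply: (dcell_nest HI _ hy); exact: leq_maxl.
by apply: mV; apply: (dcell_nest HI _ hy); exact: leq_maxr.
Qed.

Lemma gopen_bigcup (U : nat -> set T) : (forall i, gopen (U i)) -> gopen (\bigcup_i U i).
Proof.
by move=> oU x [i _ /oU[k kU]]; exists k => y /kU Uy; exists i.
Qed.

End grid_open_sets.

(** Outer regularity is asked of every finite measure absolutely continuous with respect to [mu],
    because the differentiation argument needs an excess that is small for the integrals of the
    weights, not only for [mu]. *)
Definition outer_approx d (T : measurableType d) (R : realType)
    (mu : {measure set T -> \bar R}) (I : countType) (idx : nat -> T -> I) :=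
  forall nu : {measure set T -> \bar R}, nu setT < +oo ->
  (forall A, measurable A -> mu A = 0 -> nu A = 0) ->
  forall S, measurable S -> mu S < +oo -> forall e : R, (0 < e)%R ->
  exists U, [/\ gopen idx U, S `<=` U & nu (U `\` S) <= e%:E].

Section cells.
Context {R : realType} {n : nat}.
Local Notation E := (Rn R n).
Local Notation mu := (lebesgue_n R n).
Implicit Types (a : n.-tuple R) (l h : R) (x y : n.-tuple R) (k : nat).

Lemma cube_box a l : cube a l = box (fun i => `[tnth a i, (tnth a i + l)%R]%classic) :> set E.
Proof.
by apply/seteqP; split=> x hx i; have := hx i; rewrite /= in_itv.
Qed.

Lemma measurable_cube a l : measurable (cube a l : set E).
Proof.
rewrite cube_box; apply: borel_measurable_Rn.
by apply: measurable_box => i; exact: measurable_itv.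
Qed.

Lemma mu_cube a l : (0 < l)%R -> mu (cube a l) = (l ^+ n)%:E.
Proof.
move=> l0; rewrite cube_box.
suff -> : mu (box (fun i => `[tnth a i, (tnth a i + l)%R]%classic)) = l%:E ^+ n.
  by rewrite EFin_expe.
apply: lebesgue_n_box => i; first exact: measurable_itv.
rewrite lebesgue_measure_itv/= lte_fin ltrDl l0.
  by rewrite -EFinB addrAC subrr add0r.
Qed.

(** Integer coordinates in the half-open grid of mesh [l / 2 ^+ k] anchored at [a]. The cells of one
    generation partition all of R^n; the cell of generation 0 at [a] is the cube up to its upper
    faces. *)
Definition cell_idx a l k x : n.-tuple int :=
  [tuple Num.floor ((tnth x i - tnth a i) / (l / 2 ^+ k)) | i < n].

Definition cell a l k x : set E := dcell (cell_idx a l) k x.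

Definition corner a l k x : n.-tuple R :=
  [tuple (tnth a i + (tnth (cell_idx a l k x) i)%:~R * (l / 2 ^+ k))%R | i < n].

Lemma cell_refl a l k x : cell a l k x x. Proof. by []. Qed.

Lemma floor_half_eq (z z' : R) :
  Num.floor (z * 2) = Num.floor (z' * 2) -> Num.floor z = Num.floor z'.
Proof.
have h (u v : R) : Num.floor (u * 2) = Num.floor (v * 2) ->
    (Num.floor v <= Num.floor u)%R.
  move=> uv; rewrite leNgt; apply/negP => uLv.
  have : (u * 2 < ((Num.floor v)%:~R * 2))%R.
    by rewrite ltr_pM2r// -floor_lt_int.
  rewrite -[X in (_ < _ * X)%R]/(2%:~R) -intrM -floor_lt_int uv.
  apply/negP; rewrite -leNgt floor_ge_int intrM ler_pM2r//.
  by rewrite floor_le.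
by move=> e; apply/eqP; rewrite eq_le !h.
Qed.

Lemma cell_nestS a l k x : cell a l k.+1 x `<=` cell a l k x.
Proof.
move=> y; rewrite /cell /= => e; apply: eq_from_tnth => i.
have := congr1 (fun t => tnth t i) e; rewrite !tnth_mktuple => /= e'.
apply: floor_half_eq; rewrite -!mulrA.
suff -> : ((l / 2 ^+ k)^-1 * 2 = (l / 2 ^+ k.+1)^-1)%R by [].
by rewrite exprS !invfM !invrK; ring.
Qed.

Lemma cell_box a l k x : (0 < l)%R -> cell a l k x =
  box (fun i => `[tnth (corner a l k x) i, (tnth (corner a l k x) i + l / 2 ^+ k)%R[%classic).
Proof.
move=> l0; have h0 : (0 < l / 2 ^+ k)%R by rewrite divr_gt0// exprn_gt0.
have H y i : (tnth (cell_idx a l k y) i = tnth (cell_idx a l k x) i) <->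
    (tnth (corner a l k x) i <= tnth y i < tnth (corner a l k x) i + l / 2 ^+ k)%R.
  rewrite !tnth_mktuple; set m' := Num.floor ((tnth x i - _) / _)%R.
  set z : R := (tnth y i - tnth a i)%R.
  have -> : (tnth a i + m'%:~R * (l / 2 ^+ k) <= tnth y i)%R =
     (m'%:~R <= z / (l / 2 ^+ k))%R.
    by rewrite ler_pdivlMr// /z lerBrDl.
  have -> : (tnth y i < tnth a i + m'%:~R * (l / 2 ^+ k) + l / 2 ^+ k =
     (z / (l / 2 ^+ k) < (m' + 1)%:~R))%R.
    by rewrite ltr_pdivrMr// /z ltrBlDl intrD mulrDl mul1r addrA.
  split => [<-|/floor_def//].
  by apply/andP; split; [exact: floor_le|rewrite floorD1_gt].
apply/seteqP; split=> y hy.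
  by move=> i; have /H := congr1 (fun t => tnth t i) hy; rewrite /= in_itv.
by apply: eq_from_tnth => i; apply/H; have := hy i; rewrite /= in_itv.
Qed.

Lemma measurable_cell a l k x : (0 < l)%R -> measurable (cell a l k x).
Proof.
move=> l0; rewrite cell_box//; apply: borel_measurable_Rn.
by apply: measurable_box => i; exact: measurable_itv.
Qed.

Lemma half_pow_gt0 l k : (0 < l)%R -> (0 < l / 2 ^+ k)%R.
Proof. by move=> l0; rewrite divr_gt0// exprn_gt0. Qed.

Lemma mu_cell a l k x : (0 < l)%R -> mu (cell a l k x) = ((l / 2 ^+ k) ^+ n)%:E.
Proof.
move=> l0; rewrite cell_box// EFin_expe.
apply: lebesgue_n_box => i; first exact: measurable_itv.
rewrite lebesgue_measure_itv/= lte_fin ltrDl half_pow_gt0//.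
  by rewrite -EFinB addrAC subrr add0r.
Qed.

Lemma cell_sub_cube a l k x : (0 < l)%R ->
  cell a l k x `<=` cube (corner a l k x) (l / 2 ^+ k).
Proof.
move=> l0; rewrite cell_box// cube_box => y hy i; have := hy i.
by rewrite /= !in_itv/= => /andP[-> /ltW ->].
Qed.

Lemma mu_cube_cell0 a l k x : (0 < l)%R ->
  mu (cube (corner a l k x) (l / 2 ^+ k) `\` cell a l k x) = 0.
Proof.
move=> l0; have sub := @cell_sub_cube a l k x l0.
have mc := measurable_cube (corner a l k x) (l / 2 ^+ k).
have mc' := @measurable_cell a l k x l0.
have muc := mu_cube (corner a l k x) (half_pow_gt0 k l0).
set A := cube _ _ in mc muc sub *; set B := cell _ _ _ _ in mc' sub *.
have -> : mu (A `\` B) = mu A - mu (A `&` B).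
  have mfin : mu A < +oo by rewrite muc ltry.
  exact: measureD.
by rewrite (setIidr sub) muc mu_cell// -EFinB subrr.
Qed.

Lemma cube_cellS a l k x : (0 < l)%R ->
  (cube (corner a l k.+1 x) (l / 2 ^+ k.+1) : set E) `<=` cube (corner a l k x) (l / 2 ^+ k).
Proof.
move=> l0 y hy i; have /andP[h1 h2] := hy i.
have h0 := half_pow_gt0 k l0.
have hS : (l / 2 ^+ k = l / 2 ^+ k.+1 * 2)%R.
  by rewrite exprS invfM; field.
move: h1 h2; rewrite !tnth_mktuple hS.
set h := (l / 2 ^+ k.+1)%R.
have h'0 : (0 < h)%R by exact: half_pow_gt0.
set z := ((tnth x i - tnth a i) / (h * 2))%R.
have -> : ((tnth x i - tnth a i) / h = z * 2)%R.
  by rewrite /z; field; rewrite gt_eqF.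
set m := Num.floor (z * 2); set j := Num.floor z.
have h1 : (j%:~R * 2 <= m%:~R :> R)%R.
  rewrite -[X in (_ * X <= _)%R]/(2%:~R) -intrM ler_int floor_ge_int intrM.
  by rewrite ler_pM2r// floor_le.
have h2 : (m%:~R + 1 <= (j%:~R + 1) * 2 :> R)%R.
  rewrite -[X in (_ * X)%R]/(2%:~R) -[X in (_ + X <= _)%R]/(1%:~R).
  rewrite -[X in ((_ + X) * _)%R]/(1%:~R) -!intrD -intrM ler_int lezD1.
  rewrite floor_lt_int intrM ltr_pM2r// floorD1_gt//.
by move=> h3 h4; apply/andP; split; nra.
Qed.

Lemma nested_cell a l : (0 < l)%R -> nested_cells (cell_idx a l : nat -> E -> _).
Proof.
by move=> l0; split=> [k x y|k x]; [exact: cell_nestS|exact: measurable_cell].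
Qed.

End cells.

(** * Outer regularity with respect to cell-open sets *)

Section grid_open.
Context {R : realType} {n : nat}.
Local Notation E := (Rn R n).
Local Notation borelR := (measurableTypeR R).
Variables (a : n.-tuple R) (l : R).
Hypothesis l0 : (0 < l)%R.
Local Notation cell := (cell a l).

Local Notation gopen := (@gopen E _ (cell_idx a l)).
Let HC := nested_cell a l0.

Lemma cell_close (x : E) (e : R) : (0 < e)%R ->
  exists k, forall y i, cell k x y -> (`|tnth y i - tnth x i| < e)%R.
Proof.
(* The power [2 ^+ k] is at least [k.+1], which exceeds [l / e]. *)
move=> e0; pose k := Num.truncn (l / e); exists k => y i.
have hk : (l / 2 ^+ k < e)%R.
  rewrite ltr_pdivrMr ?exprn_gt0// mulrC -ltr_pdivrMr//.
  apply: (lt_le_trans (truncnS_gt _)); rewrite -/k -natrX ler_nat.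
  exact: ltn_expl.
move=> hy; have := cell_refl a l k x; move: hy; rewrite cell_box//.
move=> /(_ i) + /(_ i); rewrite /= !in_itv/=; set c := tnth (corner _ _ _ _) i.
move=> /andP[h1 h2] /andP[h3 h4]; apply: lt_trans hk.
by rewrite ltr_distl; apply/andP; split; lra.
Qed.

Lemma gopen_gt (i : 'I_n) (t : R) : gopen [set x : E | (t < tnth x i)%R].
Proof.
move=> x /= tx; have e0 : (0 < tnth x i - t)%R by rewrite subr_gt0.
have [k hk] := cell_close x e0; exists k => y /hk-/(_ i)/=.
by rewrite ltr_distl => /andP[+ _]; rewrite opprB addrCA subrr addr0.
Qed.

Lemma gopen_lt (i : 'I_n) (t : R) : gopen [set x : E | (tnth x i < t)%R].
Proof.
move=> x /= tx; have e0 : (0 < t - tnth x i)%R by rewrite subr_gt0.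
have [k hk] := cell_close x e0; exists k => y /hk-/(_ i)/=.
by rewrite ltr_distl => /andP[_]; rewrite addrCA subrr addr0.
Qed.

Section approx.
Variable nu : {measure set E -> \bar R}.
Hypothesis nuoo : nu setT < +oo.

Definition outer_app (B : set E) := forall e : R, (0 < e)%R ->
  exists U, [/\ gopen U, B `<=` U & nu (U `\` B) <= e%:E].

(** Requiring the approximation of the complement too makes the class stable under complements at
    once. Countable unions are then the point: the complement of a finite partial union is close to
    that of the whole union because [nu] is finite. *)
Let G : set (set E) := [set B | [/\ measurable B, outer_app B & outer_app (~` B)]].

Let nufin A : measurable A -> nu A < +oo.
Proof. by move=> mA; apply: le_lt_trans nuoo; apply: le_measure; rewrite ?inE. Qed.

Let small_tail (D : nat -> set E) (e : R) : (0 < e)%R -> (forall i, measurable (D i)) ->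
  nonincreasing_seq D -> \bigcap_i D i = set0 -> exists N, nu (D N) <= e%:E.
Proof.
move=> e0 mD niD D0.
have : nu \o D @ \oo --> nu (\bigcap_i D i).
  by apply: nonincreasing_cvg_mu => //; [exact: nufin|exact: bigcapT_measurable].
rewrite D0 measure0 => /fine_cvgP[_ /cvgrPdist_lt /(_ _ e0)[N _ /(_ _ (leqnn N))]].
rewrite /= sub0r normrN => hN; exists N.
rewrite -[leLHS]fineK ?ge0_fin_numE ?nufin// lee_fin.
by apply: le_trans (ltW hN); rewrite ler_norm.
Qed.

Let app_bigcup (B : nat -> set E) : (forall i, measurable (B i)) ->
  (forall i, outer_app (B i)) -> outer_app (\bigcup_i B i).
Proof.
move=> mB aB e e0.
have ei i : (0 < e / 2 ^+ i.+1)%R by rewrite divr_gt0// exprn_gt0.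
pose U i := projT1 (cid (aB i _ (ei i))).
have UP i : [/\ gopen (U i), B i `<=` U i & nu (U i `\` B i) <= (e / 2 ^+ i.+1)%:E].
  exact: (projT2 (cid (aB i _ (ei i)))).
exists (\bigcup_i U i); split.
- by apply: gopen_bigcup => i; have [] := UP i.
- by move=> x [i _ Bx]; exists i => //; have [_ + _] := UP i; exact.
apply: (@le_trans _ _ (\sum_(i <oo) nu (U i `\` B i))).
  apply: measure_sigma_subadditive.
  + by move=> i; apply: measurableD => //; apply: (measurable_gopen HC); have [] := UP i.
  + apply: measurableD; last exact: bigcupT_measurable.
    by apply: bigcupT_measurable => i; apply: (measurable_gopen HC); have [] := UP i.
  + by move=> x [[i _ Ux] nB]; exists i => //; split => // Bx; apply: nB; exists i.
apply: (@le_trans _ _ (\sum_(i <oo) (e / 2 ^+ i.+1)%:E)).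
  by apply: lee_nneseries => // i _; have [] := UP i.
have := epsilon_trick0 (xpredT) (ltW e0).
apply: le_trans; apply: lee_nneseries => [i _|i _].
  by rewrite lee_fin divr_ge0// ltW.
by rewrite lee_fin natrX.
Qed.

Let G_setU A B : G A -> G B -> G (A `|` B).
Proof.
move=> [mA aA aA'] [mB aB aB']; split; first exact: measurableU.
  rewrite -bigcup2E; apply: app_bigcup.
    by move=> [|[|i]]//=; exact: measurable0.
  move=> [|[|i]]//= e e0; exists set0; split => //.
  by rewrite set0D measure0 lee_fin ltW.
move=> e e0; have e20 : (0 < e / 2)%R by rewrite divr_gt0.
have [U [oU AU hU]] := aA' _ e20; have [V [oV BV hV]] := aB' _ e20.
exists (U `&` V); split; first exact: (gopenI HC).
  by rewrite setCU; exact: setISS.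
apply: (@le_trans _ _ (nu ((U `\` ~` A) `|` (V `\` ~` B)))).
  have mU : measurable (U : set E) := measurable_gopen HC oU; have mV : measurable (V : set E) := measurable_gopen HC oV.
  apply: le_measure; rewrite ?inE.
  - by apply: measurableD; [exact: measurableI|apply: measurableC; exact: measurableU].
  - by apply: measurableU; apply: measurableD => //; exact: measurableC.
  - move=> x [[Ux Vx]]; rewrite setCU /= => h.
    have [Ax|nAx] := pselect (A x); first by left; split => //; apply.
    by right; split => // nBx; exact: h.
rewrite (splitr e) EFinD; apply: le_trans (leeD hU hV).
apply: measureU2; apply: measurableD.
- exact: (measurable_gopen HC).
- exact: measurableC.
- exact: (measurable_gopen HC).
- exact: measurableC.
Qed.

Let G_bigcup (B : nat -> set E) : (forall i, G (B i)) -> G (\bigcup_i B i).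
Proof.
move=> GB; have mB i : measurable (B i) by have [] := GB i.
split; first exact: bigcupT_measurable.
  by apply: app_bigcup => // i; have [] := GB i.
move=> e e0; have e20 : (0 < e / 2)%R by rewrite divr_gt0.
pose C N := \bigcup_(i < N.+1) B i.
have GC N : G (C N).
  elim: N => [|N IH]; first by rewrite /C bigcup_mkord big_ord_recl big_ord0 setU0.
  by rewrite /C bigcup_mkord big_ord_recr /= -bigcup_mkord; exact: G_setU.
have mC N : measurable (C N) by have [] := GC N.
have CB : \bigcup_N C N = \bigcup_i B i.
  apply/seteqP; split => x; first by move=> [N _ [i _ Bx]]; exists i.
  by move=> [i _ Bx]; exists i => //; exists i => //=.
have [N hN] : exists N, nu (~` C N `\` ~` (\bigcup_i B i)) <= (e / 2)%:E.
  apply: (small_tail (D := fun N => ~` C N `\` ~` (\bigcup_i B i))) => //.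
  - by move=> i; apply: measurableD; apply: measurableC => //; exact: bigcupT_measurable.
  - move=> i j ij; apply/subsetPset => x [nC nB]; split => // -[k /= ki Bx].
    by apply: nC; exists k => //=; exact: leq_trans ij.
  - apply/seteqP; split => // x h; have [_ /contrapT] := h 0%N I.
    by rewrite -CB => -[N _ CNx]; have [] := h N I.
have [_ _ /(_ _ e20)[U [oU CU hU]]] := GC N.
exists U; split => //.
  by rewrite -CB; move=> x nx; apply: CU => Cx; apply: nx; exists N.
have mU : measurable (U : set E) := measurable_gopen HC oU.
have m1 : measurable (U `\` ~` C N).
  by apply: measurableD; [exact: mU|apply: measurableC].
have m2 : measurable (~` C N `\` ~` (\bigcup_i B i)).
  by apply: measurableD; apply: measurableC => //; exact: bigcupT_measurable.
apply: (@le_trans _ _ (nu ((U `\` ~` C N) `|` (~` C N `\` ~` (\bigcup_i B i))))).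
  apply: le_measure; rewrite ?inE//; last 2 first.
  - exact: measurableU.
  - move=> x [Ux nB]; have [Cx|nCx] := pselect (C N x); last by right.
    by left; split => //; apply.
  - by apply: measurableD => //; apply: measurableC; exact: bigcupT_measurable.
rewrite (splitr e) EFinD; apply: (le_trans (measureU2 _ _ _)) => //.
exact: leeD.
Qed.

Let G_setC B : G B -> G (~` B).
Proof. by move=> [mB aB aB']; split; rewrite ?setCK//; exact: measurableC. Qed.

Let app_gopen U : gopen U -> outer_app U.
Proof. by move=> oU e e0; exists U; split => //; rewrite setDv measure0 lee_fin ltW. Qed.

Let G_ray i t : G [set x : E | (t < tnth x i)%R].
Proof.
have oU : gopen [set x : E | (t < tnth x i)%R] by exact: gopen_gt.
split; [exact: (measurable_gopen HC)|exact: app_gopen|].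
(* The complement is a closed half-space, approximated by slightly larger open ones. *)
pose V k := [set x : E | (tnth x i < t + k.+1%:R^-1)%R].
have oV k : gopen (V k) by exact: gopen_lt.
have -> : ~` [set x : E | (t < tnth x i)%R] = \bigcap_k V k.
  apply/seteqP; split => x /=.
    by move=> /negP; rewrite -leNgt => h k _ /=; rewrite /V /= (le_lt_trans h)// ltrDl.
  move=> h; apply/negP; rewrite -leNgt; apply/ler_addgt0Pr => e e0.
  pose k := Num.truncn e^-1; apply: (le_trans (ltW (h k I))); rewrite lerD2l.
  rewrite -[leRHS]invrK lef_pV2 ?posrE ?invr_gt0//.
  by apply/ltW; rewrite truncnS_gt.
have mV : measurable (\bigcap_k V k).
  by apply: bigcapT_measurable => k; exact: (measurable_gopen HC).
move=> e e0; have [N hN] : exists N, nu (V N `\` \bigcap_k V k) <= e%:E.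
  apply: (small_tail (D := fun N => V N `\` \bigcap_k V k)) => //.
  - by move=> k; apply: measurableD => //; exact: (measurable_gopen HC).
  - move=> j k jk; apply/subsetPset => x [Vx nV]; split => //.
    by apply: (lt_le_trans Vx); rewrite lerD2l lef_pV2 ?posrE// ler_nat.
  - apply/seteqP; split => // x h; have [_] := h 0%N I; apply => k _.
    by have [] := h k I.
by exists (V N); split => // x; exact.
Qed.

Lemma outer_app_borel (B : set (n.-tuple borelR)) : measurable B -> outer_app B.
Proof.
suff H : (@measurable _ (n.-tuple borelR)) `<=` G by move=> /H[].
have sG : sigma_algebra setT G.
  split; [|by move=> A /G_setC; rewrite setTD|exact: G_bigcup].
  split; [exact: measurable0| |].
    move=> e e0; exists set0; split => //.
    by rewrite set0D measure0 lee_fin ltW.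
  by rewrite setC0; apply: app_gopen => x _; exists 0%N.
(* The Borel sets of tuples are generated by preimages of Borel sets under the coordinates, and
   these by open rays. *)
clear B; apply: smallest_sub => // B.
rewrite -bigcup_seq => -[i _ /= [A mA <-]]; rewrite setTI.
move: A mA; have -> : @measurable _ borelR = <<s @RGenOInfty.G R >>.
  exact: RGenOInfty.measurableE.
suff H : <<s @RGenOInfty.G R >> `<=` [set A | G ((fun x : E => tnth x i) @^-1` A)] by exact: H.
apply: smallest_sub.
  have [s0 sC sU] := sG; split.
  - by rewrite /= preimage_set0.
  - by move=> A /sC; rewrite /= !setTD preimage_setC.
  - by move=> F /sU; rewrite /= preimage_bigcup.
move=> _ [t ->]; rewrite /=.
suff -> : (fun x : E => tnth x i) @^-1` `]t, +oo[ = [set x : E | (t < tnth x i)%R].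
  exact: G_ray.
by apply/seteqP; split => x /=; rewrite in_itv/= andbT.
Qed.

End approx.
End grid_open.

(** The Borel hull of [S] differs from [S] by a [mu]-null set, which is [nu]-null, so approximating
    the hull is enough. *)
Lemma outer_approx_cell (R : realType) n (a : n.-tuple R) (l : R) : (0 < l)%R ->
  outer_approx (lebesgue_n R n) (cell_idx a l : nat -> Rn R n -> _).
Proof.
move=> l0 nu nuoo nu_mu S mS Soo e e0.
have [B [mB SB B0]] := sub_borel_eq_mu mS Soo.
have mBE : measurable (B : set (Rn R n)) := borel_measurable_Rn mB.
have [U [oU BU hU]] := @outer_app_borel R n a l l0 nu nuoo B mB _ e0.
have mU : measurable (U : set (Rn R n)) := measurable_gopen (nested_cell a l0) oU.
exists U; split => //; first exact: subset_trans BU.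
apply: (@le_trans _ _ (nu ((U `\` B) `|` (B `\` S)))).
  apply: le_measure; rewrite ?inE//.
  - exact: measurableD.
  - by apply: measurableU; exact: measurableD.
  - move=> x [Ux nS]; have [Bx|nB] := pselect (B x); first by right.
    by left.
apply: (le_trans (measureU2 _ _ _)); [exact: measurableD|exact: measurableD|].
have h0 : nu (B `\` S) <= 0.
  by have -> : nu (B `\` S) = 0 by apply: nu_mu => //; exact: measurableD.
by apply: (le_trans (leeD hU h0)); rewrite adde0.
Qed.

(** * Differentiation and reverse Hoelder inequalities along cells *)

Section null_comparison.
Context d (T : measurableType d) (R : realType) (mu : {measure set T -> \bar R}).

Lemma integral_lt_null (S : set T) (f g : T -> R) : measurable S ->
  measurable_fun setT f -> measurable_fun setT g ->
  (forall x, 0 <= f x)%R -> (forall x, 0 <= g x)%R ->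
  \int[mu]_(x in S) (f x)%:E <= \int[mu]_(x in S) (g x)%:E ->
  \int[mu]_(x in S) (g x)%:E < +oo ->
  (forall x, S x -> g x < f x)%R -> mu S = 0.
Proof.
move=> mS mf mg f0 g0 fg goo gf.
have mfg : measurable_fun S (fun x => (f x - g x)%:E).
  by apply/measurable_EFinP; apply: measurable_funTS; exact: measurable_funB.
have fg0 x : S x -> 0 <= (f x - g x)%:E.
  by move=> Sx; rewrite lee_fin subr_ge0 ltW// gf.
have e : \int[mu]_(x in S) (f x)%:E =
    \int[mu]_(x in S) (g x)%:E + \int[mu]_(x in S) (f x - g x)%:E.
  rewrite -ge0_integralD//.
  - by apply: eq_integral => x _; rewrite -EFinD addrC subrK.
  - by move=> x _; rewrite lee_fin.
  - by apply/measurable_EFinP; exact: measurable_funTS.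
have gfin : \int[mu]_(x in S) (g x)%:E \is a fin_num.
  by rewrite ge0_fin_numE// integral_ge0// => x _; rewrite lee_fin.
have : \int[mu]_(x in S) (f x - g x)%:E = 0.
  apply/eqP; rewrite eq_le integral_ge0// andbT.
  by move: fg; rewrite e -[leRHS]adde0 leeD2lE.
have -> : \int[mu]_(x in S) (f x - g x)%:E = \int[mu]_(x in S) `|(f x - g x)%:E|.
  by apply: eq_integral => x /[!inE] Sx; rewrite gee0_abs// fg0.
move=> /(ae_eq_integral_abs mu mS mfg).
move=> [N [mN N0 SN]]; apply/eqP; rewrite eq_le measure_ge0 andbT -[leRHS]N0.
apply: le_measure; rewrite ?inE// => x Sx; apply: SN => /= /(_ Sx) [] /eqP.
by apply/negP; rewrite gt_eqF// subr_gt0 gf.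
Qed.

Lemma measurable_set_lt (f g : T -> R) : measurable_fun setT f -> measurable_fun setT g ->
  measurable [set x | f x < g x]%R.
Proof.
move=> mf mg; have := measurable_fun_ltr mf mg measurableT (Y := [set true]).
move=> /(_ I); rewrite setTI; congr measurable.
Qed.

End null_comparison.

Section density.
Context d (T : measurableType d) (R : realType) (mu : {measure set T -> \bar R}).

(** The two proofs are arguments so that the set function can carry a measure structure; continuity
    along monotone sequences of sets then applies to integrals. *)
Definition dens (f : T -> \bar R) of measurable_fun setT f & (forall x, 0 <= f x) :
  set T -> \bar R := fun A => \int[mu]_(x in A) f x.

Section inst.
Variables (f : T -> \bar R) (mf : measurable_fun setT f) (f0 : forall x, 0 <= f x).

Let dens0 : dens mf f0 set0 = 0. Proof. by rewrite /dens integral_set0. Qed.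

Let dens_ge0 A : 0 <= dens mf f0 A. Proof. exact: integral_ge0. Qed.

Let dens_sigma_additive : semi_sigma_additive (dens mf f0).
Proof.
move=> F mF tF mUF; rewrite /dens ge0_integral_bigcup//.
  by apply: is_cvg_ereal_nneg_natsum_cond => // k _ _; exact: integral_ge0.
exact: measurable_funTS.
Qed.

HB.instance Definition _ := isMeasure.Build _ _ _ (dens mf f0)
  dens0 dens_ge0 dens_sigma_additive.
End inst.

End density.

Section differentiation.
Context d (T : measurableType d) (R : realType) (mu : {measure set T -> \bar R}).
Context (I : countType) (idx : nat -> T -> I).
Hypotheses (HI : nested_cells idx) (HA : outer_approx mu idx).
Local Notation cell := (dcell idx).
Variables (w1 w2 : T -> R) (lam : R) (x0 : T).
Hypotheses (mw1 : measurable_fun setT w1) (mw2 : measurable_fun setT w2).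
Hypotheses (w10 : forall x, (0 <= w1 x)%R) (w20 : forall x, (0 <= w2 x)%R).
Hypothesis lam0 : (0 <= lam)%R.
Local Notation Q := (cell 0%N x0).
Hypotheses (muQ : mu Q < +oo) (w1oo : \int[mu]_(x in Q) (w1 x)%:E < +oo)
  (w2oo : \int[mu]_(x in Q) (w2 x)%:E < +oo).

Definition bad_cell k : set T := [set x |
  lam%:E * \int[mu]_(y in cell k x) (w2 y)%:E < \int[mu]_(y in cell k x) (w1 y)%:E].

Lemma bad_cellP k x y : cell k x y -> bad_cell k x -> bad_cell k y.
Proof. by move=> xy; rewrite /bad_cell /= (dcell_eq xy). Qed.

Lemma measurable_bad_cells : measurable (\bigcup_k bad_cell k).
Proof. exact: (measurable_stop HI bad_cellP). Qed.

(** Let [S] be the exceptional set, covered by a cell-open set with small excess. The maximal cells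
    inside the cover that meet [S] are not bad, so on their union the integral of [w1] is at most
    [lam] times that of [w2]. As the excess vanishes the same holds on [S], where the opposite
    strict inequality is pointwise; hence [S] is null. *)
Lemma cell_differentiation :
  {ae mu, forall x, Q x -> ~ (\bigcup_k bad_cell k) x -> (w1 x <= lam * w2 x)%R}.
Proof.
pose S : set T := (Q `\` \bigcup_k bad_cell k) `&` [set x | lam * w2 x < w1 x]%R.
have mQ : measurable Q by exact: HI.2.
have mlw2 : measurable_fun setT (fun x => lam * w2 x)%R.
  by apply: measurable_funM => //; exact: measurable_cst.
have mS : measurable S.
  apply: measurableI; first by apply: measurableD => //; exact: measurable_bad_cells.
  exact: measurable_set_lt.
suff S0 : mu S = 0.
  exists S; split => // x /= h; apply: contrapT => nS; apply: h => Qx nb.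
  by rewrite leNgt; apply/negP => h; apply: nS; split.
have SQ : S `<=` Q by move=> x [[]].
(* Restricting the density to [Q] makes [nu] finite, as outer approximation requires. *)
pose f := fun x => ((w1 x + w2 x)%:E) * (\1_Q x)%:E.
have mw1' : measurable_fun setT (EFin \o w1) by exact/measurable_EFinP.
have mw2' : measurable_fun setT (EFin \o w2) by exact/measurable_EFinP.
have mf : measurable_fun setT f.
  apply: emeasurable_funM; apply/measurable_EFinP.
    exact: measurable_funD.
  exact: measurable_indic.
have f0 x : 0 <= f x.
  by rewrite mule_ge0// lee_fin ?addr_ge0//.
pose nu : {measure set T -> \bar R} := dens mu mf f0.
have nuE A : nu A = \int[mu]_(x in A `&` Q) (w1 x + w2 x)%:E.
  rewrite /nu /dens [RHS]integral_mkcondr; apply: eq_integral => x _.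
  by rewrite /f /patch indicE; case: ifPn; rewrite ?mule1 ?mule0.
have i12 A : measurable A -> \int[mu]_(x in A) (w1 x + w2 x)%:E =
    \int[mu]_(x in A) (w1 x)%:E + \int[mu]_(x in A) (w2 x)%:E.
  move=> mA; rewrite -ge0_integralD//.
  - by move=> x _; rewrite lee_fin.
  - exact: measurable_funTS.
  - by move=> x _; rewrite lee_fin.
  - exact: measurable_funTS.
have nuoo : nu setT < +oo by rewrite nuE setTI i12// lte_add_pinfty.
have muSoo : mu S < +oo.
  apply: (@le_lt_trans _ _ (mu Q)); first by apply: le_measure; rewrite ?inE.
  exact: muQ.
have nu_mu A : measurable A -> mu A = 0 -> nu A = 0.
  by move=> mA A0; rewrite /nu /= /dens null_set_integral//; exact: measurable_funTS.
have mw (A : set T) (w : T -> R) : (forall x, (0 <= w x)%R) -> forall x, A x -> 0 <= (w x)%:E.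
  by move=> h x _; rewrite lee_fin.
apply: (@integral_lt_null _ _ _ mu S w1 (fun x => lam * w2 x)%R) => //.
- by move=> x; rewrite mulr_ge0.
- apply/lee_addgt0Pr => e e0.
  have e'0 : (0 < e / (lam + 1))%R by rewrite divr_gt0// ltr_wpDl.
  have [U [oU SU hU]] := HA nuoo nu_mu mS muSoo e'0.
  have mU := measurable_gopen HI oU.
  (* A cell that meets [S] contains a point lying in no bad cell, so it is not bad itself. *)
  pose P k : set T := [set x | [/\ cell k x `<=` U, cell k x `<=` Q &
    exists2 s, S s & cell k x s]].
  have Pcell k x y : cell k x y -> P k x -> P k y.
    by move=> xy; rewrite /P /= (dcell_eq xy).
  have mU' := measurable_stop HI Pcell.
  set U' := \bigcup_k P k in mU'.
  have SU' : S `<=` U'.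
    move=> x Sx; have [k kU] := oU x (SU _ Sx).
    exists k => //; split => //; last by exists x.
    apply: (@subset_trans _ (cell 0%N x)); first exact: dcell_nest.
    by rewrite (dcell_eq (SQ _ Sx)).
  have U'UQ : U' `<=` U `&` Q.
    by move=> x [k _ [kU kQ _]]; split; [apply: kU|apply: kQ]; by [].
  have step : \int[mu]_(x in U') (w1 x)%:E <= \int[mu]_(x in U') (lam * w2 x)%:E.
    apply: (stop_integral_le HI Pcell) => //.
    - exact/measurable_EFinP.
    - by move=> x; rewrite lee_fin mulr_ge0.
    - move=> k x [_ _ [s [[Qs nb] _] xs]] _; rewrite -(dcell_eq xs).
      have : ~ bad_cell k s by move=> b; apply: nb; exists k.
      move=> /negP; rewrite -leNgt => /le_trans; apply.
      rewrite -ge0_integralZl_EFin//; first exact: HI.2.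
        by move=> y _; rewrite lee_fin.
      by apply: measurable_funTS.
  apply: (@le_trans _ _ (\int[mu]_(x in U') (lam * w2 x)%:E)).
    apply: le_trans step; apply: ge0_subset_integral => //.
      exact: measurable_funTS.
    by move=> x _; rewrite lee_fin.
  have mD : measurable (U' `\` S) by exact: measurableD.
  have -> : \int[mu]_(x in U') (lam * w2 x)%:E = \int[mu]_(x in S) (lam * w2 x)%:E +
      \int[mu]_(x in U' `\` S) (lam * w2 x)%:E.
    rewrite -ge0_integral_setU ?setDUK//.
    - by apply: measurable_funTS; exact/measurable_EFinP.
    - by move=> x _; rewrite lee_fin mulr_ge0.
    - by rewrite disj_set2E setDIK.
  apply: leeD2l.
  apply: (@le_trans _ _ (lam%:E * nu (U' `\` S))).
    rewrite nuE.
    have -> : (U' `\` S) `&` Q = U' `\` S.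
      by apply: setIidl => x [/U'UQ[]].
    rewrite i12// muleDr//; last first.
    - by rewrite ge0_adde_def// ?inE integral_ge0// => x _; rewrite lee_fin.
    rewrite -[leLHS]add0e leeD//.
      by rewrite mule_ge0 ?lee_fin// integral_ge0// => x _; rewrite lee_fin.
    rewrite -ge0_integralZl_EFin//; first by move=> y _; rewrite lee_fin.
    exact: measurable_funTS.
  have -> : e = ((lam + 1) * (e / (lam + 1)))%R.
    by rewrite mulrC divfK// gt_eqF// ltr_wpDl.
  rewrite EFinM; apply: lee_pmul; rewrite ?lee_fin//; first by rewrite lerDl.
  apply: le_trans hU; apply: le_measure; rewrite ?inE//; first exact: measurableD.
  by move=> x [/U'UQ[Ux _] nS].
- under eq_integral do rewrite EFinM.
  rewrite ge0_integralZl_EFin//.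
  - rewrite lte_mul_pinfty ?lee_fin//.
    apply: le_lt_trans w2oo; apply: ge0_subset_integral => // [|x _].
      exact: measurable_funTS.
    by rewrite lee_fin.
  - by move=> x _; rewrite lee_fin.
  - exact: measurable_funTS.
- by move=> x [].
Qed.

End differentiation.

Section weighted_measure.
Context d (T : measurableType d) (R : realType) (mu : {measure set T -> \bar R}).
Implicit Types (w : T -> R) (A B : set T).

Definition wint w A : \bar R := \int[mu]_(x in A) (w x)%:E.

Definition nnw w := measurable_fun setT w /\ forall x, (0 <= w x)%R.
(** Positivity is asked at every point, so that quotients and negative powers need no exceptional
    set; a weight is given such a representative in [posw_representative]. *)
Definition posw w := measurable_fun setT w /\ forall x, (0 < w x)%R.

Lemma posw_nnw w : posw w -> nnw w.
Proof. by move=> [mw w0]; split => // x; exact: ltW. Qed.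

Lemma posw_powR w (p : R) : posw w -> posw (fun x => w x `^ p)%R.
Proof.
move=> [mw w0]; split; last by move=> x; rewrite powR_gt0.
exact: (measurableT_comp (measurable_powR _)).
Qed.

Lemma posw_inv w : posw w -> posw (fun x => (w x)^-1)%R.
Proof.
move=> pw; have [m _] := posw_powR (-1) pw; split; last by move=> x; rewrite invr_gt0 pw.2.
by under eq_fun do rewrite -powR_inv1 ?(ltW (pw.2 _))//.
Qed.

Lemma posw_mul w w' : posw w -> posw w' -> posw (fun x => w x * w' x)%R.
Proof.
move=> [mw w0] [mw' w'0]; split; last by move=> x; rewrite mulr_gt0.
exact: measurable_funM.
Qed.

Lemma nnw_mE w : nnw w -> forall A, measurable_fun A (fun x => (w x)%:E).
Proof. by move=> [mw _] A; apply: measurable_funTS; exact/measurable_EFinP. Qed.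

Lemma nnw_ge0 w : nnw w -> forall x, 0 <= (w x)%:E.
Proof. by move=> [_ w0] x; rewrite lee_fin. Qed.

Lemma wint_ge0 w A : nnw w -> 0 <= wint w A.
Proof. by move=> nw; apply: integral_ge0 => x _; exact: nnw_ge0. Qed.

Lemma wint_sub w A B : nnw w -> measurable A -> measurable B -> A `<=` B ->
  wint w A <= wint w B.
Proof.
move=> nw mA mB AB; apply: ge0_subset_integral => //; first exact: nnw_mE.
by move=> x _; exact: nnw_ge0.
Qed.

Lemma wint_setD w A B : nnw w -> measurable A -> measurable B -> A `<=` B ->
  wint w B = wint w A + wint w (B `\` A).
Proof.
move=> nw mA mB AB; rewrite /wint -ge0_integral_setU ?setDUK//.
- exact: measurableD.
- exact: nnw_mE.
- by move=> x _; exact: nnw_ge0.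
- by rewrite disj_set2E setDIK.
Qed.

Lemma wint_null w A : nnw w -> measurable A -> mu A = 0 -> wint w A = 0.
Proof. by move=> nw mA A0; apply: null_set_integral => //; exact: nnw_mE. Qed.

Lemma posw_null w A : posw w -> measurable A -> wint w A = 0 -> mu A = 0.
Proof.
move=> pw mA wA.
apply: (@integral_lt_null _ _ _ mu A w (cst 0%R)) => //.
- exact: pw.1.
- by move=> x; exact: ltW (pw.2 x).
- by rewrite -/(wint w A) wA; apply: integral_ge0.
- by rewrite integral0_eq//; move=> x _.
- by move=> x _; exact: pw.2.
Qed.

Lemma wint_fin w A Q : nnw w -> measurable A -> measurable Q -> A `<=` Q ->
  wint w Q < +oo -> wint w A = (fine (wint w A))%:E.
Proof.
move=> nw mA mQ AQ Qoo; rewrite fineK// ge0_fin_numE ?wint_ge0//.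
by apply: le_lt_trans Qoo; exact: wint_sub.
Qed.

Lemma le_wint w1 w2 A (c : R) : nnw w1 -> nnw w2 -> measurable A -> (0 <= c)%R ->
  {ae mu, forall x, A x -> (w1 x <= c * w2 x)%R} ->
  wint w1 A <= c%:E * wint w2 A.
Proof.
move=> n1 n2 mA c0 h; rewrite /wint -ge0_integralZl_EFin//.
- apply: ae_ge0_le_integral; first exact: mA.
  + by move=> x _; exact: nnw_ge0.
  + exact: nnw_mE.
  + by move=> x _; rewrite mule_ge0 ?lee_fin// n2.2.
  + by apply: measurable_funeM; exact: nnw_mE.
  + by apply: filterS h => x h Ax; rewrite -EFinM lee_fin h.
- by move=> x _; exact: nnw_ge0.
- exact: nnw_mE.
Qed.

Section stop.
Context (I : countType) (idx : nat -> T -> I).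
Hypothesis HI : nested_cells idx.
Local Notation cell := (dcell idx).

Lemma stop_wint_le (P : nat -> set T) w1 w2 A B (c : R) :
  (forall k x y, cell k x y -> P k x -> P k y) ->
  nnw w1 -> nnw w2 -> measurable A -> measurable B -> (0 <= c)%R ->
  (forall k x, P k x -> (forall j, (j < k)%N -> ~ P j x) ->
    wint w1 (cell k x `&` A) <= c%:E * wint w2 (cell k x `&` B)) ->
  wint w1 ((\bigcup_k P k) `&` A) <= c%:E * wint w2 ((\bigcup_k P k) `&` B).
Proof.
move=> Pcell n1 n2 mA mB c0 H.
have mr w C : nnw w -> measurable C -> measurable_fun setT (fun x => ((w \_ C) x)%:E).
  move=> nw mC; apply/measurable_EFinP; apply/(measurable_restrictT _ mC).
  by apply: measurable_funTS; exact: nw.1.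
have r0 w C : nnw w -> forall x, (0 <= (w \_ C) x)%R.
  by move=> nw x; rewrite /patch; case: ifPn => // _; exact: nw.2.
have E w C D : wint w (D `&` C) = \int[mu]_(x in D) ((w \_ C) x)%:E.
  rewrite /wint integral_mkcondr; apply: eq_integral => x _.
  by rewrite /patch; case: ifPn.
have Z w C D : nnw w -> measurable C -> measurable D -> c%:E * wint w (D `&` C) =
    \int[mu]_(x in D) ((c * (w \_ C) x)%:E).
  move=> nw mC mD; rewrite E -ge0_integralZl_EFin//.
  - by move=> x _; rewrite lee_fin r0.
  - by apply: measurable_funTS; exact: mr.
rewrite Z//; last exact: (measurable_stop HI Pcell).
rewrite E; apply: (stop_integral_le HI Pcell).
- exact: mr.
- under eq_fun do rewrite EFinM.
  by apply: measurable_funeM; exact: mr.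
- by move=> x; rewrite lee_fin r0.
- by move=> x; rewrite lee_fin mulr_ge0// r0.
- by move=> k x Px nP; rewrite -E -Z//; [exact: H|exact: HI.2].
Qed.

End stop.
End weighted_measure.

Section reverse_hoelder.
Context d (T : measurableType d) (R : realType) (mu : {measure set T -> \bar R}).
Context (I : countType) (idx : nat -> T -> I).
Hypotheses (HI : nested_cells idx) (HA : outer_approx mu idx).
Local Notation cell := (dcell idx).
Local Notation wint := (wint mu).
Variables (w1 w2 : T -> R) (x0 : T) (D eps th rho : R).
Local Notation Q := (cell 0%N x0).
Hypotheses (p1 : posw w1) (p2 : posw w2) (muQ : mu Q < +oo)
  (w1oo : wint w1 Q < +oo) (w2oo : wint w2 Q < +oo).
Hypotheses (D2 : (2 <= D)%R) (eps0 : (0 < eps)%R) (eps1 : (eps <= 1)%R)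
  (th0 : (0 < th)%R) (th1 : (th < 1)%R) (rho0 : (0 < rho)%R).
Hypothesis doubl : forall k x, Q x -> wint w2 (cell k x) <= D%:E * wint w2 (cell k.+1 x).
Hypothesis ainf : forall k x A, Q x -> measurable A -> A `<=` cell k x ->
  wint w2 A <= eps%:E * wint w2 (cell k x) -> wint w1 A <= th%:E * wint w1 (cell k x).
Hypothesis w12Q : wint w1 Q = rho%:E * wint w2 Q.

Let n1 := posw_nnw p1.
Let n2 := posw_nnw p2.
(** The ratio of successive levels. In a maximal bad cell of level [k] the [w1]-mass is at most
    [D * lam k] times the [w2]-mass, since the parent is not bad; dividing by [lam k.+1] leaves the
    proportion [eps] of the hypothesis [ainf]. *)
Let Lam := (D / eps)%R.
Let lam k : R := (rho * Lam ^+ k)%R.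
Let bad k m : set T := Q `&` bad_cell mu idx w1 w2 (lam k) m.
Let Om k : set T := \bigcup_m bad k m.

Let Lam2 : (2 <= Lam)%R.
Proof.
rewrite /Lam ler_pdivlMr//; apply: le_trans D2.
by rewrite ler_piMr.
Qed.

Let lam0 k : (0 < lam k)%R.
Proof. by rewrite mulr_gt0// exprn_gt0// (lt_le_trans _ Lam2). Qed.

Let mcell k x : measurable (cell k x). Proof. exact: HI.2. Qed.

Let sub_cell k x : Q x -> cell k x `<=` Q.
Proof.
move=> Qx; rewrite -(dcell_eq Qx); exact: (dcell_nest HI).
Qed.

Let bad_dcell k m x y : cell m x y -> bad k m x -> bad k m y.
Proof.
move=> xy [Qx bx]; split; first exact: sub_cell Qx _ xy.
by move: bx; rewrite /bad_cell /= (dcell_eq xy).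
Qed.

Let mOm k : measurable (Om k).
Proof. by apply: (measurable_stop HI) => m x y; exact: bad_dcell. Qed.

Let OmQ k : Om k `<=` Q. Proof. by move=> x [m _ []]. Qed.

Let bad_mono k m x : bad k.+1 m x -> bad k m x.
Proof.
move=> [Qx bx]; split => //; apply: le_lt_trans bx.
apply: lee_wpmul2r; first by apply: wint_ge0.
rewrite lee_fin /lam ler_pM2l// exprS ler_peMl//.
  by rewrite exprn_ge0// (le_trans _ Lam2).
by rewrite (le_trans _ Lam2)// ler1n.
Qed.

Let Om_mono k : Om k.+1 `<=` Om k.
Proof. by move=> x [m _ /bad_mono b]; exists m. Qed.

Let f1 A : measurable A -> A `<=` Q -> wint w1 A = (fine (wint w1 A))%:E.
Proof. by move=> mA AQ; apply: (@wint_fin _ _ _ _ _ _ Q). Qed.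
Let f2 A : measurable A -> A `<=` Q -> wint w2 A = (fine (wint w2 A))%:E.
Proof. by move=> mA AQ; apply: (@wint_fin _ _ _ _ _ _ Q). Qed.

Let Om_decay k : wint w1 (Om k.+1) <= th%:E * wint w1 (Om k).
Proof.
rewrite -(setIidr (@Om_mono k)) -[X in _ * wint w1 X]setIT.
apply: (stop_wint_le HI (@bad_dcell k)) => //; first exact: ltW.
move=> m x [Qx bx] nbx; rewrite setIT.
have cQ := @sub_cell m x Qx.
set A := cell m x `&` Om k.+1.
have mA : measurable A by exact: measurableI.
apply: ainf => //; first by move=> y [].
have : (lam k.+1)%:E * wint w2 A <= wint w1 A.
  (* Bad cells of level [k.+1] are bad at level [k], so those that meet the maximal cell have
     generation at least [m] and are contained in it. *)
  have -> : A = \bigcup_j (cell m x `&` bad k.+1 j `&` [set y | (m <= j)%N]).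
    apply/seteqP; split => y.
      move=> [xy [j _ bj]]; exists j => //; split => //=.
      rewrite leqNgt; apply/negP => jm; apply: (nbx j jm).
      apply: (@bad_dcell k j y x); last exact: bad_mono.
      have := dcell_nest HI (ltnW jm) xy; rewrite /dcell /= => e.
      by rewrite e.
    by move=> [j _ [[xy b] _]]; split => //; exists j.
  set P := fun j => _.
  have Pcell j y z : cell j y z -> P j y -> P j z.
    move=> yz [[xy b] /= mj]; split; last exact: mj.
    split; last exact: bad_dcell b.
    have := dcell_nest HI mj yz; rewrite /dcell /= => ->; exact: xy.
  rewrite -[X in wint w2 X]setIT -[X in _ <= wint w1 X]setIT.
  rewrite -lee_pdivlMl//.
  apply: (stop_wint_le HI Pcell) => //; first by rewrite invr_ge0 ltW.
  move=> j y [[_ [_ b]] _] _; rewrite !setIT lee_pdivlMl//.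
  exact: ltW.
(* The top cell has ratio [rho], which exceeds no level, so it is never bad: the stopping cell has a
   parent. *)
have [m' em] : exists m', m = m'.+1.
  case: m bx {nbx cQ A mA} => [|m' _]; last by exists m'.
  rewrite /bad_cell /= -/(wint w1 _) -/(wint w2 _) (dcell_eq Qx) w12Q.
  move=> h; exfalso; move: h; apply/negP; rewrite -leNgt.
  apply: lee_wpmul2r; first exact: wint_ge0.
  by rewrite lee_fin /lam ler_peMr ?(ltW rho0)// exprn_ege1// (le_trans _ Lam2)// ler1n.
have h1 : wint w1 (cell m x) <= (lam k * D)%:E * wint w2 (cell m x).
  rewrite em; apply: (@le_trans _ _ (wint w1 (cell m' x))).
    by apply: wint_sub => //; apply: (dcell_nest HI).
  have nb : ~ bad k m' x by apply: nbx; rewrite em.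
  apply: (@le_trans _ _ ((lam k)%:E * wint w2 (cell m' x))).
    by rewrite leNgt; apply/negP => h; apply: nb; split.
  rewrite (EFinM (lam k) D) -muleA; apply: lee_wpmul2l; first by rewrite lee_fin ltW.
  exact: doubl.
have h2 : wint w1 A <= wint w1 (cell m x) by apply: wint_sub => // y [].
move=> /le_trans /(_ h2) /le_trans /(_ h1).
have [u ->] : exists u, wint w2 A = u%:E.
  by exists (fine (wint w2 A)); apply: f2 => // y [/cQ].
have [v ->] : exists v, wint w2 (cell m x) = v%:E.
  by exists (fine (wint w2 (cell m x))); exact: f2.
have e : (lam k * D = lam k.+1 * eps)%R.
  have gen (a b c e : R) : (a * b * (c * e) = a * (c * b) * e)%R by ring.
  have -> : D = (Lam * eps)%R by rewrite /Lam divfK// gt_eqF.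
  by rewrite /lam exprS gen.
rewrite e; have := lam0 k.+1; move: (lam k.+1) => L L0.
by rewrite -!EFinM !lee_fin -mulrA ler_pM2l.
Qed.

Let Om_pow k : wint w1 (Om k) <= (th ^+ k)%:E * wint w1 Q.
Proof.
elim: k => [|k IH]; first by rewrite expr0 mul1e; exact: wint_sub.
apply: (le_trans (Om_decay k)); rewrite exprS EFinM -muleA.
by apply: lee_wpmul2l => //; rewrite lee_fin ltW.
Qed.

(** Chosen so that (D / eps)^rh_exp = th^(-1/2). From one level to the next the power of the ratio
    gains th^(-1/2) while the mass loses [th], so the series over the levels is geometric of ratio
    th^(1/2). In [rh_cst] its sum is added to 1, the share of the part outside the first level
    set. *)
Definition rh_exp : R := (ln (th `^ (- 2^-1)) / ln (D / eps))%R.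
Definition rh_cst : R := (1 + (1 - th `^ 2^-1)^-1 * th `^ (- 2^-1))%R.

Let r := (th `^ (- 2^-1))%R.

Let half1 : (th `^ 2^-1 < 1)%R.
Proof.
have e : (1 = 1 `^ 2^-1 :> R)%R by rewrite powR1.
by rewrite [ltRHS]e; apply: gt0_ltr_powR; rewrite ?nnegrE ?invr_gt0// ltW.
Qed.

Lemma rh_exp_gt0 : (0 < rh_exp)%R.
Proof.
rewrite /rh_exp divr_gt0//; last first.
  by rewrite ln_gt0// -/Lam (lt_le_trans _ Lam2)// ltr1n.
by rewrite ln_gt0// powRN invf_gt1 ?powR_gt0//.
Qed.

Let Lam_exp : (Lam `^ rh_exp = r)%R.
Proof.
have L0 : (0 < Lam)%R by rewrite (lt_le_trans _ Lam2).
rewrite /powR gt_eqF// /rh_exp -/Lam divfK ?lnK ?posrE ?powR_gt0//.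
by rewrite gt_eqF// ln_gt0// (lt_le_trans _ Lam2)// ltr1n.
Qed.

Let g x : R := ((w1 x / w2 x) `^ rh_exp * w1 x)%R.

Let ng : nnw g.
Proof.
apply: posw_nnw; apply: posw_mul => //; apply: posw_powR; apply: posw_mul => //.
exact: posw_inv.
Qed.

Let g_level k A : measurable A -> A `<=` Q `\` Om k ->
  wint g A <= (rho `^ rh_exp * r ^+ k)%:E * wint w1 A.
Proof.
move=> mA AO; apply: le_wint => //.
  by rewrite mulr_ge0 ?exprn_ge0 ?powR_ge0.
have := @cell_differentiation _ _ _ _ _ _ HI HA w1 w2 (lam k) x0 p1.1 p2.1 n1.2 n2.2
  (ltW (lam0 k)) muQ w1oo w2oo.
apply: filterS => x h Ax; have [Qx nO] := AO _ Ax.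
have {}h : (w1 x <= lam k * w2 x)%R.
  by apply: h => // -[m _ b]; apply: nO; exists m.
rewrite /g ler_pM2r ?p1.2//.
have -> : (rho `^ rh_exp * r ^+ k = lam k `^ rh_exp)%R.
  have L0 : (0 <= Lam)%R by rewrite (le_trans _ Lam2).
  rewrite /lam powRM ?exprn_ge0 ?(ltW rho0)//; congr (_ * _)%R.
  by rewrite -(powR_mulrn k L0) powRAC Lam_exp powR_mulrn ?powR_ge0.
have d0 : (0 < w1 x / w2 x)%R by rewrite divr_gt0 ?p1.2 ?p2.2.
apply: ge0_ler_powR; rewrite ?nnegrE; [exact: ltW rh_exp_gt0|exact: ltW d0| |].
  exact: ltW (lam0 k).
by rewrite ler_pdivrMr ?p2.2.
Qed.

(** Between [Om N] and [Om N.+1] the power of the ratio is at most that of the level [lam N.+1], and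
    the mass is at most [th ^+ N] times that of [Q]. *)
Let g_trunc N : wint g (Q `\` Om N) <=
  (rho `^ rh_exp * (1 + \sum_(k < N) r * (r * th) ^+ k))%:E * wint w1 Q.
Proof.
have rr0 : (0 <= rho `^ rh_exp)%R by exact: powR_ge0.
have r0 : (0 <= r)%R by exact: powR_ge0.
elim: N => [|N IH].
  rewrite big_ord0 addr0 mulr1.
  have mD : measurable (Q `\` Om 0) by exact: measurableD.
  apply: (le_trans (g_level (k := 0%N) mD _)) => //; rewrite expr0 mulr1.
  apply: lee_wpmul2l; first by rewrite lee_fin.
  by apply: wint_sub => // x [].
have sub : Q `\` Om N `<=` Q `\` Om N.+1.
  by move=> x [Qx nO]; split => // /Om_mono.
have mD k : measurable (Q `\` Om k) by exact: measurableD.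
rewrite (wint_setD mu ng (mD N) (mD N.+1) sub) big_ord_recr /=.
have -> : (rho `^ rh_exp * (1 + (\sum_(k < N) r * (r * th) ^+ k + r * (r * th) ^+ N)))%:E *
    wint w1 Q = (rho `^ rh_exp * (1 + \sum_(k < N) r * (r * th) ^+ k))%:E * wint w1 Q +
    (rho `^ rh_exp * (r * (r * th) ^+ N))%:E * wint w1 Q.
  have [W ->] : exists W, wint w1 Q = W%:E.
    by exists (fine (wint w1 Q)); exact: f1 (mcell _ _) _.
  by rewrite -!EFinM -EFinD addrA mulrDr mulrDl.
apply: leeD => //.
have mDD : measurable ((Q `\` Om N.+1) `\` (Q `\` Om N)) by exact: measurableD.
apply: (le_trans (g_level (k := N.+1) mDD _)); first by move=> x [].
have -> : (rho `^ rh_exp * (r * (r * th) ^+ N) = (rho `^ rh_exp * r ^+ N.+1) * th ^+ N)%R.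
  by rewrite exprMn exprS; ring.
rewrite (EFinM _ (th ^+ N)) -muleA; apply: lee_wpmul2l.
  by rewrite lee_fin mulr_ge0 ?exprn_ge0.
apply: le_trans (Om_pow N); apply: wint_sub => // x [[Qx _] h].
by apply: contrapT => nO; apply: h; split.
Qed.

(* [w1 = 1] gives [A_oo => A_r] for [w2], and [w2 = 1] is Gehring's lemma for [w1]. *)
Lemma reverse_hoelder :
  wint (fun x => (w1 x / w2 x) `^ rh_exp * w1 x)%R Q <=
  (rh_cst * rho `^ rh_exp)%:E * wint w1 Q.
Proof.
have rth : (r * th = th `^ 2^-1)%R.
  rewrite /r -[X in (_ * X)%R](powRr1 (ltW th0)) -powRD.
    by congr (_ `^ _)%R; lra.
  by apply/implyP => _; rewrite gt_eqF.
have h1 := half1.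
have h0 : (0 <= th `^ 2^-1)%R by exact: powR_ge0.
have bound N : wint g (Q `\` Om N) <= (rh_cst * rho `^ rh_exp)%:E * wint w1 Q.
  apply: (le_trans (g_trunc N)); apply: lee_wpmul2r; first exact: wint_ge0.
  rewrite lee_fin [leRHS]mulrC ler_wpM2l ?powR_ge0// /rh_cst lerD2l -mulr_sumr rth.
  rewrite [leRHS]mulrC ler_wpM2l ?powR_ge0//.
  rewrite -[leRHS]mul1r ler_pdivlMr ?subr_gt0//.
  have := subrX1 (th `^ 2^-1) N; rewrite mulrC.
  have : (0 <= (th `^ 2^-1) ^+ N)%R by rewrite exprn_ge0.
  by move: (\sum_(i < N) _)%R ((th `^ 2^-1) ^+ N)%R => S t; nra.
have mD k : measurable (Q `\` Om k) by exact: measurableD.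
have mU : measurable (\bigcup_N (Q `\` Om N)) by exact: bigcupT_measurable.
pose gE x : \bar R := (g x)%:E.
have mg : measurable_fun setT gE by exact: nnw_mE.
have g0 x : 0 <= gE x by exact: nnw_ge0.
pose nu : {measure set T -> \bar R} := dens mu mg g0.
have cvg : nu \o (fun N => Q `\` Om N) @ \oo --> nu (\bigcup_N (Q `\` Om N)).
  apply: nondecreasing_cvg_mu => // i j ij; apply/subsetPset => x [Qx nO]; split => //.
  move=> Oj; apply: nO; move: Oj; rewrite -(subnKC ij).
  elim: (j - i)%N => [|m IH]; first by rewrite addn0.
  by rewrite addnS => /Om_mono /IH.
(* The level sets shrink to a set without [w1]-mass, hence null since [w1] is positive: nothing is
   lost in the limit. *)
have cap0 : wint w1 (\bigcap_N Om N) = 0.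
  have mC : measurable (\bigcap_N Om N) by exact: bigcapT_measurable.
  apply/eqP; rewrite eq_le wint_ge0// andbT.
  have : (th ^+ k * fine (wint w1 Q))%R @[k --> \oo] --> (0 * fine (wint w1 Q))%R.
    by apply: cvgMl; apply: cvg_expr; rewrite ger0_norm// ltW.
  rewrite mul0r => cv.
  have -> : wint w1 (\bigcap_N Om N) = (fine (wint w1 (\bigcap_N Om N)))%:E.
    by apply: f1 => // x /(_ 0%N Logic.I)/OmQ.
  rewrite lee_fin.
  apply: (cvgr_to_ge cv); apply: nearW => k.
  have : wint w1 (\bigcap_N Om N) <= (th ^+ k)%:E * wint w1 Q.
    apply: le_trans (Om_pow k); apply: wint_sub => //.
    by move=> x; exact.
  have eQ : wint w1 Q = (fine (wint w1 Q))%:E by exact: f1 (mcell _ _) _.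
  have eC : wint w1 (\bigcap_N Om N) = (fine (wint w1 (\bigcap_N Om N)))%:E.
    by apply: f1 => // x /(_ 0%N Logic.I)/OmQ.
  by rewrite eQ eC -EFinM lee_fin.
have mC : measurable (\bigcap_N Om N) by exact: bigcapT_measurable.
have sub : \bigcup_N (Q `\` Om N) `<=` Q by move=> x [N _ []].
rewrite -/g (wint_setD mu ng mU (mcell _ _) sub).
have -> : Q `\` \bigcup_N (Q `\` Om N) = \bigcap_N Om N.
  apply/seteqP; split => x.
    by move=> [Qx h] N _; apply: contrapT => nO; apply: h; exists N.
  move=> h; split; first by apply: (@OmQ 0%N); exact: h.
  by move=> [N _ [_ nO]]; apply: nO; exact: h.
rewrite [X in _ + X]wint_null// ?adde0; last exact: posw_null cap0.
apply: (cvge_to_le cvg); apply: nearW => N; exact: bound.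
Qed.

End reverse_hoelder.

(** * Maximal functions and Muckenhoupt's theorem *)

(* The combinatorial facts about cubes used in maximal function estimates:
   [trip c] is the concentric triple of [c] and [rc] a countable family, cofinal
   up to a bounded dilation. *)
Record cube_basis d (T : measurableType d) (R : realType)
    (mu : {measure set T -> \bar R}) (C : Type) (Q : C -> set T)
    (trip : C -> C) (rc : nat -> C) (K3 : R) : Prop := CubeBasis {
  cb_meas : forall c, measurable (Q c) ;
  cb_gt0 : forall c, 0 < mu (Q c) ;
  cb_fin : forall c, mu (Q c) < +oo ;
  cb_trip_sub : forall c, Q c `<=` Q (trip c) ;
  cb_trip_le : forall c, mu (Q (trip c)) <= K3%:E * mu (Q c) ;
  cb_vitali : forall c c', Q c `&` Q c' !=set0 -> mu (Q c') <= mu (Q c) ->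
    Q c' `<=` Q (trip c) ;
  cb_count : forall c, exists i, Q c `<=` Q (rc i) /\ Q (rc i) `<=` Q (trip c) ;
  cb_large : forall c x, exists c', Q c `<=` Q c' /\ Q c' x ;
  cb_K3 : (1 <= K3)%R
}.

Section maximal_function.
Context d (T : measurableType d) (R : realType) (mu : {measure set T -> \bar R}).
Context (C : Type) (Q : C -> set T) (trip : C -> C) (rc : nat -> C) (K3 : R).
Hypothesis CB : cube_basis mu Q trip rc K3.
Local Notation wint := (wint mu).
Let mQ c : measurable (Q c) := cb_meas CB c.

Section weight.
Variables (w : T -> R) (D : R).
Hypotheses (pw : posw w) (wfin : forall c, wint w (Q c) < +oo).
Hypothesis (D1 : (1 <= D)%R).
Hypothesis (dbl : forall c, wint w (Q (trip c)) <= D%:E * wint w (Q c)).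
Let nw := posw_nnw pw.
Let D0 : (0 <= D)%R. Proof. exact: le_trans D1. Qed.

Definition avgw (f : T -> \bar R) c : \bar R :=
  (wint w (Q c))^-1 * \int[mu]_(x in Q c) (f x * (w x)%:E).

(** The supremum is over the countable family, which makes it measurable, and the averages are taken
    for the measure of density [w]. The choice [w = 1] is the usual maximal function up to the
    factor [K3], by [gmax_le_maxw]. *)
Definition maxw (f : T -> \bar R) (x : T) : \bar R :=
  ereal_sup [set avgw f (rc i) | i in [set i | Q (rc i) x]].

Lemma wintQ_gt0 c : 0 < wint w (Q c).
Proof.
rewrite lt_neqAle wint_ge0// andbT eq_sym; apply/eqP => /(posw_null pw (mQ c)) h.
by have := cb_gt0 CB c; rewrite h ltxx.
Qed.

Lemma wintQE c : exists2 v : R, (0 < v)%R & wint w (Q c) = v%:E.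
Proof.
exists (fine (wint w (Q c))); last by rewrite fineK// ge0_fin_numE ?wint_ge0.
by rewrite fine_gt0// wintQ_gt0 wfin.
Qed.

Let fw_ge0 (f : T -> \bar R) : (forall x, 0 <= f x) -> forall x, 0 <= f x * (w x)%:E.
Proof. by move=> f0 x; rewrite mule_ge0// lee_fin ltW// pw.2. Qed.

Let mfw (f : T -> \bar R) A : measurable_fun setT f ->
  measurable_fun A (fun x => f x * (w x)%:E).
Proof.
move=> mf; apply: emeasurable_funM; first exact: measurable_funTS.
exact: nnw_mE.
Qed.

Lemma avgw_ge0 f c : (forall x, 0 <= f x) -> 0 <= avgw f c.
Proof.
move=> f0; rewrite /avgw mule_ge0//; last by apply: integral_ge0 => x _; exact: fw_ge0.
by have [v v0 ->] := wintQE c; rewrite inver gt_eqF// lee_fin invr_ge0 ltW.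
Qed.

Lemma avgw_gt f c (t : R) : (0 <= t)%R ->
  (t%:E < avgw f c) = (t%:E * wint w (Q c) < \int[mu]_(x in Q c) (f x * (w x)%:E)).
Proof.
move=> t0; rewrite /avgw; have [v v0 ->] := wintQE c.
by rewrite inver gt_eqF// lte_pdivlMl// muleC.
Qed.

Lemma maxw_ge0 f x : (forall x, 0 <= f x) -> 0 <= maxw f x.
Proof.
move=> f0; have [c [_ cx]] := cb_large CB (rc 0%N) x.
have [i [ci _]] := cb_count CB c.
apply: (@le_trans _ _ (avgw f (rc i))); first exact: avgw_ge0.
by apply: ereal_sup_ubound; exists i => //; exact: ci.
Qed.

Lemma maxw_gt f (t : R) :
  [set x | t%:E < maxw f x] = \bigcup_(i in [set i | t%:E < avgw f (rc i)]) Q (rc i).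
Proof.
apply/seteqP; split => x /=.
  by move=> /ereal_sup_gt[_ [i Qx <-] h]; exists i.
by move=> [i h Qx]; apply: (lt_le_trans h); apply: ereal_sup_ubound; exists i.
Qed.

Lemma measurable_maxw f : measurable_fun setT (maxw f).
Proof.
apply: (measurability _ (ErealGenOInfty.measurableE R)) => _ [_ [t ->] <-].
rewrite setTI (_ : _ @^-1` _ = [set x | t%:E < maxw f x]); last first.
  by apply/seteqP; split => x /=; rewrite in_itv/= andbT.
rewrite maxw_gt; apply: bigcup_measurable => i _; exact: mQ.
Qed.

(** Vitali's greedy selection, as an induction on the length of the list: a cube of largest
    [mu]-measure contains in its triple every cube that meets it, doubling of [w] pays for the
    triple, and the cubes left over are disjoint from it. *)
Lemma vitali_wint (s : seq nat) (g : T -> \bar R) (t : R) : (0 <= t)%R ->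
  measurable_fun setT g -> (forall x, 0 <= g x) ->
  (forall i, i \in s -> t%:E * wint w (Q (rc i)) <= \int[mu]_(x in Q (rc i)) g x) ->
  t%:E * wint w (\bigcup_(i in [set` s]) Q (rc i)) <=
  D%:E * \int[mu]_(x in \bigcup_(i in [set` s]) Q (rc i)) g x.
Proof.
move=> t0 mg g0; have [m] := ubnP (size s); elim: m s => // m IH s ss hs.
have mU (r : seq nat) : measurable (\bigcup_(i in [set` r]) Q (rc i)).
  by apply: bigcup_measurable => i _; exact: mQ.
case: s ss hs => [|i0 s] ss hs.
  by rewrite set_nil bigcup_set0 /wint !integral_set0 !mule0.
set s1 := i0 :: s in ss hs *.
have [i is1 imax] : exists2 i, i \in s1 &
    forall j, j \in s1 -> mu (Q (rc j)) <= mu (Q (rc i)).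
  rewrite /s1; elim: (s) (i0) => [|j r IHr] j0.
    by exists j0; rewrite ?inE// => k; rewrite inE => /eqP->.
  have [k kr kmax] := IHr j.
  have [h|h] := leP (mu (Q (rc j0))) (mu (Q (rc k))).
    exists k; first by rewrite inE kr orbT.
    by move=> k'; rewrite inE => /predU1P[->//|]; exact: kmax.
  exists j0; first by rewrite inE eqxx.
  move=> k'; rewrite inE => /predU1P[->//|/kmax h'].
  by apply: (le_trans h'); exact: ltW.
pose s2 := [seq j <- s1 | `[< Q (rc i) `&` Q (rc j) = set0 >]].
have s2s : {subset s2 <= s1} by move=> j; rewrite mem_filter => /andP[].
have is2 : i \notin s2.
  rewrite mem_filter negb_and; apply/orP; left; apply/asboolPn; rewrite setIid => h.
  by have := cb_gt0 CB (rc i); rewrite h measure0 ltxx.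
have szs2 : (size s2 < m)%N.
  apply: (@leq_trans (size s1)); last by rewrite -ltnS.
  rewrite size_filter -[ltnRHS](count_predC (fun j => `[< Q (rc i) `&` Q (rc j) = set0 >])).
  rewrite -[ltnLHS]addn0 ltn_add2l -has_count; apply/hasP; exists i => //=.
  by move: is2; rewrite mem_filter is1 andbT.
set U1 := \bigcup_(i in [set` s1]) _; set U2 := \bigcup_(i in [set` s2]) Q (rc i).
have mU1 : measurable U1 by exact: mU.
have mU2 : measurable U2 by exact: mU.
have sub12 : U1 `<=` Q (trip (rc i)) `|` U2.
  move=> x [j js1 jx].
  have [/asboolP h|/asboolP h] := boolP `[< Q (rc i) `&` Q (rc j) = set0 >].
    by right; exists j => //=; rewrite mem_filter js1 andbT; apply/asboolP.
  left; apply: (cb_vitali CB _ _ jx); last exact: imax.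
  by apply/set0P/eqP.
have dis : Q (rc i) `&` U2 = set0.
  apply/seteqP; split => // x [ix [j]] /=.
  rewrite mem_filter => /andP[/asboolP h _] jx.
  have : (Q (rc i) `&` Q (rc j)) x by exact: (conj ix jx).
  by rewrite h.
have IH2 := IH s2 szs2 (fun j js2 => hs j (s2s _ js2)).
have twfin c : t%:E * wint w (Q c) = t%:E * wint w (Q c) by [].
apply: (@le_trans _ _ (t%:E * (wint w (Q (trip (rc i))) + wint w U2))).
  apply: lee_wpmul2l; first by rewrite lee_fin.
  apply: (@le_trans _ _ (wint w (Q (trip (rc i)) `|` U2))).
    by apply: wint_sub => //; exact: measurableU.
  rewrite (wint_setD mu nw (mQ (trip (rc i)))) //; last exact: measurableU.
  apply: leeD => //; apply: wint_sub => //; first by apply: measurableD => //; exact: measurableU.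
  by move=> x [[]].
rewrite [leLHS]ge0_muleDr ?wint_ge0//.
apply: (@le_trans _ _ (D%:E * (\int[mu]_(x in Q (rc i)) g x + \int[mu]_(x in U2) g x))).
  rewrite [leRHS]ge0_muleDr ?integral_ge0//.
  apply: leeD => //.
  apply: (@le_trans _ _ (D%:E * (t%:E * wint w (Q (rc i))))).
    rewrite muleCA; apply: lee_wpmul2l; rewrite ?lee_fin//; exact: dbl.
  by apply: lee_wpmul2l; rewrite ?lee_fin//; exact: hs.
apply: lee_wpmul2l; first by rewrite lee_fin.
rewrite -ge0_integral_setU//.
- apply: ge0_subset_integral => //.
  + exact: measurableU.
  + exact: measurable_funTS.
  + by move=> x [ix|[j js2 jx]]; [exists i|exists j => //; exact: s2s].
- exact: measurable_funTS.
- by rewrite disj_set2E dis.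
Qed.

(** On a cube where the average exceeds [t], the values of [f] below [t / 2] contribute at most
    [t / 2], so [f] may be cut to the set where it exceeds [t / 2]. This localised form is what
    interpolation needs. *)
Lemma weak_type f (t : R) : (0 < t)%R -> measurable_fun setT f -> (forall x, 0 <= f x) ->
  (t / 2)%:E * wint w [set x | t%:E < maxw f x] <=
  D%:E * \int[mu]_(x in [set x | (t / 2)%:E < f x]) (f x * (w x)%:E).
Proof.
move=> t0 mf f0; have t20 : (0 < t / 2)%R by rewrite divr_gt0.
pose S := [set x | (t / 2)%:E < f x].
have mS : measurable S.
  rewrite /S (_ : [set x | _] = f @^-1` `](t / 2)%:E, +oo[%classic).
    by rewrite -[X in measurable X]setTI; apply: mf => //; exact: emeasurable_itv.
  by apply/seteqP; split => x /=; rewrite in_itv/= andbT.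
pose g := (fun x => f x * (w x)%:E) \_ S.
have mg : measurable_fun setT g.
  by apply/(measurable_restrictT _ mS); exact: mfw.
have g0 x : 0 <= g x by rewrite /g /patch; case: ifPn => // _; exact: fw_ge0.
have gS A : measurable A -> \int[mu]_(x in A) g x <= \int[mu]_(x in S) (f x * (w x)%:E).
  move=> mA; rewrite [leRHS]integral_mkcond -/g.
  by apply: ge0_subset_integral => //.
rewrite maxw_gt; set J := [set i | _].
(* The covering argument works on finite lists; the whole union is reached by continuity from
   below. *)
pose s N := [seq i <- iota 0 N | `[< J i >]].
have Us N : [set` s N] = [set i | (i < N)%N /\ J i].
  apply/seteqP; split => i /=; rewrite mem_filter mem_iota leq0n add0n /=.
    by move=> /andP[/asboolP Ji iN].
  by move=> [iN Ji]; rewrite iN andbT; apply/asboolP.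
pose U N := \bigcup_(i in [set` s N]) Q (rc i).
have mU N : measurable (U N) by apply: bigcup_measurable => i _; exact: mQ.
have UE : \bigcup_(i in J) Q (rc i) = \bigcup_N U N.
  apply/seteqP; split => x.
    by move=> [i Ji ix]; exists i.+1 => //; exists i => //; rewrite Us.
  by move=> [N _ [i]]; rewrite Us => -[_ Ji] ix; exists i.
have bnd N : (t / 2)%:E * wint w (U N) <= D%:E * \int[mu]_(x in S) (f x * (w x)%:E).
  apply: (@le_trans _ _ (D%:E * \int[mu]_(x in U N) g x)); last first.
    by apply: lee_wpmul2l; rewrite ?lee_fin//; exact: gS.
  apply: vitali_wint => //; first exact: ltW.
  move=> i; have : [set` s N] i -> J i by rewrite Us => -[].
  move=> /[apply]; rewrite /J /= avgw_gt ?(ltW t0)// => h.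
  have : \int[mu]_(x in Q (rc i)) (f x * (w x)%:E) <=
      \int[mu]_(x in Q (rc i)) g x + (t / 2)%:E * wint w (Q (rc i)).
    rewrite -ge0_integralZl_EFin ?(ltW t20)//; last 2 first.
      by move=> x _; exact: nnw_ge0.
      exact: nnw_mE.
    rewrite -ge0_integralD//; last 3 first.
      exact: measurable_funTS.
      by move=> x _; rewrite -EFinM lee_fin mulr_ge0 ?(ltW t20)// ltW// pw.2.
      by apply: measurable_funeM; exact: nnw_mE.
    apply: ge0_le_integral.
    - exact: mQ.
    - by move=> x _; exact: fw_ge0.
    - exact: mfw.
    - apply: emeasurable_funD; first exact: measurable_funTS.
      by apply: measurable_funeM; exact: nnw_mE.
    - move=> x _; rewrite /g /patch; case: ifPn => [_|].
        by rewrite leeDl// -EFinM lee_fin mulr_ge0 ?(ltW t20)// ltW// pw.2.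
      move=> /negP; rewrite inE /S /= => /negP; rewrite -leNgt => h'.
      by rewrite add0e lee_wpmul2r// lee_fin ltW// pw.2.
  move=> /(lt_le_trans h) {h}; have [v v0 ->] := wintQE (rc i).
  rewrite -!EFinM; case: (\int[mu]_(x in Q (rc i)) g x) => [r| |]//=.
    rewrite -EFinD lte_fin lee_fin => h; have : (t * v = t / 2 * v + t / 2 * v)%R by field.
    by move=> e; move: h; rewrite e ltrD2r => /ltW.
  by rewrite leey.
rewrite UE.
have mE : measurable_fun setT (fun x => (w x)%:E) by exact: nnw_mE.
have w0 := nnw_ge0 nw.
pose nu : {measure set T -> \bar R} := dens mu mE w0.
have cvg : nu \o U @ \oo --> nu (\bigcup_N U N).
  apply: nondecreasing_cvg_mu => //; first exact: bigcupT_measurable.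
  move=> i j ij; apply/subsetPset => x [k]; rewrite Us => -[ki Jk] kx.
  by exists k => //; rewrite Us; split => //; exact: leq_trans ij.
have {}cvg : (fun N => (t / 2)%:E * nu (U N)) @ \oo --> (t / 2)%:E * nu (\bigcup_N U N).
  by apply: cvgeZl.
by apply: (cvge_to_le cvg); apply: nearW => N; exact: bnd.
Qed.

End weight.
End maximal_function.

(** * Marcinkiewicz interpolation by dyadic levels *)

Section levels.
Context {R : realType}.
Local Open Scope ring_scope.

(** The level 2^(j - N): the natural numbers up to [N + N] run through the dyadic values from 2^(-N)
    to 2^N, so finite sums replace the layer-cake integral. *)
Definition lev (N j : nat) : R := 2 ^+ j / 2 ^+ N.

Lemma lev_gt0 N j : 0 < lev N j.
Proof. by rewrite divr_gt0// exprn_gt0. Qed.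

Lemma levS N j : lev N j.+1 = 2 * lev N j.
Proof. by rewrite /lev exprS mulrA. Qed.

Lemma powR2_gt1 (q : R) : 0 < q -> 1 < 2 `^ q.
Proof.
move=> q0; have e : 1 = 1 `^ q :> R by rewrite powR1.
by rewrite [ltLHS]e; apply: gt0_ltr_powR; rewrite ?nnegrE// ltr1n.
Qed.

Lemma lev_layers N J (y p : R) : 0 < p -> lev N 0 < y -> y <= lev N J ->
  y `^ p <= 2 `^ p * \sum_(j < J) lev N j `^ p * (lev N j < y)%R%:R.
Proof.
move=> p0 y0; elim: J => [|J IH] yJ; first by have := lt_le_trans y0 yJ; rewrite ltxx.
rewrite big_ord_recr /=; have [h|h] := leP y (lev N J).
  by rewrite mulr0 addr0 IH.
rewrite mulr1 mulrDr -powRM ?(ltW (lev_gt0 _ _))// -levS.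
apply: ler_wpDl; last first.
  apply: ge0_ler_powR; rewrite ?nnegrE; [exact: ltW p0| | |exact: yJ].
    exact: ltW (lt_trans (lev_gt0 N 0) y0).
  exact: ltW (lev_gt0 _ _).
rewrite mulr_ge0 ?powR_ge0// sumr_ge0// => j _.
by rewrite mulr_ge0 ?powR_ge0// ler0n.
Qed.

(** The active levels are those below 2 z, and a geometric sum is comparable to its last term. *)
Lemma lev_geometric N J (z q : R) : 0 < q -> 0 <= z ->
  \sum_(j < J) lev N j `^ q * (lev N j / 2 < z)%R%:R <=
  (2 `^ q - 1)^-1 * 2 `^ q * 2 `^ q * z `^ q.
Proof.
move=> q0 z0; set A := (2 `^ q - 1)^-1.
have q1 : 1 < 2 `^ q := powR2_gt1 q0.
have A0 : 0 < A by rewrite invr_gt0 subr_gt0.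
have AE : A + 1 = A * 2 `^ q by rewrite /A; field; rewrite gt_eqF// subr_gt0.
have levSq j : lev N j.+1 `^ q = 2 `^ q * lev N j `^ q.
  by rewrite levS powRM// ltW// lev_gt0.
have full j : \sum_(i < j) lev N i `^ q * (lev N i / 2 < z)%R%:R <= A * lev N j `^ q.
  elim: j => [|j IH]; first by rewrite big_ord0 mulr_ge0 ?powR_ge0// ltW.
  rewrite big_ord_recr /= levSq mulrA -AE mulrDl mul1r lerD//.
  by case: (_ < _); rewrite ?mulr1 ?mulr0 ?powR_ge0.
elim: J => [|J IH]; first by rewrite big_ord0 !mulr_ge0 ?powR_ge0// ltW.
have [h|h] := ltP (lev N J / 2) z; last first.
  by rewrite big_ord_recr /= ltNge h mulr0 addr0.
apply: (le_trans (full J.+1)); rewrite levSq mulrA -[leRHS]mulrA.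
rewrite ler_wpM2l ?mulr_ge0 ?powR_ge0 ?(ltW A0)//.
rewrite -powRM//; apply: ge0_ler_powR; rewrite ?nnegrE; [exact: ltW q0| | |].
- exact: ltW (lev_gt0 _ _).
- by rewrite mulr_ge0.
- by move: h; rewrite ltr_pdivrMr// mulrC => /ltW.
Qed.

End levels.

Section strong_type.
Context d (T : measurableType d) (R : realType) (mu : {measure set T -> \bar R}).
Context (C : Type) (Q : C -> set T) (trip : C -> C) (rc : nat -> C) (K3 : R).
Hypothesis CB : cube_basis mu Q trip rc K3.
Local Notation wint := (wint mu).
Variables (w : T -> R) (D : R).
Hypotheses (pw : posw w) (wfin : forall c, wint w (Q c) < +oo).
Hypothesis (D1 : (1 <= D)%R).
Hypothesis (dbl : forall c, wint w (Q (trip c)) <= D%:E * wint w (Q c)).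
Local Notation maxw := (maxw mu Q rc).
Variables (f : T -> \bar R) (p : R).
Hypotheses (p1 : (1 < p)%R) (mf : measurable_fun setT f) (f0 : forall x, 0 <= f x).
Let nw := posw_nnw pw.
Let D0 : (0 <= D)%R. Proof. exact: le_trans D1. Qed.
Let q := (p - 1)%R.
Let q0 : (0 < q)%R. Proof. by rewrite subr_gt0. Qed.
Let p0 : (0 < p)%R. Proof. exact: lt_trans p1. Qed.
Let powq (z : R) : (0 <= z)%R -> (z `^ p = z `^ q * z)%R.
Proof.
move=> z0; rewrite -[X in (_ * X)%R](powRr1 z0) -powRD /q subrK//.
by rewrite gt_eqF.
Qed.

Let F := maxw w f.
Let mF : measurable_fun setT F. Proof. exact: (measurable_maxw CB). Qed.
Let F0 x : 0 <= F x. Proof. exact: (maxw_ge0 CB). Qed.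

Let Fp x := F x `^ p * (w x)%:E.
Let fp x := f x `^ p * (w x)%:E.

Let mpow (g : T -> \bar R) A : measurable_fun setT g ->
  measurable_fun A (fun x => g x `^ p * (w x)%:E).
Proof.
move=> mg; apply: emeasurable_funM; last exact: nnw_mE.
by apply: measurable_funTS; exact: (measurableT_comp (measurable_poweR _)).
Qed.

Let pow_ge0 (g : T -> \bar R) x : 0 <= g x `^ p * (w x)%:E.
Proof. by rewrite mule_ge0 ?poweR_ge0// lee_fin ltW// pw.2. Qed.

Let isum J (c : nat -> R) (G : nat -> T -> \bar R) : (forall j, (0 <= c j)%R) ->
  (forall j, measurable_fun setT (G j)) -> (forall j x, 0 <= G j x) ->
  \int[mu]_x (\sum_(j < J) (c j)%:E * G j x) = \sum_(j < J) (c j)%:E * \int[mu]_x G j x.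
Proof.
move=> c0 mG G0; rewrite ge0_integral_sum//.
- apply: eq_bigr => j _; rewrite ge0_integralZl_EFin//.
- by move=> j; exact: measurable_funeM.
- by move=> j x _; rewrite mule_ge0// lee_fin.
Qed.

Let sup_gt (g : T -> \bar R) t : measurable_fun setT g -> measurable [set x | t%:E < g x].
Proof.
move=> mg; rewrite (_ : [set x | _] = g @^-1` `]t%:E, +oo[%classic).
  by rewrite -[X in measurable X]setTI; apply: mg => //; exact: emeasurable_itv.
by apply/seteqP; split => x /=; rewrite in_itv/= andbT.
Qed.

Let fw_ge0 x : 0 <= f x * (w x)%:E.
Proof. by rewrite mule_ge0// lee_fin ltW// pw.2. Qed.

Let weak (t : R) : (0 < t)%R -> (t / 2)%:E * wint w [set x | t%:E < F x] <=
  D%:E * \int[mu]_(x in [set x | (t / 2)%:E < f x]) (f x * (w x)%:E).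
Proof. by move=> t0; exact: (weak_type CB). Qed.

(** The factor 2^p comes from [lev_layers], [2 * D] from the weak type bound and the rest from
    [lev_geometric] with exponent [p - 1]. *)
Definition strong_cst : R :=
  (2 `^ p * (2 * D * ((2 `^ (p - 1) - 1)^-1 * 2 `^ (p - 1) * 2 `^ (p - 1))))%R.

Let cst0 : (0 < (2 `^ q - 1)^-1 * 2 `^ q * 2 `^ q)%R.
Proof. by rewrite !mulr_gt0 ?powR_gt0// invr_gt0 subr_gt0 powR2_gt1. Qed.

Let level_bound N :
  \int[mu]_(x in [set x | (lev N 0)%:E < F x <= (lev N (N + N))%:E]) Fp x <=
  strong_cst%:E * \int[mu]_x fp x.
Proof.
set A := [set x | _]; pose J := (N + N)%N.
have mA : measurable A.
  rewrite (_ : A = [set x | (lev N 0)%:E < F x] `\` [set x | (lev N J)%:E < F x]).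
    by apply: measurableD; exact: sup_gt.
  apply/seteqP; split => x /=.
    by move=> /andP[h1 h]; split => //=; apply/negP; rewrite -leNgt.
  by move=> [/= h1 /negP]; rewrite -leNgt => h2; apply/andP; split.
pose S j := [set x | (lev N j)%:E < F x].
pose S' j := [set x | (lev N j / 2)%:E < f x].
have mS j : measurable (S j) by exact: sup_gt.
have mS' j : measurable (S' j) by exact: sup_gt.
pose G j : T -> \bar R := (fun x => (w x)%:E) \_ (S j).
pose G' j : T -> \bar R := (fun x => f x * (w x)%:E) \_ (S' j).
have mG j : measurable_fun setT (G j).
  by apply/(measurable_restrictT _ (mS j)); exact: nnw_mE.
have mG' j : measurable_fun setT (G' j).
  apply/(measurable_restrictT _ (mS' j)); apply: emeasurable_funM; last exact: nnw_mE.
  exact: measurable_funTS.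
have G0 j x : 0 <= G j x.
  by rewrite /G /patch; case: ifPn => // _; exact: nnw_ge0.
have G'0 j x : 0 <= G' j x by rewrite /G' /patch; case: ifPn => // _.
pose c j : R := (lev N j `^ p)%R.
pose c' j : R := (lev N j `^ q)%R.
have c0 j : (0 <= c j)%R by exact: powR_ge0.
have c'0 j : (0 <= c' j)%R by exact: powR_ge0.
have mcG : measurable_fun setT (fun x => \sum_(j < J) (c j)%:E * G j x).
  by apply: emeasurable_sum => j _; exact: measurable_funeM.
have mcG' : measurable_fun setT (fun x => \sum_(j < J) (c' j)%:E * G' j x).
  by apply: emeasurable_sum => j _; exact: measurable_funeM.
have cG0 x : 0 <= \sum_(j < J) (c j)%:E * G j x.
  by apply: sume_ge0 => j _; rewrite mule_ge0// lee_fin.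
have cG'0 x : 0 <= \sum_(j < J) (c' j)%:E * G' j x.
  by apply: sume_ge0 => j _; rewrite mule_ge0// lee_fin.
apply: (@le_trans _ _ ((2 `^ p)%:E * \int[mu]_x \sum_(j < J) (c j)%:E * G j x)).
  rewrite -ge0_integralZl_EFin ?powR_ge0//.
  apply: (@le_trans _ _ (\int[mu]_(x in A) ((2 `^ p)%:E * \sum_(j < J) (c j)%:E * G j x))).
    apply: ge0_le_integral => //; [by move=> x _; exact: pow_ge0|exact: mpow| |].
      by apply: measurable_funTS; exact: measurable_funeM.
    move=> x /andP[]; rewrite /Fp; have := F0 x; case eF : (F x) => [y| |]//.
    rewrite lee_fin => y0; rewrite lte_fin lee_fin => h1 h2.
    rewrite poweR_EFin -EFinM.
    have -> : \sum_(j < J) (c j)%:E * G j x =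
        ((\sum_(j < J) lev N j `^ p * (lev N j < y)%R%:R) * w x)%:E.
      rewrite mulr_suml -sumEFin; apply: eq_bigr => j _; rewrite /G /patch.
      have -> : (x \in S j) = (lev N j < y)%R.
        by apply/idP/idP; rewrite inE /S /= eF lte_fin.
      by case: ifPn => _; rewrite ?mulr1 ?mulr0 ?mule0 ?mul0r// EFinM.
    rewrite -EFinM lee_fin mulrA ler_wpM2r ?(ltW (pw.2 x))//.
    exact: lev_layers.
  apply: ge0_subset_integral => //; first exact: measurable_funeM.
  by move=> x _; rewrite mule_ge0 ?lee_fin ?powR_ge0.
rewrite isum// /strong_cst EFinM -muleA; apply: lee_wpmul2l.
  by rewrite lee_fin powR_ge0.
apply: (@le_trans _ _ (\sum_(j < J) (c' j)%:E * ((2 * D)%:E * \int[mu]_x G' j x))).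
  apply: lee_sum => j _.
  have h : (lev N j / 2)%:E * \int[mu]_x G j x <= D%:E * \int[mu]_x G' j x.
    have := weak (lev_gt0 N j); rewrite /wint integral_mkcond.
    by rewrite [X in _ <= _ * X]integral_mkcond.
  have -> : c j = (c' j * 2 * (lev N j / 2))%R.
    rewrite -mulrA [(2 * _)%R]mulrC divfK// /c /c' /q.
    rewrite -[X in (_ * X)%R](powRr1 (ltW (lev_gt0 N j))) -powRD ?subrK//.
    by apply/implyP => _; rewrite gt_eqF// lev_gt0.
  rewrite (EFinM (c' j * 2)) -muleA; apply: le_trans (lee_wpmul2l _ h) _.
    by rewrite lee_fin mulr_ge0.
  by rewrite (EFinM (c' j)) (EFinM 2) -!muleA.
under eq_bigr do rewrite muleCA.
rewrite -ge0_sume_distrr; last first.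
  by move=> j _; rewrite mule_ge0 ?lee_fin//; apply: integral_ge0.
rewrite -isum// (EFinM (2 * D)) -muleA; apply: lee_wpmul2l.
  by rewrite lee_fin mulr_ge0.
rewrite -ge0_integralZl_EFin; [|exact: measurableT|by move=> x _; exact: pow_ge0|
  exact: mpow|exact: ltW cst0].
apply: ge0_le_integral => //.
  by apply: measurable_funeM; exact: mpow.
move=> x _; rewrite /fp.
have -> : \sum_(j < J) (c' j)%:E * G' j x =
    \sum_(j < J) ((c' j)%:E * (if (lev N j / 2)%:E < f x then f x else 0)) * (w x)%:E.
  apply: eq_bigr => j _; rewrite /G' /patch.
  have -> : (x \in S' j) = ((lev N j / 2)%:E < f x).
    by apply/idP/idP; rewrite inE.
  by case: ifPn => _; rewrite ?mule0 ?mul0e// muleA.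
rewrite -ge0_sume_distrl; last first.
  by move=> j _; rewrite mule_ge0 ?lee_fin//; case: ifPn.
rewrite muleA; apply: lee_wpmul2r; first by rewrite lee_fin ltW// pw.2.
have := f0 x; case: (f x) => [z| |]// z0; last first.
  by rewrite poweRyr ?gt_eqF// gt0_muley ?leey.
rewrite poweR_EFin -EFinM.
have -> : \sum_(j < J) (c' j)%:E * (if (lev N j / 2)%:E < z%:E then z%:E else 0) =
    ((\sum_(j < J) lev N j `^ q * (lev N j / 2 < z)%R%:R) * z)%:E.
  rewrite mulr_suml -sumEFin; apply: eq_bigr => j _; rewrite lte_fin.
  by case: ifPn => _; rewrite ?mulr1 ?mulr0 ?mule0 ?mul0r// EFinM.
rewrite lee_fin in z0; rewrite lee_fin.
by rewrite powq// mulrA ler_wpM2r// lev_geometric.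
Qed.

(** The truncated levels never see the points where the maximal function is infinite. The weak type
    bound at height s gives s^p w(A) at most D times the integral on the right for every s, which
    forces [A] to be null. *)
Let F_infty : \int[mu]_x fp x < +oo -> mu [set x | F x = +oo] = 0.
Proof.
move=> fpoo; set A := [set x | F x = +oo].
have mA : measurable A.
  rewrite (_ : A = F @^-1` [set +oo]); last by apply/seteqP; split.
  by rewrite -[X in measurable X]setTI; apply: mF => //; exact: emeasurable_set1.
apply: (posw_null pw mA).
have I0 : 0 <= \int[mu]_x fp x by apply: integral_ge0 => x _; exact: pow_ge0.
have bnd (s : R) : (0 < s)%R -> (s `^ p)%:E * wint w A <= D%:E * \int[mu]_x fp x.
  move=> s0; have t0 : (0 < s * 2)%R by rewrite mulr_gt0.
  have := weak t0; rewrite -mulrA divff// mulr1 => h.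
  rewrite (powq (ltW s0)) EFinM -muleA.
  apply: (@le_trans _ _ ((s `^ q)%:E * (D%:E *
      \int[mu]_(x in [set x | s%:E < f x]) (f x * (w x)%:E)))).
    apply: lee_wpmul2l; first by rewrite lee_fin powR_ge0.
    apply: le_trans h; apply: lee_wpmul2l; first by rewrite lee_fin ltW.
    apply: wint_sub => //; first exact: sup_gt.
    by move=> x; rewrite /A /= => ->; rewrite ltry.
  rewrite muleCA; apply: lee_wpmul2l; first by rewrite lee_fin.
  rewrite -ge0_integralZl_EFin ?powR_ge0//; last 2 first.
  - exact: sup_gt.
  - by apply: emeasurable_funM; [exact: measurable_funTS|exact: nnw_mE].
  apply: (@le_trans _ _ (\int[mu]_(x in [set x | s%:E < f x]) fp x)).
    apply: ge0_le_integral.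
    - exact: sup_gt.
    - by move=> x _; rewrite mule_ge0 ?lee_fin ?powR_ge0.
    - apply: measurable_funeM.
      by apply: emeasurable_funM; [exact: measurable_funTS|exact: nnw_mE].
    - exact: mpow.
    - move=> x /= sx; rewrite /fp muleA; apply: lee_wpmul2r.
        by rewrite lee_fin ltW// pw.2.
      move: sx; case: (f x) (f0 x) => [z| |]// z0; last first.
        by rewrite poweRyr ?gt_eqF// leey.
      rewrite lte_fin lee_fin in z0 * => sz; rewrite poweR_EFin -EFinM lee_fin.
      rewrite powq// ler_wpM2r//; apply: ge0_ler_powR; rewrite ?nnegrE ?(ltW q0)//.
      - exact: ltW.
      - exact: ltW.
  apply: ge0_subset_integral; [exact: sup_gt|exact: measurableT|exact: mpow| |by []].
  by move=> x _; exact: pow_ge0.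
have [B eB] : exists B, D%:E * \int[mu]_x fp x = B%:E.
  exists (D * fine (\int[mu]_x fp x))%R; rewrite EFinM fineK// ge0_fin_numE//.
rewrite eB in bnd; have w0 := wint_ge0 mu A nw.
apply/eqP; rewrite eq_le w0 andbT leNgt; apply/negP => wA.
have B0 : (0 <= B)%R by rewrite -lee_fin -eB mule_ge0.
move: (wint w A) w0 wA bnd => [v| |]// _ v0 bnd; last first.
  by have := bnd 1%R ltr01; rewrite powR1 mul1e leNgt ltry.
(* At this height s^p v = B + 1, which contradicts the bound [B]. *)
rewrite lte_fin in v0; pose s := (((B + 1) / v) `^ p^-1)%R.
have Bv0 : (0 < (B + 1) / v)%R by rewrite divr_gt0// ltr_wpDl.
have /bnd : (0 < s)%R by rewrite powR_gt0.
rewrite /s -powRrM mulVf ?gt_eqF// powRr1 ?(ltW Bv0)//.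
by rewrite -EFinM divfK ?gt_eqF// lee_fin; apply/negP; rewrite -ltNge ltrDl.
Qed.

Lemma strong_type : \int[mu]_x (maxw w f x `^ p * (w x)%:E) <=
  strong_cst%:E * \int[mu]_x (f x `^ p * (w x)%:E).
Proof.
have cstgt0 : (0 < strong_cst)%R.
  have D'0 : (0 < D)%R by exact: lt_le_trans D1.
  by rewrite /strong_cst !mulr_gt0 ?powR_gt0// invr_gt0 subr_gt0 powR2_gt1.
have I0 : 0 <= \int[mu]_x fp x by apply: integral_ge0 => x _; exact: pow_ge0.
have [fpoo|] := ltP (\int[mu]_x fp x) +oo; last first.
  by rewrite leye_eq => /eqP; rewrite /fp => ->; rewrite gt0_muley ?leey.
have F0oo := F_infty fpoo.
pose A N := [set x | (lev N 0)%:E < F x <= (lev N (N + N))%:E].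
have mA N : measurable (A N).
  rewrite (_ : A N = [set x | (lev N 0)%:E < F x] `\` [set x | (lev N (N + N))%:E < F x]).
    by apply: measurableD; exact: sup_gt.
  apply/seteqP; split => x /=.
    by move=> /andP[h1 h]; split => //=; apply/negP; rewrite -leNgt.
  by move=> [/= h1 /negP]; rewrite -leNgt => h2; apply/andP; split.
have mU : measurable (\bigcup_N A N) by exact: bigcupT_measurable.
have ndA : nondecreasing_seq A.
  move=> i j ij; apply/subsetPset => x /= /andP[h1 h2]; apply/andP; split.
    apply: le_lt_trans h1; rewrite lee_fin /lev ler_wpM2l ?expr0//.
    by rewrite lef_pV2 ?posrE ?exprn_gt0// ler_weXn2l// ler1n.
  apply: (le_trans h2); rewrite lee_fin /lev !exprD !mulfK ?expf_neq0//.
  by rewrite ler_weXn2l// ler1n.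
have mFp : measurable_fun setT Fp by exact: mpow.
have Fp0 x : 0 <= Fp x by exact: pow_ge0.
pose nu : {measure set T -> \bar R} := dens mu mFp Fp0.
have cvg : nu \o A @ \oo --> nu (\bigcup_N A N) by exact: nondecreasing_cvg_mu.
have bU : \int[mu]_(x in \bigcup_N A N) Fp x <= strong_cst%:E * \int[mu]_x fp x.
  by apply: (cvge_to_le cvg); apply: nearW => N; exact: level_bound.
have -> : \int[mu]_x (maxw w f x `^ p * (w x)%:E) = \int[mu]_(x in \bigcup_N A N) Fp x.
  rewrite -[X in integral _ X _](setvU (\bigcup_N A N)) setUC ge0_integral_setU//=.
  - rewrite [X in _ + X](_ : _ = 0) ?adde0//.
    apply/eqP; rewrite eq_le; apply/andP; split; last first.
      by apply: integral_ge0 => x _; exact: Fp0.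
    rewrite -(integral0 mu (~` (\bigcup_N A N))).
    apply: ae_ge0_le_integral; [exact: measurableC|by move=> x _; exact: Fp0|exact: mpow|by []|by []|].
    exists [set x | F x = +oo]; split => //.
      rewrite (_ : [set x | _] = F @^-1` [set +oo]); last by apply/seteqP; split.
      by rewrite -[X in measurable X]setTI; apply: mF => //; exact: emeasurable_set1.
    move=> x /= h; apply: contrapT => Fx; apply: h => nU.
    suff e : F x = 0 by rewrite -/F e poweR0r ?gt_eqF// mul0e.
    apply: contrapT => Fx0; apply: nU.
    move: (F0 x) Fx Fx0; case eF : (F x) => [y| |]// y0 _ ny0.
    have {}y0 : (0 < y)%R.
      rewrite lt_neqAle -lee_fin y0 andbT eq_sym; apply/eqP => y00.
      by apply: ny0; rewrite y00.
    pose N := maxn (Num.truncn y^-1) (Num.truncn y).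
    have pow2 (z : R) : (Num.truncn z <= N)%N -> (z < 2 ^+ N)%R.
      move=> zN; apply: (lt_le_trans (truncnS_gt _)); rewrite -natrX ler_nat.
      by apply: leq_ltn_trans zN _; exact: ltn_expl.
    exists N => //; rewrite /A /= eF lte_fin lee_fin; apply/andP; split.
      rewrite /lev expr0 mul1r -[ltRHS]invrK ltf_pV2 ?posrE ?invr_gt0 ?exprn_gt0//.
      by apply: pow2; exact: leq_maxl.
    by rewrite /lev exprD mulfK ?expf_neq0//; apply/ltW/pow2; exact: leq_maxr.
  - exact: measurableC.
  - exact: measurable_funTS.
  - by rewrite disj_set2E setICr.
exact: bU.
Qed.

End strong_type.

Section powR_facts.
Context {R : realType}.
Local Open Scope ring_scope.
Implicit Types x y a b r s : R.

Lemma powRD_gt0 x r s : 0 < x -> x `^ (r + s) = x `^ r * x `^ s.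
Proof. by move=> x0; rewrite powRD//; apply/implyP => _; rewrite gt_eqF. Qed.

Lemma powRV x r : 0 < x -> (x^-1) `^ r = (x `^ r)^-1.
Proof.
move=> x0; rewrite -[in LHS]powR_inv1 ?ltW// -powRrM mulN1r.
by rewrite powRN.
Qed.

Lemma amgm2 a x y : 0 < a < 1 -> 0 <= x -> 0 <= y ->
  x `^ a * y `^ (1 - a) <= a * x + (1 - a) * y.
Proof.
move=> /andP[a0 a1] x0 y0; have b0 : 0 < 1 - a by rewrite subr_gt0.
have := @conjugate_powR R (x `^ a) (y `^ (1 - a)) a^-1 (1 - a)^-1 (powR_ge0 _ _)
  (powR_ge0 _ _); rewrite !invr_gt0 => /(_ a0 b0); rewrite !invrK addrC subrK => /(_ erefl).
by rewrite -!powRrM !mulfV ?gt_eqF// !powRr1// [x * a]mulrC [y * _]mulrC.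
Qed.

Lemma ge1_powR_le a x y : 0 < a -> 0 <= x -> 0 <= y -> (x `^ a <= y `^ a) = (x <= y).
Proof.
move=> a0 x0 y0; apply/idP/idP => h; last first.
  by apply: ge0_ler_powR; rewrite ?nnegrE// ltW.
rewrite leNgt; apply/negP => yx; move: h; apply/negP; rewrite -ltNge.
by apply: gt0_ltr_powR; rewrite ?nnegrE.
Qed.

End powR_facts.

(** * Power means indexed by reciprocal exponents *)

Section power_means.
Context d (T : measurableType d) (R : realType) (mu : {measure set T -> \bar R}).
Variables (A : set T) (m : R).
Hypotheses (mA : measurable A) (m0 : (0 < m)%R) (muA : mu A <= m%:E).
Local Notation wint := (wint mu).
Implicit Types (a b c e : R) (f g : T -> R).

(* The power mean of [f] over [A] of exponent [1 / a] with respect to [mu / m] is at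
   most [c]; [a = 0] is the essential supremum. *)
Definition pmean a f c : Prop :=
  if a == 0%R then {ae mu, forall x, A x -> (f x <= c)%R}
  else wint (fun x => f x `^ a^-1)%R A <= (c `^ a^-1 * m)%:E.

(** Hoelder's inequality: with reciprocal exponents the indices add. After normalisation by [c] and
    [e] it is the pointwise weighted AM-GM inequality with weight a / (a + b), integrated; the index
    0 is an essential bound and is treated apart. *)
Lemma pmean_mul a b f g c e : (0 <= a)%R -> (0 <= b)%R -> (0 < c)%R -> (0 < e)%R ->
  posw f -> posw g -> pmean a f c -> pmean b g e ->
  pmean (a + b) (fun x => f x * g x)%R (c * e).
Proof.
move=> a0 b0 c0 e0 pf pg; rewrite /pmean; have [->|an0] := eqVneq a 0%R.
  rewrite add0r; have [_ hf hg|bn0 hf hg] := eqVneq b 0%R.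
    apply: filterS2 hf hg => x hf hg Ax.
    by apply: ler_pM; rewrite ?hf ?hg// ltW ?pf.2 ?pg.2.
  have bV0 : (0 < b^-1)%R by rewrite invr_gt0 lt0r bn0.
  apply: (@le_trans _ _ ((c `^ b^-1)%:E * wint (fun x => g x `^ b^-1)%R A)); last first.
    rewrite powRM ?(ltW c0) ?(ltW e0)// -mulrA EFinM; apply: lee_wpmul2l => //.
    by rewrite lee_fin powR_ge0.
  apply: le_wint => //; rewrite ?powR_ge0//.
  - by apply: posw_nnw; apply: posw_powR; exact: posw_mul.
  - by apply: posw_nnw; exact: posw_powR.
  apply: filterS hf => x hf Ax; rewrite powRM ?(ltW (pf.2 _)) ?(ltW (pg.2 _))//.
  by rewrite ler_wpM2r ?powR_ge0// ge1_powR_le ?hf// ltW// pf.2.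
have a_gt0 : (0 < a)%R by rewrite lt0r an0.
have [->|bn0] := eqVneq b 0%R.
  rewrite addr0 (negbTE an0) => hf hg.
  have aV0 : (0 < a^-1)%R by rewrite invr_gt0.
  apply: (@le_trans _ _ ((e `^ a^-1)%:E * wint (fun x => f x `^ a^-1)%R A)); last first.
    rewrite powRM ?(ltW c0) ?(ltW e0)// -mulrA mulrCA EFinM; apply: lee_wpmul2l => //.
    by rewrite lee_fin powR_ge0.
  apply: le_wint => //; rewrite ?powR_ge0//.
  - by apply: posw_nnw; apply: posw_powR; exact: posw_mul.
  - by apply: posw_nnw; exact: posw_powR.
  apply: filterS hg => x hg Ax; rewrite powRM ?(ltW (pf.2 _)) ?(ltW (pg.2 _))//.
  by rewrite mulrC ler_wpM2r ?powR_ge0// ge1_powR_le ?hg// ltW// pg.2.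
have b_gt0 : (0 < b)%R by rewrite lt0r bn0.
have ab0 : (0 < a + b)%R by rewrite addr_gt0.
rewrite gt_eqF// => hf hg.
pose th := (a / (a + b))%R.
have th0 : (0 < th < 1)%R by rewrite divr_gt0//= ltr_pdivrMr// mul1r ltrDl.
have thC : (1 - th = b / (a + b))%R by rewrite /th; field; rewrite gt_eqF.
pose F := (c `^ a^-1)%R; pose G := (e `^ b^-1)%R; pose H := ((c * e) `^ (a + b)^-1)%R.
have F0 : (0 < F)%R by rewrite powR_gt0.
have G0 : (0 < G)%R by rewrite powR_gt0.
have H0 : (0 < H)%R by rewrite powR_gt0// mulr_gt0.
have pf' := posw_powR a^-1 pf; have pg' := posw_powR b^-1 pg.
pose cf := (H * (th / F))%R; pose cg := (H * ((1 - th) / G))%R.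
have cf0 : (0 <= cf)%R by rewrite !mulr_ge0// ?invr_ge0 ltW//; case/andP: th0.
have cg0 : (0 <= cg)%R.
  by rewrite !mulr_ge0// ?invr_ge0 ?(ltW H0) ?(ltW G0)// subr_ge0 ltW//; case/andP: th0.
apply: (@le_trans _ _ (cf%:E * wint (fun x => f x `^ a^-1)%R A +
   cg%:E * wint (fun x => g x `^ b^-1)%R A)); last first.
  apply: (@le_trans _ _ (cf%:E * (F * m)%:E + cg%:E * (G * m)%:E)).
    by apply: leeD; apply: lee_wpmul2l; rewrite ?lee_fin.
  rewrite -!EFinM -EFinD lee_fin /cf /cg -/H.
  suff -> : (H * (th / F) * (F * m) + H * ((1 - th) / G) * (G * m) = H * m)%R by [].
  by field; rewrite !gt_eqF.
rewrite /wint -!ge0_integralZl_EFin//; last 4 first.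
- by move=> x _; rewrite lee_fin powR_ge0.
- exact: nnw_mE (posw_nnw pg') _.
- by move=> x _; rewrite lee_fin powR_ge0.
- exact: nnw_mE (posw_nnw pf') _.
rewrite -ge0_integralD//; last 4 first.
- by move=> x _; rewrite -EFinM lee_fin mulr_ge0// powR_ge0.
- by apply: measurable_funeM; exact: nnw_mE (posw_nnw pf') _.
- by move=> x _; rewrite -EFinM lee_fin mulr_ge0// powR_ge0.
- by apply: measurable_funeM; exact: nnw_mE (posw_nnw pg') _.
apply: ge0_le_integral => //.
- by move=> x _; rewrite lee_fin powR_ge0.
- by apply: (nnw_mE (posw_nnw (posw_powR _ (posw_mul pf pg)))).
- by apply: emeasurable_funD; apply: measurable_funeM;
    [exact: nnw_mE (posw_nnw pf') _|exact: nnw_mE (posw_nnw pg') _].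
move=> x _; rewrite -!EFinM -EFinD lee_fin.
pose X := (f x `^ a^-1 / F)%R; pose Y := (g x `^ b^-1 / G)%R.
have X0 : (0 <= X)%R by rewrite mulr_ge0 ?powR_ge0// invr_ge0 ltW.
have Y0 : (0 <= Y)%R by rewrite mulr_ge0 ?powR_ge0// invr_ge0 ltW.
have Xth : (X `^ th = (f x / c) `^ (a + b)^-1)%R.
  rewrite /X /F -powRV// -powRM ?invr_ge0 ?(ltW c0) ?(ltW (pf.2 x))//.
  by rewrite -powRrM /th mulrA mulVf// mul1r.
have Yth : (Y `^ (1 - th) = (g x / e) `^ (a + b)^-1)%R.
  rewrite /Y /G thC -powRV// -powRM ?invr_ge0 ?(ltW e0) ?(ltW (pg.2 x))//.
  by rewrite -powRrM mulrA mulVf// mul1r.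
have fc0 : (0 <= f x / c)%R by rewrite divr_ge0 ?ltW ?pf.2.
have ge0 : (0 <= g x / e)%R by rewrite divr_ge0 ?ltW ?pg.2.
have -> : ((f x * g x) `^ (a + b)^-1 = H * (X `^ th * Y `^ (1 - th)))%R.
  rewrite Xth Yth -(powRM _ fc0 ge0) /H -powRM; [|by rewrite mulr_ge0 ?(ltW c0) ?(ltW e0)|by rewrite mulr_ge0].
  by congr (_ `^ _)%R; field; rewrite !gt_eqF.
have -> : (cf * f x `^ a^-1 + cg * g x `^ b^-1 = H * (th * X + (1 - th) * Y))%R.
  by rewrite /cf /cg /X /Y; field; rewrite !gt_eqF.
by rewrite ler_wpM2l ?(ltW H0)// amgm2.
Qed.

Lemma pmean_pow a f c t : (0 <= a)%R -> (0 <= t)%R -> (0 < c)%R -> posw f ->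
  pmean a f c -> pmean (a * t) (fun x => f x `^ t)%R (c `^ t).
Proof.
move=> a0 t0 c0 pf; rewrite /pmean mulf_eq0.
have [->|an0] := eqVneq a 0%R.
  move=> /= hf; apply: filterS hf => x hf Ax.
  by apply: ge0_ler_powR; rewrite ?nnegrE ?hf ?(ltW (pf.2 x)) ?(ltW c0).
have [->|tn0] /= := eqVneq t 0%R.
  by move=> _; apply: aeW => x _; rewrite !powRr0.
rewrite -powRrM invfM mulrCA mulfV// mulr1.
by under [in X in _ -> X]eq_fun do rewrite -powRrM mulrCA mulfV// mulr1.
Qed.

Let wint1 r : wint (fun=> 1 `^ r)%R A = mu A.
Proof.
rewrite -[RHS]mul1e -(integral_cst _ mA); apply: eq_integral => x _.
by rewrite powR1.
Qed.

Lemma pmean_one b : (0 <= b)%R -> pmean b (fun=> 1%R) 1.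
Proof.
move=> b0; rewrite /pmean; case: ifPn => _; first by apply: aeW => x _.
by rewrite wint1 powR1 mul1r.
Qed.

(** Jensen's inequality as [pmean_mul] against the constant 1, whose mean is at most 1 because
    [mu A] is at most [m]. *)
Lemma pmean_mono a b f c : (0 <= a)%R -> (a <= b)%R -> (0 < c)%R -> posw f ->
  pmean a f c -> pmean b f c.
Proof.
move=> a0 ab c0 pf hf.
have ba0 : (0 <= b - a)%R by rewrite subr_ge0.
have p1 : posw (fun _ : T => 1%R : R) by split => //; exact: measurable_cst.
have := pmean_mul a0 ba0 c0 ltr01 pf p1 hf (pmean_one ba0).
have -> : (fun x => f x * 1)%R = f by apply/funext => x; rewrite mulr1.
by have -> : (a + (b - a) = b)%R by [rewrite addrC subrK]; rewrite mulr1.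
Qed.

Lemma pmean_le a f c e : (0 <= a)%R -> (0 < c)%R -> (c <= e)%R -> pmean a f c -> pmean a f e.
Proof.
move=> a0 c0 ce; rewrite /pmean; case: ifPn => [_|an0] hf.
  by apply: filterS hf => x hf Ax; exact: le_trans (hf Ax) ce.
apply: (le_trans hf); rewrite lee_fin ler_wpM2r ?(ltW m0)//.
by apply: ge0_ler_powR; rewrite ?nnegrE ?invr_ge0 ?(ltW c0)//; exact: le_trans (ltW c0) ce.
Qed.

Lemma pmean1_ge1 a c : (0 <= a)%R -> (0 < c)%R -> mu A = m%:E ->
  pmean a (fun=> 1%R) c -> (1 <= c)%R.
Proof.
move=> a0 c0 eA; rewrite /pmean; have [_|an0] := eqVneq a 0%R.
  move=> [N [mN N0 h]]; rewrite leNgt; apply/negP => c1.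
  have : mu A <= mu N.
    apply: le_measure; rewrite ?inE// => x Ax; apply: h => /= /(_ Ax).
    by apply/negP; rewrite -ltNge.
  by rewrite N0 eA lee_fin leNgt m0.
rewrite wint1 eA lee_fin -{1}[m]mul1r ler_pM2r// => h.
have a'0 : (0 < a^-1)%R by rewrite invr_gt0 lt0r an0.
by rewrite -(ge1_powR_le a'0) ?(ltW c0)// powR1.
Qed.

(** The product of [f] and its inverse is 1, whose mean over a set of measure exactly [m] is 1. This
    turns an upper bound for the mean of 1/w into a lower bound for the mean of w. *)
Lemma pmean_inv_ge1 a b f c e : (0 <= a)%R -> (0 <= b)%R -> (0 < c)%R -> (0 < e)%R ->
  posw f -> mu A = m%:E -> pmean a f c -> pmean b (fun x => (f x)^-1)%R e -> (1 <= c * e)%R.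
Proof.
move=> a0 b0 c0 e0 pf eA hf hg.
have := pmean_mul a0 b0 c0 e0 pf (posw_inv pf) hf hg.
rewrite (_ : (fun x => _) = fun=> 1%R); last first.
  by apply/funext => x; rewrite mulfV// gt_eqF// pf.2.
by apply: pmean1_ge1 => //; rewrite ?addr_ge0 ?mulr_gt0.
Qed.

End power_means.

(** * Doubling for the power mean classes *)

Section muckenhoupt.
Context d (T : measurableType d) (R : realType) (mu : {measure set T -> \bar R}).
Context (C : Type) (Q : C -> set T) (trip : C -> C) (rc : nat -> C) (K3 : R).
Hypothesis CB : cube_basis mu Q trip rc K3.
Local Notation wint := (wint mu).
Local Notation maxw := (maxw mu Q rc).

Definition cmass i : R := fine (mu (Q i)).

(* For [a = 1/p - 1/p_+] and [b = 1/p_- - 1/p] this says that [w^p] lies in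
   A_(p/p_-) and RH_((p_+/p)'). *)
Definition apw (a b : R) (w : T -> R) (K : R) : Prop := forall i, exists c e : R,
  [/\ (0 < c)%R, (0 < e)%R, (c * e <= K)%R, pmean mu (Q i) (cmass i) a w c &
      pmean mu (Q i) (cmass i) b (fun x => (w x)^-1)%R e].

Lemma cmassE i : mu (Q i) = (cmass i)%:E.
Proof. by rewrite fineK// ge0_fin_numE// (cb_fin CB). Qed.

Lemma cmass_gt0 i : (0 < cmass i)%R.
Proof. by rewrite -lte_fin -cmassE; exact: cb_gt0 CB i. Qed.

Lemma apw_sym a b w K : posw w -> apw a b w K -> apw b a (fun x => (w x)^-1)%R K.
Proof.
move=> pw h i; have [c [e [c0 e0 ce hc he]]] := h i; exists e, c; split => //.
  by rewrite mulrC.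
by under eq_fun do rewrite invrK.
Qed.

Section ap.
Variables (a b : R) (w : T -> R) (K : R).
Hypotheses (a0 : (0 < a)%R) (b0 : (0 < b)%R) (pw : posw w) (AP : apw a b w K).

Definition apw_dbl : R := ((K * K3 `^ b) `^ a^-1 * K3)%R.

Let u x : R := (w x `^ a^-1)%R.
Let pu : posw u. Proof. exact: posw_powR. Qed.

Lemma apw_wint_fin i : wint u (Q i) < +oo.
Proof.
have [c [e [_ _ _ + _]]] := AP i; rewrite /pmean gt_eqF// => h.
by apply: (le_lt_trans h); rewrite ltry.
Qed.

Lemma apw_K1 (i0 : C) : (1 <= K)%R.
Proof.
have [c [e [c0 e0 ce hc he]]] := AP i0; apply: le_trans ce.
have := cb_meas CB i0 => mQ; have := cmassE i0 => eQ.
exact: (pmean_inv_ge1 mQ (cmass_gt0 i0) (ltW a0) (ltW b0) c0 e0 pw eQ hc he).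
Qed.

(** On the small cube the means of w and 1/w have product at least 1, and the mean of 1/w there is
    at most K3^b times the bound on the triple. Against the bound [K] on the triple, the mean of w
    grows by at most K K3^b; the power 1/a and the ratio of volumes give [apw_dbl]. *)
Lemma apw_doubling i : wint u (Q (trip i)) <= apw_dbl%:E * wint u (Q i).
Proof.
have mQ := cb_meas CB; have K31 := cb_K3 CB.
have K30 : (0 < K3)%R by exact: lt_le_trans K31.
have [c [e [c0 e0 ce hc he]]] := AP (trip i).
have ufin : wint u (Q i) = (fine (wint u (Q i)))%:E.
  by rewrite fineK// ge0_fin_numE ?apw_wint_fin// wint_ge0//; exact: posw_nnw.
set U := fine _ in ufin.
have U0 : (0 < U)%R by rewrite -lte_fin -ufin; exact: (wintQ_gt0 CB).
have m0 := cmass_gt0 i; have mt0 := cmass_gt0 (trip i).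
have mt : (cmass (trip i) <= K3 * cmass i)%R.
  by rewrite -lee_fin -cmassE EFinM -cmassE; exact: cb_trip_le CB i.
pose c1 := ((U / cmass i) `^ a)%R.
have Um0 : (0 < U / cmass i)%R by rewrite divr_gt0.
have c10 : (0 < c1)%R by rewrite powR_gt0.
have h1 : pmean mu (Q i) (cmass i) a w c1.
  rewrite /pmean gt_eqF// -/u ufin lee_fin /c1 -powRrM mulfV ?gt_eqF// powRr1 ?(ltW Um0)//.
  by rewrite divfK ?gt_eqF.
pose e1 := (e * K3 `^ b)%R.
have e10 : (0 < e1)%R by rewrite mulr_gt0// powR_gt0.
have h2 : pmean mu (Q i) (cmass i) b (fun x => (w x)^-1)%R e1.
  move: he; rewrite /pmean gt_eqF// => he.
  apply: (@le_trans _ _ (wint (fun x => (w x)^-1 `^ b^-1)%R (Q (trip i)))).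
    apply: wint_sub => //; last exact: cb_trip_sub CB i.
    by apply: posw_nnw; apply: posw_powR; exact: posw_inv.
  apply: (le_trans he); rewrite lee_fin /e1 powRM ?powR_ge0 ?(ltW e0)//.
  rewrite -powRrM mulfV ?gt_eqF// powRr1 ?(ltW K30)// -mulrA.
  by rewrite ler_wpM2l ?powR_ge0.
have ce1 : (1 <= c1 * e1)%R.
  exact: (pmean_inv_ge1 (mQ i) m0 (ltW a0) (ltW b0) c10 e10 pw (cmassE i) h1 h2).
have cle : (c <= c1 * (K * K3 `^ b))%R.
  rewrite -(ler_pM2r e0); apply: (le_trans ce).
  have K0 : (0 < K)%R by apply: lt_le_trans ce; rewrite mulr_gt0.
  have -> : (c1 * (K * K3 `^ b) * e = K * (c1 * e1))%R by rewrite /e1; ring.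
  by rewrite ler_peMr ?(ltW K0).
move: hc; rewrite /pmean gt_eqF// => /le_trans; apply.
rewrite ufin -EFinM lee_fin /apw_dbl.
have K0 : (0 < K)%R by apply: lt_le_trans ce; rewrite mulr_gt0.
apply: (@le_trans _ _ ((c1 * (K * K3 `^ b)) `^ a^-1 * (K3 * cmass i))%R).
  apply: ler_pM; rewrite ?powR_ge0 ?(ltW mt0)//.
  apply: ge0_ler_powR; rewrite ?nnegrE ?invr_ge0 ?(ltW a0) ?(ltW c0)//.
  by rewrite !mulr_ge0 ?powR_ge0 ?(ltW c10) ?(ltW K0).
rewrite powRM ?(ltW c10) ?mulr_ge0 ?powR_ge0 ?(ltW K0)//.
rewrite /c1 -powRrM mulfV ?gt_eqF// powRr1 ?(ltW Um0)//.
rewrite [leLHS](_ : _ = (K * K3 `^ b) `^ a^-1 * K3 * (U / cmass i * cmass i))%R; last by ring.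
by rewrite divfK ?gt_eqF.
Qed.

Lemma apw_dbl_ge1 (i0 : C) : (1 <= apw_dbl)%R.
Proof.
have K31 := cb_K3 CB; have K1 := apw_K1 i0.
rewrite /apw_dbl -[leLHS]mulr1; apply: ler_pM => //.
have e : (1 = 1 `^ a^-1 :> R)%R by rewrite powR1.
rewrite [leLHS]e; apply: ge0_ler_powR; rewrite ?nnegrE ?invr_ge0 ?(ltW a0)//.
  by rewrite mulr_ge0 ?powR_ge0// (le_trans _ K1).
rewrite -[leLHS]mulr1; apply: ler_pM => //.
have e' : (1 = 1 `^ b :> R)%R by rewrite powR1.
by rewrite [leLHS]e'; apply: ge0_ler_powR; rewrite ?nnegrE ?(ltW b0)// (le_trans _ K31).
Qed.

End ap.
End muckenhoupt.

(** * Lerner's proof of Muckenhoupt's theorem *)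

Section lerner.
Context d (T : measurableType d) (R : realType) (mu : {measure set T -> \bar R}).
Context (C : Type) (Q : C -> set T) (trip : C -> C) (rc : nat -> C) (K3 : R).
Hypothesis CB : cube_basis mu Q trip rc K3.
Local Notation wint := (wint mu).
Local Notation maxw := (maxw mu Q rc).
Variables (a b : R) (w : T -> R) (K : R).
Hypotheses (a0 : (0 < a)%R) (b0 : (0 < b)%R) (pw : posw w) (AP : apw mu Q a b w K).
Variable f : T -> \bar R.
Hypotheses (mf : measurable_fun setT f) (f0 : forall x, 0 <= f x).

Let u x : R := (w x `^ a^-1)%R.
Let s x : R := ((w x)^-1 `^ b^-1)%R.
Let pu : posw u. Proof. exact: posw_powR. Qed.
Let ps : posw s. Proof. by apply: posw_powR; exact: posw_inv. Qed.
Let APs := apw_sym pw AP.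
Let ufin : forall i, wint u (Q i) < +oo := apw_wint_fin a0 AP.
Let sfin : forall i, wint s (Q i) < +oo := apw_wint_fin b0 APs.
Let p := ((a + b) / a)%R.
Let p' := ((a + b) / b)%R.
Let p1 : (1 < p)%R. Proof. by rewrite ltr_pdivlMr// mul1r ltrDl. Qed.
Let p'1 : (1 < p')%R. Proof. by rewrite ltr_pdivlMr// mul1r ltrDr. Qed.
Let i0 := rc 0%N.

Let fs y : \bar R := f y * ((s y)^-1)%:E.
Let g := maxw s fs.
(** Here [u] and [s] are the weight and its dual, and b / a = p - 1. [G] is the function M_s(f /
    s)^(p - 1) / u of Lerner's bound, to which the maximal operator of the measure [u] is
    applied. *)
Let G y : \bar R := g y `^ (b / a) * ((u y)^-1)%:E.

Let mfs : measurable_fun setT fs.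
Proof. by apply: emeasurable_funM => //; apply: nnw_mE; apply: posw_nnw; exact: posw_inv. Qed.

Let fs0 y : 0 <= fs y.
Proof. by rewrite mule_ge0// lee_fin invr_ge0 ltW// ps.2. Qed.

Let mg : measurable_fun setT g. Proof. exact: (measurable_maxw CB). Qed.
Let g0 y : 0 <= g y. Proof. exact: (maxw_ge0 CB ps sfin). Qed.

Let mG : measurable_fun setT G.
Proof.
apply: emeasurable_funM; first exact: (measurableT_comp (measurable_poweR _)).
by apply: nnw_mE; apply: posw_nnw; exact: posw_inv.
Qed.

Let G0 y : 0 <= G y.
Proof. by rewrite mule_ge0 ?poweR_ge0// lee_fin invr_ge0 ltW// pu.2. Qed.

Let fsE y : fs y * (s y)%:E = f y.
Proof. by rewrite /fs -muleA -EFinM mulVf ?mule1// gt_eqF// ps.2. Qed.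

Let GE y : G y * (u y)%:E = g y `^ (b / a).
Proof. by rewrite /G -muleA -EFinM mulVf ?mule1// gt_eqF// pu.2. Qed.

Lemma le_poweR (x y : \bar R) (r : R) : (0 <= r)%R -> 0 <= x -> x <= y -> x `^ r <= y `^ r.
Proof.
move=> r0 x0 xy; apply: gt0_ler_poweR => //; rewrite in_itv/= leey andbT//.
exact: le_trans xy.
Qed.

(* Lerner's pointwise bound, through [avg f = (S / m) * mm] with
   [mm <= maxw s (f / s)] on the whole cube. *)
Let pointwise x : maxw (fun=> 1%R) f x <= (K `^ b^-1)%:E * maxw u G x `^ (a / b).
Proof.
apply: ge_ereal_sup => _ [j Qx <-]; set i := rc j in Qx *.
have mQ : measurable (Q i) by exact: cb_meas CB i.
have [S S0 eS] := wintQE CB ps sfin i.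
have [U U0 eU] := wintQE CB pu ufin i.
have m0 := cmass_gt0 CB i; have em := cmassE CB i; set m := cmass mu Q i in m0 em *.
pose mm := avgw mu Q s fs i.
have mm0 : 0 <= mm by exact: (avgw_ge0 CB).
have eF : \int[mu]_(y in Q i) f y = S%:E * mm.
  rewrite /mm /avgw eS inver gt_eqF// muleA -EFinM mulfV ?gt_eqF// mul1e.
  by apply: eq_integral => y _; rewrite fsE.
have gmm y : Q i y -> mm <= g y.
  by move=> Qy; apply: ereal_sup_ubound; exists j.
have h1 : mm `^ (b / a) * m%:E <= \int[mu]_(y in Q i) (g y `^ (b / a)).
  rewrite -em -(integral_cst mu mQ); apply: ge0_le_integral => //.
  - by move=> y _; exact: poweR_ge0.
  - by apply: measurable_funTS; exact: (measurableT_comp (measurable_poweR _)).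
  - move=> y Qy; apply: le_poweR => //; last exact: gmm.
    by rewrite divr_ge0 ?(ltW a0) ?(ltW b0).
pose X := maxw u G x.
have X0 : 0 <= X by exact: (maxw_ge0 CB).
have h2 : \int[mu]_(y in Q i) (g y `^ (b / a)) <= U%:E * X.
  have : avgw mu Q u G i <= X by apply: ereal_sup_ubound; exists j.
  rewrite /avgw eU inver gt_eqF// => h; rewrite -lee_pdivrMl//; apply: le_trans h.
  rewrite (_ : \int[mu]_(y in Q i) (G y * (u y)%:E) = \int[mu]_(y in Q i) (g y `^ (b / a)))//.
  by apply: eq_integral => y _; rewrite GE.
have h3 : mm `^ (b / a) <= (U / m)%:E * X.
  have := le_trans h1 h2; rewrite muleC -lee_pdivlMl// => /le_trans; apply.
  by rewrite muleA -EFinM mulrC.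
have h4 : mm <= ((U / m) `^ (a / b))%:E * X `^ (a / b).
  have ab0 : (0 <= a / b)%R by rewrite divr_ge0 ?(ltW a0) ?(ltW b0).
  have -> : mm = (mm `^ (b / a)) `^ (a / b).
    by rewrite -poweRrM (_ : b / a * (a / b) = 1)%R ?poweRe1//; field; rewrite !gt_eqF.
  rewrite -poweR_EFin -poweRM ?lee_fin ?divr_ge0 ?(ltW U0) ?(ltW m0)//.
  by apply: le_poweR => //; exact: poweR_ge0.
have -> : avgw mu Q (fun=> 1%R) f i = (S / m)%:E * mm.
  rewrite /avgw (_ : wint (fun=> 1%R) (Q i) = m%:E); last first.
    by rewrite /wint (integral_cst mu mQ 1) mul1e em.
  under eq_integral do rewrite mule1.
  by rewrite eF inver gt_eqF// muleA -EFinM mulrC.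
have Sm0 : (0 <= S / m)%R by rewrite divr_ge0 ?(ltW S0) ?(ltW m0).
apply: le_trans (lee_wpmul2l _ h4) _; first by rewrite lee_fin.
rewrite muleA -EFinM; apply: lee_wpmul2r; first exact: poweR_ge0.
rewrite lee_fin; have [c [e [c0 e0 ce]]] := AP i.
rewrite /pmean !gt_eqF// -/u -/s eS eU !lee_fin => hU hS.
have K0 : (0 < K)%R by apply: lt_le_trans ce; rewrite mulr_gt0.
have hU' : (U / m <= c `^ a^-1)%R by rewrite ler_pdivrMr.
have hS' : (S / m <= e `^ b^-1)%R by rewrite ler_pdivrMr.
apply: (@le_trans _ _ (e `^ b^-1 * c `^ b^-1)%R).
  apply: ler_pM; rewrite ?powR_ge0//.
  have -> : (c `^ b^-1 = (c `^ a^-1) `^ (a / b))%R.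
    by rewrite -powRrM mulrA mulVf ?gt_eqF// mul1r.
  apply: ge0_ler_powR; rewrite ?nnegrE ?powR_ge0//.
    by rewrite divr_ge0 ?(ltW a0) ?(ltW b0).
  by rewrite divr_ge0 ?(ltW U0) ?(ltW m0).
rewrite -powRM ?(ltW e0) ?(ltW c0)// mulrC.
apply: ge0_ler_powR; rewrite ?nnegrE ?invr_ge0 ?(ltW b0) ?(ltW K0)//.
by rewrite mulr_ge0 ?(ltW c0) ?(ltW e0).
Qed.

Definition muck_cst : R := (K `^ (p / b) *
  (strong_cst (apw_dbl K3 a b K) p' * strong_cst (apw_dbl K3 b a K) p))%R.

Lemma strong_cst_gt0 (D r : R) : (1 <= D)%R -> (1 < r)%R -> (0 < strong_cst D r)%R.
Proof.
move=> D1 r1; have D0 : (0 < D)%R by exact: lt_le_trans D1.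
by rewrite /strong_cst !mulr_gt0 ?powR_gt0// invr_gt0 subr_gt0 powR2_gt1// subr_gt0.
Qed.

Lemma muck_cst_gt0 : (0 < muck_cst)%R.
Proof.
have K0 : (0 < K)%R by apply: lt_le_trans (apw_K1 CB a0 b0 pw AP i0).
have D1 := apw_dbl_ge1 CB a0 b0 pw AP i0.
have D1' := apw_dbl_ge1 CB b0 a0 (posw_inv pw) APs i0.
apply: mulr_gt0; first by rewrite powR_gt0.
by apply: mulr_gt0; apply: strong_cst_gt0.
Qed.

(** By [pointwise] the maximal function is controlled by two weighted maximal operators, those of
    the measures [s] and [u]. Their strong type constants depend on doubling only, so no
    self-improvement of the weight is involved and the constant is explicit. *)
Lemma muckenhoupt : \int[mu]_x (maxw (fun=> 1%R) f x `^ ((a + b) / a) * (w x `^ a^-1)%:E) <=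
  muck_cst%:E * \int[mu]_x (f x `^ ((a + b) / a) * (w x `^ a^-1)%:E).
Proof.
rewrite -/p; have K0 : (0 <= K)%R.
  by apply: le_trans (apw_K1 CB a0 b0 pw AP i0).
have p0 : (0 < p)%R by exact: lt_trans p1.
have mp (k : T -> \bar R) (v : T -> R) r : measurable_fun setT k -> posw v ->
    measurable_fun setT (fun x => k x `^ r * (v x)%:E).
  move=> mk pv; apply: emeasurable_funM; last by apply: nnw_mE; exact: posw_nnw.
  exact: (measurableT_comp (measurable_poweR _)).
have gp (k : T -> \bar R) (v : T -> R) r x : posw v -> 0 <= k x `^ r * (v x)%:E.
  by move=> pv; rewrite mule_ge0 ?poweR_ge0// lee_fin ltW// pv.2.
pose X := maxw u G.
have mX : measurable_fun setT X by exact: (measurable_maxw CB).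
have X0 x : 0 <= X x by exact: (maxw_ge0 CB).
have p1' : posw (fun _ : T => 1%R : R) by split => //; exact: measurable_cst.
have w1fin i : wint (fun=> 1%R) (Q i) < +oo.
  by rewrite /wint (integral_cst mu (cb_meas CB i) 1) mul1e; exact: cb_fin CB i.
apply: (@le_trans _ _ ((K `^ (p / b))%:E * \int[mu]_x (X x `^ p' * (u x)%:E))).
  rewrite -ge0_integralZl_EFin ?powR_ge0//; [|by move=> x _; exact: gp|exact: mp].
  apply: ge0_le_integral => //.
  - by move=> x _; exact: (gp _ u).
  - by apply: (mp _ u) => //; exact: (measurable_maxw CB).
  - by apply: measurable_funeM; exact: mp.
  - move=> x _; rewrite muleA; apply: lee_wpmul2r; first by rewrite lee_fin ltW// pu.2.
    have -> : (K `^ (p / b))%:E * X x `^ p' = ((K `^ b^-1)%:E * X x `^ (a / b)) `^ p.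
      rewrite poweRM ?poweR_ge0 ?lee_fin ?powR_ge0// poweR_EFin -powRrM -poweRrM.
      congr ((_ `^ _)%:E * _ `^ _); first by rewrite mulrC.
      by rewrite /p' /p; field; rewrite !gt_eqF.
    apply: le_poweR; [exact: ltW p0|exact: (maxw_ge0 CB p1' w1fin)|exact: pointwise].
rewrite /muck_cst EFinM -muleA; apply: lee_wpmul2l; first by rewrite lee_fin powR_ge0.
have D1 := apw_dbl_ge1 CB a0 b0 pw AP i0.
have D1' := apw_dbl_ge1 CB b0 a0 (posw_inv pw) APs i0.
have dblu := apw_doubling CB a0 b0 pw AP.
have dbls := apw_doubling CB b0 a0 (posw_inv pw) APs.
apply: (le_trans (strong_type CB pu ufin D1 dblu p'1 mG G0)).
rewrite (EFinM (strong_cst (apw_dbl K3 a b K) p') (strong_cst (apw_dbl K3 b a K) p)).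
rewrite -muleA; apply: lee_wpmul2l.
  by rewrite lee_fin ltW// strong_cst_gt0.
(* The exponents fit: p' b / a = p and u^(1 - p') = s; further below s^(1 - p) = u in the same
   way. *)
have -> : \int[mu]_x (G x `^ p' * (u x)%:E) = \int[mu]_x (g x `^ p * (s x)%:E).
  apply: eq_integral => x _; rewrite /G poweRM ?poweR_ge0 ?lee_fin ?invr_ge0 ?(ltW (pu.2 x))//.
  rewrite -poweRrM -muleA poweR_EFin -EFinM.
  congr (_ `^ _ * _%:E); first by rewrite /p' /p; field; rewrite !gt_eqF.
  rewrite powRV ?pu.2// -powRN -[X in (_ * X)%R](powRr1 (ltW (pu.2 x))) -powRD_gt0 ?pu.2//.
  rewrite /u /s -powRrM powRV ?pw.2// -powRN; congr (_ `^ _)%R.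
  by rewrite /p'; field; rewrite !gt_eqF.
apply: (le_trans (strong_type CB ps sfin D1' dbls p1 mfs fs0)).
apply: lee_wpmul2l; first by rewrite lee_fin ltW// strong_cst_gt0.
rewrite le_eqVlt; apply/orP; left; apply/eqP.
apply: eq_integral => x _; rewrite /fs poweRM ?lee_fin ?invr_ge0 ?(ltW (ps.2 x))//.
rewrite -muleA poweR_EFin -EFinM; congr (_ * _%:E).
rewrite powRV ?ps.2// -powRN -[X in (_ * X)%R](powRr1 (ltW (ps.2 x))) -powRD_gt0 ?ps.2//.
rewrite /s -powRrM powRV ?pw.2// -powRN; congr (_ `^ _)%R.
by rewrite /p; field; rewrite !gt_eqF.
Qed.

End lerner.

(** * The Rubio de Francia algorithm *)

Section rubio_de_francia.
Context d (T : measurableType d) (R : realType) (mu : {measure set T -> \bar R}).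
Context (C : Type) (Q : C -> set T) (trip : C -> C) (rc : nat -> C) (K3 : R).
Hypothesis CB : cube_basis mu Q trip rc K3.
Local Notation wint := (wint mu).
Local Notation cmass := (cmass mu Q).
Variables (a b : R) (w : T -> R) (K : R).
Hypotheses (a0 : (0 < a)%R) (b0 : (0 < b)%R) (pw : posw w) (AP : apw mu Q a b w K).
Local Notation M := (maxw mu Q rc (fun=> 1%R)).
Let p := ((a + b) / a)%R.
Let u x : R := (w x `^ a^-1)%R.
Let pu : posw u. Proof. exact: posw_powR. Qed.
Let p1 : (1 < p)%R. Proof. by rewrite ltr_pdivlMr// mul1r ltrDl. Qed.
Let p0 : (0 < p)%R. Proof. exact: lt_trans p1. Qed.
Let pone : posw (fun _ : T => 1%R : R). Proof. by split => //; exact: measurable_cst. Qed.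
Let onefin i : wint (fun=> 1%R) (Q i) < +oo.
Proof. by rewrite /wint (integral_cst mu (cb_meas CB i) 1) mul1e; exact: cb_fin CB i. Qed.
Let oneE i : wint (fun=> 1%R) (Q i) = (cmass i)%:E.
Proof. by rewrite /wint (integral_cst mu (cb_meas CB i) 1) mul1e; exact: (cmassE CB). Qed.

Definition rdf_norm : R := (muck_cst K3 a b K `^ p^-1)%R.
Let B := rdf_norm.
Let B0 : (0 < B)%R.
Proof. by rewrite powR_gt0// (muck_cst_gt0 CB a0 b0 pw AP). Qed.

Variable h : T -> R.
Hypotheses (nh : nnw h) (hfin : wint (fun x => h x `^ p * u x)%R setT < +oo)
  (hpos : 0 < wint (fun x => h x `^ p * u x)%R setT).

(** A monotone iteration towards H = h + M H / (4 B), in place of the usual series of iterates of M;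
    [B] bounds the norm of M on L^p(u). The factor 4 absorbs the crude inequality [poweRD_le], which
    stands in for Minkowski's inequality in bounding the norms of the iterates. *)
Fixpoint rdf_iter N : T -> \bar R :=
  if N is N'.+1 then fun x => (h x)%:E + ((4 * B)^-1)%:E * M (rdf_iter N') x
  else fun=> 0.

Let nI (f : T -> \bar R) := \int[mu]_x (f x `^ p * (u x)%:E).

Let iter_ge0 N x : 0 <= rdf_iter N x.
Proof.
elim: N x => [|N IH] x //=; rewrite adde_ge0 ?lee_fin ?nh.2// mule_ge0//.
  by rewrite lee_fin invr_ge0 mulr_ge0// ltW.
exact: (maxw_ge0 CB pone onefin).
Qed.

Let mh : measurable_fun setT (fun x => (h x)%:E). Proof. exact: nnw_mE. Qed.

Let miter N : measurable_fun setT (rdf_iter N).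
Proof.
elim: N => [|N IH] /=; first exact: measurable_cst.
apply: emeasurable_funD => //; apply: measurable_funeM.
exact: (measurable_maxw CB).
Qed.

Let int1 (f : T -> \bar R) i : \int[mu]_(x in Q i) (f x * 1%:E) = \int[mu]_(x in Q i) f x.
Proof. by apply: eq_integral => x _; rewrite mule1. Qed.

Let maxw_mono (f g : T -> \bar R) x : measurable_fun setT f -> measurable_fun setT g ->
  (forall y, 0 <= f y) -> (forall y, f y <= g y) -> M f x <= M g x.
Proof.
move=> mf mg f0 fg; apply: ge_ereal_sup => _ [j Qx <-].
apply: (@le_trans _ _ (avgw mu Q (fun=> 1%R) g (rc j))); last first.
  by apply: ereal_sup_ubound; exists j.
have [v v0 ev] := wintQE CB pone onefin (rc j).
rewrite /avgw ev inver gt_eqF// !int1; apply: lee_wpmul2l.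
  by rewrite lee_fin invr_ge0 ltW.
apply: ge0_le_integral => //; [exact: cb_meas CB _|exact: measurable_funTS|exact: measurable_funTS].
Qed.

Let iter_mono N x : rdf_iter N x <= rdf_iter N.+1 x.
Proof.
elim: N x => [|N IH] x; first by rewrite [leLHS]/= iter_ge0.
rewrite [leRHS]/= [leLHS]/=; apply: leeD => //; apply: lee_wpmul2l.
  by rewrite lee_fin invr_ge0 mulr_ge0// ltW.
apply: maxw_mono; [exact: miter|exact: (miter N.+1)|exact: iter_ge0|exact: IH].
Qed.

Let mpow (f : T -> \bar R) : measurable_fun setT f ->
  measurable_fun setT (fun x => f x `^ p * (u x)%:E).
Proof.
move=> mf; apply: emeasurable_funM; last by apply: nnw_mE; exact: posw_nnw.
exact: (measurableT_comp (measurable_poweR _)).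
Qed.

Let pow_ge0 (f : T -> \bar R) x : 0 <= f x `^ p * (u x)%:E.
Proof. by rewrite mule_ge0 ?poweR_ge0// lee_fin ltW// pu.2. Qed.

Lemma poweRD_le (x y : \bar R) : 0 <= x -> 0 <= y ->
  (x + y) `^ p <= (2 `^ p)%:E * (x `^ p + y `^ p).
Proof.
wlog xy : x y / x <= y.
  move=> H x0 y0; have [xy|/ltW yx] := leP x y; first exact: H.
  by rewrite addeC [X in _ * X]addeC; exact: H.
move=> x0 y0; apply: (@le_trans _ _ ((2%:E * y) `^ p)).
  apply: le_poweR; [exact: ltW p0|exact: adde_ge0|].
  by rewrite mule_natl mule2n leeD.
rewrite poweRM ?lee_fin// poweR_EFin; apply: lee_wpmul2l; first by rewrite lee_fin powR_ge0.
by rewrite leeDr// poweR_ge0.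
Qed.

Let iter_bound N : nI (rdf_iter N) <= (2 `^ (p + 1))%:E * nI (fun x => (h x)%:E).
Proof.
have I0 : 0 <= nI (fun x => (h x)%:E).
  by apply: integral_ge0 => x _; exact: (pow_ge0 (fun x => (h x)%:E)).
elim: N => [|N IH].
  rewrite /nI [leLHS]integral0_eq; first by rewrite mule_ge0 ?lee_fin ?powR_ge0.
  move=> x _; have -> : rdf_iter 0 x = 0 by [].
  by rewrite poweR0r ?gt_eqF// mul0e.
pose G x := ((4 * B)^-1)%:E * M (rdf_iter N) x.
have c0 : (0 <= (4 * B)^-1)%R by rewrite invr_ge0 mulr_ge0// ltW.
have M0 x : 0 <= M (rdf_iter N) x by exact: (maxw_ge0 CB pone onefin).
have mM : measurable_fun setT (M (rdf_iter N)) by exact: (measurable_maxw CB).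
have G0 x : 0 <= G x by rewrite mule_ge0 ?lee_fin.
have mG : measurable_fun setT G by exact: measurable_funeM.
have nG : nI G <= (((4 * B)^-1) `^ p * (2 `^ (p + 1) * muck_cst K3 a b K))%:E * nI (fun x => (h x)%:E).
  rewrite EFinM -muleA; apply: (@le_trans _ _ ((((4 * B)^-1) `^ p)%:E * nI (M (rdf_iter N)))).
    rewrite /nI -(ge0_integralZl_EFin mu measurableT (fun x _ => pow_ge0 (M (rdf_iter N)) x)
      (mpow mM) (powR_ge0 _ _)).
    rewrite le_eqVlt; apply/orP; left; apply/eqP; apply: eq_integral => x _.
    by rewrite /G poweRM ?lee_fin// poweR_EFin muleA.
  apply: lee_wpmul2l; first by rewrite lee_fin powR_ge0.
  apply: (le_trans (muckenhoupt CB a0 b0 pw AP (miter N) (iter_ge0 N))).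
  have -> : (2 `^ (p + 1) * muck_cst K3 a b K)%:E = (muck_cst K3 a b K)%:E * (2 `^ (p + 1))%:E.
    by rewrite -EFinM mulrC.
  rewrite -muleA; apply: lee_wpmul2l => //.
  by rewrite lee_fin ltW// (muck_cst_gt0 CB a0 b0 pw AP).
apply: (@le_trans _ _ ((2 `^ p)%:E * (nI (fun x => (h x)%:E) + nI G))).
  have hp0 x : setT x -> 0 <= (h x)%:E `^ p * (u x)%:E.
    by move=> _; exact: (pow_ge0 (fun x => (h x)%:E)).
  have gp0 x : setT x -> 0 <= G x `^ p * (u x)%:E by move=> _; exact: (pow_ge0 G).
  have hgp0 x : setT x -> 0 <= (h x)%:E `^ p * (u x)%:E + G x `^ p * (u x)%:E.
    by move=> ?; rewrite adde_ge0 ?hp0 ?gp0.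
  rewrite /nI -(ge0_integralD mu measurableT hp0 (mpow mh) gp0 (mpow mG)).
  rewrite -(ge0_integralZl_EFin mu measurableT hgp0
    (emeasurable_funD (mpow mh) (mpow mG)) (powR_ge0 _ _)).
  apply: ge0_le_integral; first by [].
  - by move=> x _; exact: (pow_ge0 (rdf_iter N.+1)).
  - exact: (mpow (miter N.+1)).
  - by apply: measurable_funeM; apply: emeasurable_funD; exact: mpow.
  - move=> x _; rewrite -ge0_muleDl ?poweR_ge0// muleA; apply: lee_wpmul2r.
      by rewrite lee_fin ltW// pu.2.
    by apply: poweRD_le; [rewrite lee_fin nh.2|exact: G0].
have -> : (2 `^ (p + 1))%:E * nI (fun x => (h x)%:E) =
    (2 `^ p)%:E * (nI (fun x => (h x)%:E) + nI (fun x => (h x)%:E)).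
  by rewrite powRD_gt0// powRr1// EFinM -muleA mule_natl mule2n.
apply: lee_wpmul2l; first by rewrite lee_fin powR_ge0.
apply: leeD => //; apply: (le_trans nG); rewrite -[leRHS]mul1e.
apply: lee_wpmul2r => //; rewrite lee_fin.
have -> : (muck_cst K3 a b K = B `^ p)%R.
  rewrite /B /rdf_norm -powRrM mulVf ?gt_eqF// powRr1//.
  by rewrite ltW// (muck_cst_gt0 CB a0 b0 pw AP).
rewrite powRV ?mulr_gt0// powRM ?(ltW B0)// powRD_gt0// powRr1//.
have e4 : (4 = 2 * 2 :> R)%R by rewrite -natrM.
rewrite e4 powRM//.
(* The term with M carries the factor 2 / 2^p, at most 1 because p > 1. It is thus bounded by the
   term with [h], and the factor 2^(p + 1) reproduces itself. *)
have P2 : (2 <= 2 `^ p :> R)%R.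
  by rewrite -[leLHS](powRr1 (ler0n R 2)); apply: ler_powR; rewrite ?ler1n// ltW.
have BP0 : (0 < B `^ p)%R by rewrite powR_gt0.
have P0 : (0 < 2 `^ p :> R)%R by rewrite powR_gt0.
rewrite (_ : (_ * _)^-1 * _ = 2 / 2 `^ p)%R; last by field; rewrite !gt_eqF.
by rewrite ler_pdivrMr// mul1r.
Qed.

Let H x : \bar R := ereal_sup (range (fun N => rdf_iter N x)).

Let nd x : nondecreasing_seq (fun N => rdf_iter N x).
Proof. by apply/nondecreasing_seqP => N; exact: iter_mono. Qed.

Let Hcvg x : rdf_iter N x @[N --> \oo] --> H x.
Proof. exact: ereal_nondecreasing_cvgn. Qed.

Let mH : measurable_fun setT H.
Proof. by apply: (emeasurable_fun_cvg rdf_iter) => // x _; exact: Hcvg. Qed.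

Let iterH N x : rdf_iter N x <= H x.
Proof. by apply: ereal_sup_ubound; exists N. Qed.

Let H0 x : 0 <= H x. Proof. exact: le_trans (iter_ge0 0 x) (iterH 0 x). Qed.

Let H_bound : nI H <= (2 `^ (p + 1))%:E * nI (fun x => (h x)%:E).
Proof.
have V0 : (0 <= p^-1)%R by rewrite invr_ge0 ltW.
pose g N x := rdf_iter N x `^ p * (u x)%:E.
have mg N : measurable_fun setT (g N) by exact: mpow.
have g0 N x : setT x -> 0 <= g N x by move=> _; exact: (pow_ge0 (rdf_iter N)).
have ndg x : setT x -> nondecreasing_seq (g ^~ x).
  move=> _ i j ij; apply: lee_wpmul2r; first by rewrite lee_fin ltW// pu.2.
  by apply: le_poweR => //; [exact: ltW p0|exact: nd].
apply: (@le_trans _ _ (\int[mu]_x limn (g ^~ x))).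
  apply: ge0_le_integral; first by [].
  - by move=> x _; exact: (pow_ge0 H).
  - exact: (mpow mH).
  - apply: (emeasurable_fun_cvg g) => // x _.
    exact: (ereal_nondecreasing_is_cvgn (ndg x Logic.I)).
  move=> x _.
  have ux0 : (0 < u x)%R by exact: pu.2.
  have gle N : g N x <= limn (g ^~ x).
    rewrite (cvg_lim _ (ereal_nondecreasing_cvgn (ndg x Logic.I)))//.
    by apply: ereal_sup_ubound; exists N.
  have L0 : 0 <= limn (g ^~ x) by apply: le_trans (gle 0%N); exact: g0.
  rewrite -lee_pdivlMr//.
  have L'0 : 0 <= limn (g ^~ x) * ((u x)^-1)%:E by rewrite mule_ge0// lee_fin invr_ge0 ltW.
  have -> : limn (g ^~ x) * ((u x)^-1)%:E = ((limn (g ^~ x) * ((u x)^-1)%:E) `^ p^-1) `^ p.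
    by rewrite -poweRrM mulVf ?gt_eqF// poweRe1.
  apply: le_poweR => //; first exact: ltW.
  apply: ge_ereal_sup => _ [N _ <-].
  have -> : rdf_iter N x = (rdf_iter N x `^ p) `^ p^-1.
    by rewrite -poweRrM mulfV ?gt_eqF// poweRe1.
  apply: le_poweR => //; first exact: poweR_ge0.
  by rewrite lee_pdivlMr//; exact: gle.
rewrite monotone_convergence//.
apply: lime_le; last by apply: nearW => N; exact: iter_bound.
apply: ereal_nondecreasing_is_cvgn => i j ij; apply: ge0_le_integral; [by []|exact: g0|exact: mg|exact: mg|].
by move=> x _; exact: ndg.
Qed.

(** The A_1 property: by construction M of an iterate is at most 4 B times the next iterate, and
    monotone convergence passes this to the limit. *)
Let avgH j x : Q (rc j) x -> \int[mu]_(y in Q (rc j)) H y <= (cmass (rc j) * (4 * B))%:E * H x.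
Proof.
move=> Qx; have mQ : measurable (Q (rc j)) by exact: cb_meas CB _.
have m0 := cmass_gt0 CB (rc j).
have B40 : (0 < 4 * B)%R by rewrite mulr_gt0.
have -> : \int[mu]_(y in Q (rc j)) H y = \int[mu]_(y in Q (rc j)) limn (rdf_iter ^~ y).
  by apply: eq_integral => y _; rewrite (cvg_lim _ (@Hcvg y)).
rewrite (monotone_convergence mu mQ (fun N => measurable_funTS (miter N))
  (fun N x _ => iter_ge0 N x) (fun x _ => @nd x)).
apply: lime_le.
  apply: ereal_nondecreasing_is_cvgn => i k ik; apply: ge0_le_integral; first exact: mQ.
  - by [].
  - exact: measurable_funTS.
  - exact: measurable_funTS.
  - by move=> y _; exact: nd.
apply: nearW => N.
apply: (@le_trans _ _ ((cmass (rc j) * (4 * B))%:E * rdf_iter N.+1 x)); last first.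
  by apply: lee_wpmul2l => //; rewrite lee_fin ltW// mulr_gt0.
apply: (@le_trans _ _ ((cmass (rc j) * (4 * B))%:E * (((4 * B)^-1)%:E * M (rdf_iter N) x))); last first.
  apply: lee_wpmul2l => /=; first by rewrite lee_fin ltW// mulr_gt0.
  by rewrite leeDr// lee_fin nh.2.
rewrite muleA -EFinM -mulrA mulfV ?gt_eqF// mulr1.
have : avgw mu Q (fun=> 1%R) (rdf_iter N) (rc j) <= M (rdf_iter N) x.
  by apply: ereal_sup_ubound; exists j.
rewrite /avgw oneE inver gt_eqF// int1 => le1.
by rewrite -lee_pdivrMl.
Qed.

(** The weight has to be positive even where [h] vanishes. Some cube of the family has a positive
    integral of [h], and it lies with any given point in a larger one, so M spreads positivity
    everywhere by the second iterate. *)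
Let H_gt0 x : 0 < H x.
Proof.
have [j hj] : exists j, 0 < \int[mu]_(y in Q (rc j)) (h y)%:E.
  apply: contrapT => /forallNP nj.
  have hz j : \int[mu]_(y in Q (rc j)) (h y)%:E = 0.
    apply/eqP; rewrite eq_le integral_ge0 ?andbT//; last by move=> y _; rewrite lee_fin nh.2.
    by rewrite leNgt; apply/negP; exact: nj.
  pose S := [set y | (0 < h y)%R].
  have mS : measurable S by apply: measurable_set_lt; [exact: measurable_cst|exact: nh.1].
  have S0 : mu S = 0.
    have cov : S `<=` \bigcup_j (S `&` Q (rc j)).
      move=> y Sy; have [c [_ cy]] := cb_large CB (rc 0%N) y.
      have [i [ci _]] := cb_count CB c; exists i => //; split => //; exact: ci.
    apply/eqP; rewrite eq_le measure_ge0 andbT.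
    have mSQ k : measurable (S `&` Q (rc k)) by apply: measurableI => //; exact: cb_meas CB _.
    apply: (@le_trans _ _ (\sum_(k <oo) mu (S `&` Q (rc k)))).
      exact: measure_sigma_subadditive.
    rewrite eseries0// => k _ _.
    apply: (@integral_lt_null _ _ _ mu _ h (cst 0%R)) => //; [exact: nh.1|exact: nh.2| | |].
    - rewrite [leRHS]integral0_eq// -(hz k); apply: ge0_subset_integral => //.
      + exact: cb_meas CB _.
      + exact: measurable_funTS.
      + by move=> y _; rewrite lee_fin nh.2.
    - by rewrite integral0_eq.
    - by move=> y [].
  move: hpos; rewrite lt_neqAle => /andP[/eqP + _]; apply; apply/esym.
  have nhp : nnw (fun z => h z `^ p * u z)%R.
    split; last by move=> z; rewrite mulr_ge0 ?powR_ge0// ltW// pu.2.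
    apply: measurable_funM; last exact: pu.1.
    by apply: (measurableT_comp (measurable_powR _)); exact: nh.1.
  rewrite (wint_setD mu nhp mS measurableT)// wint_null// add0e.
  rewrite [LHS]integral0_eq// => z [_ /= /negP]; rewrite -leNgt => hz0.
  have -> : h z = 0%R by apply/eqP; rewrite eq_le hz0 nh.2.
  by rewrite powR0 ?gt_eqF// mul0r.
have [c [jc cx]] := cb_large CB (rc j) x; have [k [ck _]] := cb_count CB c.
have Qkx : Q (rc k) x by exact: ck.
apply: (@lt_le_trans _ _ (rdf_iter 2 x)); last exact: iterH.
have M1 : 0 < M (rdf_iter 1) x.
  apply: (@lt_le_trans _ _ (avgw mu Q (fun=> 1%R) (rdf_iter 1) (rc k))); last first.
    by apply: ereal_sup_ubound; exists k.
  have m0 := cmass_gt0 CB (rc k).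
  rewrite /avgw oneE inver gt_eqF// int1 mule_gt0// ?lte_fin ?invr_gt0//.
  apply: (lt_le_trans hj); apply: (@le_trans _ _ (\int[mu]_(y in Q (rc k)) (h y)%:E)).
    apply: ge0_subset_integral; [exact: cb_meas CB _|exact: cb_meas CB _|exact: measurable_funTS| |].
      by move=> y _; rewrite lee_fin nh.2.
    exact: subset_trans jc ck.
  apply: ge0_le_integral; [exact: cb_meas CB _| |exact: measurable_funTS| |].
  - by move=> y _; rewrite lee_fin nh.2.
  - by apply: measurable_funTS; exact: (miter 1).
  - move=> y _ /=; rewrite leeDl// mule_ge0//.
      by rewrite lee_fin invr_ge0 mulr_ge0// ltW.
    by apply: (maxw_ge0 CB pone onefin) => z; exact: lexx.
rewrite [ltRHS]/=; apply: (@lt_le_trans _ _ (((4 * B)^-1)%:E * M (rdf_iter 1) x)).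
  by rewrite mule_gt0// lte_fin invr_gt0 mulr_gt0.
by rewrite leeDr// lee_fin nh.2.
Qed.

(** The value 1 on the null set where [H] is infinite keeps the function positive. *)
Let Hr x : R := if H x is v%:E then v else 1%R.

Let H_fin : {ae mu, forall x, H x = (Hr x)%:E}.
Proof.
have nIfin : nI H < +oo.
  have e : nI (fun x => (h x)%:E) = wint (fun x => h x `^ p * u x)%R setT.
    by apply: eq_integral => x _; rewrite poweR_EFin EFinM.
  by apply: (le_lt_trans H_bound); rewrite e lte_mul_pinfty ?lee_fin ?powR_ge0.
have : mu.-integrable setT (fun x => H x `^ p * (u x)%:E).
  apply/integrableP; split; first exact: mpow.
  apply: le_lt_trans nIfin; rewrite le_eqVlt; apply/orP; left; apply/eqP.
  by apply: eq_integral => x _; rewrite gee0_abs// (pow_ge0 H).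
move=> /(integrable_ae measurableT); apply: filterS => x /(_ Logic.I).
rewrite /Hr; have := H0 x; case: (H x) => [v| |]//.
by rewrite poweRyr ?gt_eqF// mulyr gtr0_sg ?pu.2// mul1e.
Qed.

Let pHr : posw Hr.
Proof.
split; last by move=> x; rewrite /Hr; have := H_gt0 x; case: (H x).
have mb : measurable_fun setT (fun x => H x == +oo).
  apply: (measurable_fun_bool true).
  rewrite setTI (_ : _ @^-1` _ = H @^-1` [set +oo]); last first.
    by apply/seteqP; split => x /= /eqP.
  by rewrite -[X in measurable X]setTI; apply: mH => //; exact: emeasurable_set1.
have mf : measurable_fun setT (fun x => if H x == +oo then 1 else H x).
  by apply: measurable_fun_ifT => //; exact: measurable_cst.
have -> : Hr = fine \o (fun x => if H x == +oo then 1 else H x).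
  by apply/funext => x; rewrite /Hr /=; have := H_gt0 x; case: (H x).
exact: (measurableT_comp (fine_measurable measurableT)).
Qed.

(** The factor [4 * B] is the A_1 bound over the countable family; [K3] is the price of enclosing an
    arbitrary cube in a member of it. *)
Definition rdf_cst : R := (K3 * (4 * B))%R.

(** The A_1 condition is given as a bound [c] for the mean of the majorant on each cube and one for
    its inverse separately, so that both can be raised to powers and multiplied with the means of w
    and 1/w. *)
Lemma rubio_de_francia : exists H' : T -> R,
  [/\ posw H', {ae mu, forall x, (h x <= H' x)%R},
   wint (fun x => H' x `^ p * u x)%R setT <=
     (2 `^ (p + 1))%:E * wint (fun x => h x `^ p * u x)%R setT &
   forall i, exists c, [/\ (0 < c)%R, pmean mu (Q i) (cmass i) 1 H' c &
     pmean mu (Q i) (cmass i) 0 (fun x => (H' x)^-1)%R (rdf_cst / c)]].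
Proof.
exists Hr; split; first exact: pHr.
- apply: filterS H_fin => x Hx; have := iterH 1 x.
  rewrite Hx /= => h1; rewrite -lee_fin; apply: le_trans h1; rewrite leeDl// mule_ge0//.
    by rewrite lee_fin invr_ge0 mulr_ge0// ltW.
  by apply: (maxw_ge0 CB pone onefin) => z; exact: lexx.
- have <- : nI (fun x => (h x)%:E) = wint (fun x => h x `^ p * u x)%R setT.
    by apply: eq_integral => x _; rewrite poweR_EFin EFinM.
  apply: le_trans H_bound; apply: ae_ge0_le_integral; first by [].
  + by move=> x _; rewrite lee_fin mulr_ge0 ?powR_ge0// ltW// pu.2.
  + by apply: nnw_mE; apply: posw_nnw; apply: posw_mul => //; exact: posw_powR.
  + by move=> x _; exact: (pow_ge0 H).
  + exact: (mpow mH).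
  + by apply: filterS H_fin => x -> _; rewrite poweR_EFin EFinM.
move=> i; have [j [ij ji]] := cb_count CB i.
have mQ : measurable (Q i) by exact: cb_meas CB i.
have B40 : (0 < 4 * B)%R by rewrite mulr_gt0.
have K30 : (0 < K3)%R by exact: lt_le_trans (cb_K3 CB).
have key : {ae mu, forall x, Q i x -> wint Hr (Q i) <= (rdf_cst * cmass i * Hr x)%:E}.
  apply: filterS H_fin => x Hx Qx.
  apply: (@le_trans _ _ (\int[mu]_(y in Q i) H y)).
    apply: ae_ge0_le_integral; first by [].
    + by move=> y _; rewrite lee_fin ltW// pHr.2.
    + by apply: nnw_mE; exact: posw_nnw.
    + by move=> y _; exact: H0.
    + exact: measurable_funTS.
    + by apply: filterS H_fin => y -> _.
  apply: (@le_trans _ _ (\int[mu]_(y in Q (rc j)) H y)).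
    apply: ge0_subset_integral => //; first exact: cb_meas CB _.
    exact: measurable_funTS.
  apply: (le_trans (avgH (ij _ Qx))); rewrite Hx -EFinM lee_fin.
  apply: ler_wpM2r; first exact: ltW (pHr.2 x).
  rewrite /rdf_cst mulrAC; apply: ler_wpM2r; first exact: ltW.
  rewrite -lee_fin EFinM -!(cmassE CB); apply: le_trans (cb_trip_le CB i).
  by apply: le_measure; rewrite ?inE//; exact: cb_meas CB _.
have [v v0 ev] : exists2 v, (0 < v)%R & wint Hr (Q i) = v%:E.
  have w0 : 0 < wint Hr (Q i) by exact: (wintQ_gt0 CB).
  suff woo : wint Hr (Q i) < +oo.
    exists (fine (wint Hr (Q i))); first by rewrite fine_gt0// w0.
    by rewrite fineK// gt0_fin_numE.
  rewrite ltey; apply/eqP => woo.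
  have : mu (Q i) <= 0.
    move: key => [N [mN N0 sub]]; rewrite -N0; apply: le_measure; rewrite ?inE//.
    by move=> x Qx; apply: sub => /= /(_ Qx); rewrite woo leye_eq.
  by rewrite leNgt (cb_gt0 CB i).
have m0 := cmass_gt0 CB i.
exists (v / cmass i)%R; split; first by rewrite divr_gt0.
  rewrite /pmean oner_eq0 invr1 powRr1 ?divr_ge0 ?(ltW v0) ?(ltW m0)// divfK ?gt_eqF// -ev.
  rewrite (_ : (fun x => _) = Hr)//; apply/funext => x.
  by rewrite powRr1// ltW// pHr.2.
rewrite /pmean eqxx; apply: filterS key => x hx Qx; have {hx} := hx Qx.
have hx0 := pHr.2 x.
rewrite ev lee_fin => hx; rewrite invf_div mulrA.
by rewrite ler_pdivlMr// mulrC ler_pdivrMr.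
Qed.

End rubio_de_francia.

(** * Moving an exponent by factorisation of the weight *)

Section extrapolation_weights.
Context d (T : measurableType d) (R : realType) (mu : {measure set T -> \bar R}).
Context (C : Type) (Q : C -> set T) (trip : C -> C) (rc : nat -> C) (K3 : R).
Hypothesis CB : cube_basis mu Q trip rc K3.
Local Notation wint := (wint mu).
Local Notation cmass := (cmass mu Q).
Local Notation apw := (apw mu Q).

Definition core_cst (a b t K : R) : R :=
  (rdf_cst K3 a b K `^ (t * (a + b) / a) * K `^ ((a - t) / a))%R.

(* [kap] is [H^e w^(t/a)], where [H] is the Rubio de Francia majorant of
   [(k^(1/t) / w^(1/a))^(a/(a+b))]: [H] is an A_1 weight, so Hoelder's inequality
   moves [t] from the first exponent to the second. *)
Lemma factor_down (a b t K : R) (w k : T -> R) :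
  (0 < a)%R -> (0 < b)%R -> (0 < t)%R -> (t <= a)%R -> posw w -> apw a b w K ->
  nnw k -> 0 < wint (fun x => k x `^ t^-1)%R setT -> wint (fun x => k x `^ t^-1)%R setT < +oo ->
  exists kap : T -> R, [/\ posw kap, {ae mu, forall x, (k x <= kap x)%R},
    wint (fun x => kap x `^ t^-1)%R setT <=
      (2 `^ ((a + b) / a + 1))%:E * wint (fun x => k x `^ t^-1)%R setT &
    apw (a - t) (b + t) (fun x => w x / kap x)%R (core_cst a b t K)].
Proof.
move=> a0 b0 t0 ta pw AP nk kpos kfin.
pose p := ((a + b) / a)%R; have p0 : (0 < p)%R by rewrite divr_gt0 ?addr_gt0.
pose u x := (w x `^ a^-1)%R; have pu : posw u by exact: posw_powR.
have u0 x : (0 < u x)%R := pu.2 x; have w0 x : (0 < w x)%R := pw.2 x.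
pose h x := ((k x `^ t^-1 / u x) `^ p^-1)%R.
have nh : nnw h.
  split; last by move=> x; exact: powR_ge0.
  apply: (measurableT_comp (measurable_powR _)).
  apply: measurable_funM; last exact: (posw_inv pu).1.
  by apply: (measurableT_comp (measurable_powR _)); exact: nk.1.
have hE x : (h x `^ p * u x = k x `^ t^-1)%R.
  rewrite /h -powRrM mulVf ?gt_eqF// powRr1 ?divr_ge0 ?powR_ge0 ?(ltW (u0 x))//.
  by rewrite divfK ?gt_eqF.
have eh : (fun x => h x `^ p * u x)%R = (fun x => k x `^ t^-1)%R by apply/funext.
have hpos : 0 < wint (fun x => h x `^ p * u x)%R setT by rewrite eh.
have hfin : wint (fun x => h x `^ p * u x)%R setT < +oo by rewrite eh.
have [H [pH hH HI HQ]] := rubio_de_francia CB a0 b0 pw AP nh hfin hpos.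
rewrite -/p -/u eh in HI; have H0 x : (0 < H x)%R := pH.2 x.
(* This [e] makes kap^(1/t) equal to H^p u, whose integral is controlled. With s = (a - t) / a the
   indices on a cube become a s = a - t for w / kap and e + b s = b + t for its inverse. *)
pose e := (t * (a + b) / a)%R; pose kap x := (H x `^ e * w x `^ (t / a))%R.
have e0 : (0 < e)%R by rewrite divr_gt0 ?mulr_gt0 ?addr_gt0.
have pkap : posw kap by apply: posw_mul; exact: posw_powR.
have kapE x : (kap x `^ t^-1 = H x `^ p * u x)%R.
  rewrite /kap powRM ?powR_ge0// -!powRrM; congr (_ `^ _ * _ `^ _)%R.
    by rewrite /e /p; field; rewrite !gt_eqF.
  by field; rewrite !gt_eqF.
exists kap; split => //.
- apply: filterS hH => x hx.
  have V0 : (0 < t^-1)%R by rewrite invr_gt0.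
  rewrite -(ge1_powR_le V0) ?nk.2 ?(ltW (pkap.2 x))// kapE -hE.
  by rewrite ler_pM2r// ge1_powR_le// ?nh.2// ltW.
- by rewrite (_ : (fun x => kap x `^ t^-1)%R = (fun x => H x `^ p * u x)%R)//; apply/funext.
move=> i; have [c [c' [c0 c'0 cc hc hc']]] := AP i; have [cH [cH0 hH1 hH2]] := HQ i.
pose s := ((a - t) / a)%R.
have s0 : (0 <= s)%R by rewrite divr_ge0 ?subr_ge0// ltW.
pose B := rdf_cst K3 a b K.
have mQ := cb_meas CB i; have eQ := cmassE CB i; have m0 := cmass_gt0 CB i.
have muQ : mu (Q i) <= (cmass i)%:E by rewrite eQ.
have K0 : (0 < K)%R by apply: lt_le_trans cc; rewrite mulr_gt0.
have B0 : (0 < B)%R.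
  have K30 : (0 < K3)%R by apply: lt_le_trans (cb_K3 CB).
  by rewrite !mulr_gt0// powR_gt0// (muck_cst_gt0 CB a0 b0 pw AP).
have BcH0 : (0 < B / cH)%R by rewrite divr_gt0.
exists ((B / cH) `^ e * c `^ s)%R, (cH `^ e * c' `^ s)%R; split.
- by rewrite mulr_gt0 ?powR_gt0.
- by rewrite mulr_gt0 ?powR_gt0.
- rewrite mulrACA -powRM ?(ltW BcH0) ?(ltW cH0)// divfK ?gt_eqF//.
  rewrite -powRM ?(ltW c0) ?(ltW c'0)// /core_cst -/e -/B -/s.
  apply: ler_wpM2l; first exact: powR_ge0.
  by apply: (ge0_ler_powR s0) => //; rewrite nnegrE ?(ltW K0)// mulr_ge0// ltW.
- have h1 := pmean_pow (lexx 0%R) (ltW e0) BcH0 (posw_inv pH) hH2.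
  have h2 := pmean_pow (ltW a0) s0 c0 pw hc.
  have e10 : (0 <= 0 * e)%R by rewrite mul0r.
  have e20 : (0 <= a * s)%R by rewrite mulr_ge0 ?(ltW a0).
  have := pmean_mul mQ e10 e20 (powR_gt0 e BcH0) (powR_gt0 s c0)
    (posw_powR e (posw_inv pH)) (posw_powR s pw) h1 h2.
  have -> : (0 * e + a * s = a - t)%R by rewrite /s; field; rewrite gt_eqF.
  have -> // : (fun x => (H x)^-1 `^ e * w x `^ s)%R = (fun x => w x / kap x)%R.
  apply/funext => x; rewrite /kap invfM mulrCA powRV//; congr (_ * _)%R.
  rewrite -powRN -[X in (X * _)%R](powRr1 (ltW (w0 x))) -powRD_gt0//.
  by congr (_ `^ _)%R; rewrite /s; field; rewrite gt_eqF.
- have h1 := pmean_pow (ler01) (ltW e0) cH0 pH hH1.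
  have h2 := pmean_pow (ltW b0) s0 c'0 (posw_inv pw) hc'.
  have e10 : (0 <= 1 * e)%R by rewrite mul1r ltW.
  have e20 : (0 <= b * s)%R by rewrite mulr_ge0 ?(ltW b0).
  have := pmean_mul mQ e10 e20 (powR_gt0 e cH0) (powR_gt0 s c'0)
    (posw_powR e pH) (posw_powR s (posw_inv pw)) h1 h2.
  have -> : (1 * e + b * s = b + t)%R by rewrite /s /e; field; rewrite gt_eqF.
  have -> // : (fun x => H x `^ e * (w x)^-1 `^ s)%R = (fun x => (w x / kap x)^-1)%R.
  apply/funext => x; rewrite invf_div /kap -mulrA powRV//; congr (_ * _)%R.
  rewrite -powRN -[X in (_ / X)%R](powRr1 (ltW (w0 x))) -powRN -powRD_gt0//.
  by congr (_ `^ _)%R; rewrite /s; field; rewrite gt_eqF.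
Qed.

(** By duality: [factor_down] applied to 1/w, with the two exponents exchanged. *)
Lemma factor_up (a b t K : R) (w k : T -> R) :
  (0 < a)%R -> (0 < b)%R -> (0 < t)%R -> (t <= b)%R -> posw w -> apw a b w K ->
  nnw k -> 0 < wint (fun x => k x `^ t^-1)%R setT -> wint (fun x => k x `^ t^-1)%R setT < +oo ->
  exists kap : T -> R, [/\ posw kap, {ae mu, forall x, (k x <= kap x)%R},
    wint (fun x => kap x `^ t^-1)%R setT <=
      (2 `^ ((b + a) / b + 1))%:E * wint (fun x => k x `^ t^-1)%R setT &
    apw (a + t) (b - t) (fun x => w x * kap x)%R (core_cst b a t K)].
Proof.
move=> a0 b0 t0 tb pw AP nk kpos kfin.
have [kap [pk hk kI AP']] :=
  factor_down b0 a0 t0 tb (posw_inv pw) (apw_sym pw AP) nk kpos kfin.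
exists kap; split => //.
have pw' : posw (fun x => (w x)^-1 / kap x)%R.
  by apply: posw_mul; exact: posw_inv.
have := apw_sym pw' AP'.
have -> // : (fun x => ((w x)^-1 / kap x)^-1)%R = (fun x => w x * kap x)%R.
by apply/funext => x; rewrite invfM !invrK.
Qed.

(* Young's inequality: [M f <= (M f)^p s + u], where [u^(1/p') s^(1/p) = 1] and
   the first term is integrated by Muckenhoupt's theorem. *)
Lemma fujii_wilson (a b K : R) (w : T -> R) i :
  (0 < a)%R -> (0 < b)%R -> posw w -> apw a b w K ->
  \int[mu]_(x in Q i)
    maxw mu Q rc (fun=> 1%R) (fun y => (((fun z => w z `^ a^-1)%R \_ (Q i)) y)%:E) x <=
  (muck_cst K3 b a K + 1)%:E * wint (fun x => w x `^ a^-1)%R (Q i).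
Proof.
move=> a0 b0 pw AP; set u := (fun z => w z `^ a^-1)%R.
pose s x := ((w x)^-1 `^ b^-1)%R; pose p := ((b + a) / b)%R.
have pu : posw u by exact: posw_powR.
have ps : posw s by apply: posw_powR; exact: posw_inv.
have mQ := cb_meas CB i; have w0 x := pw.2 x.
pose f y := ((u \_ (Q i)) y)%:E.
have p0 : (0 < p)%R by rewrite divr_gt0 ?addr_gt0.
have mf : measurable_fun setT f.
  apply/measurable_EFinP; apply/(measurable_restrictT _ mQ).
  by apply: measurable_funTS; exact: pu.1.
have f0 y : 0 <= f y by rewrite /f /patch lee_fin; case: ifPn => // _; exact: ltW (pu.2 y).
have mM := measurable_maxw CB (fun=> 1%R) f.
have M0 x : 0 <= maxw mu Q rc (fun=> 1%R) f x.
  apply: (maxw_ge0 CB) => //.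
  by move=> j; rewrite /wint (integral_cst mu (cb_meas CB j) 1) mul1e; exact: cb_fin CB j.
have := muckenhoupt CB b0 a0 (posw_inv pw) (apw_sym pw AP) mf f0.
rewrite -/p -/(s _) => Mk.
have fs : \int[mu]_x (f x `^ p * (s x)%:E) = wint u (Q i).
  rewrite /wint [RHS]integral_mkcond; apply: eq_integral => x _.
  rewrite /f /patch; case: ifPn => _; last by rewrite poweR0r ?gt_eqF// mul0e.
  rewrite poweR_EFin -EFinM /u /s powRV// -powRN -powRrM -powRD_gt0//.
  by congr (_ `^ _)%:E; rewrite /p; field; rewrite !gt_eqF.
have mX : measurable_fun setT (fun x => maxw mu Q rc (fun=> 1%R) f x `^ p * (s x)%:E).
  apply: emeasurable_funM; last by apply: nnw_mE; exact: posw_nnw.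
  exact: (measurableT_comp (measurable_poweR _)).
have X0 x : 0 <= maxw mu Q rc (fun=> 1%R) f x `^ p * (s x)%:E.
  by rewrite mule_ge0 ?poweR_ge0// lee_fin ltW// ps.2.
apply: (@le_trans _ _ (\int[mu]_(x in Q i)
   (maxw mu Q rc (fun=> 1%R) f x `^ p * (s x)%:E + (u x)%:E))).
  apply: ge0_le_integral => //.
  - exact: measurable_funTS.
  - apply: emeasurable_funD; first exact: measurable_funTS.
    by apply: nnw_mE; exact: posw_nnw.
  - move=> x _; have := M0 x; case: (maxw mu Q rc (fun=> 1%R) f x) => [y| |]// y0; last first.
      by rewrite poweRyr ?gt_eqF// mulyr gtr0_sg ?ps.2// mul1e addye// leey.
    rewrite lee_fin in y0; rewrite poweR_EFin -EFinM -EFinD lee_fin.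
    pose th := p^-1%R.
    have th01 : (0 < th < 1)%R.
      rewrite /th invr_gt0 p0/= invf_lt1// /p ltr_pdivlMr// mul1r ltrDl//.
    have := amgm2 th01 (mulr_ge0 (powR_ge0 y p) (ltW (ps.2 x))) (ltW (pu.2 x)).
    have -> : ((y `^ p * s x) `^ th * u x `^ (1 - th) = y)%R.
      rewrite powRM ?powR_ge0// -powRrM /th mulfV ?gt_eqF// powRr1//.
      rewrite /s /u powRV// -powRN -!powRrM -mulrA -powRD_gt0//.
      rewrite (_ : (_ + _)%R = 0%R); first by rewrite powRr0 mulr1.
      by rewrite /p; field; rewrite !gt_eqF// addr_gt0.
    move=> h; apply: (le_trans h); case/andP: th01 => th0 th1.
    apply: lerD; last by rewrite ler_piMl ?(ltW (pu.2 x))// gerBl ltW.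
    by rewrite ler_piMl ?mulr_ge0 ?powR_ge0 ?(ltW (ps.2 x))// ltW.
rewrite ge0_integralD//; last 3 first.
- exact: measurable_funTS.
- by move=> x _; rewrite lee_fin ltW// pu.2.
- by apply: nnw_mE; exact: posw_nnw.
have wu0 : 0 <= wint u (Q i) by apply: wint_ge0; exact: posw_nnw.
have M0' : (0 <= muck_cst K3 b a K)%R.
  by rewrite ltW// (muck_cst_gt0 CB b0 a0 (posw_inv pw) (apw_sym pw AP)).
rewrite EFinD ge0_muleDl ?lee_fin// mul1e; apply: leeD => //.
rewrite -fs; apply: le_trans Mk; apply: ge0_subset_integral => //.
Qed.

End extrapolation_weights.

(** * The cubes of R^n *)

Section cubes.
Context {R : realType} {n : nat}.
Hypothesis n_gt0 : (0 < n)%N.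
Local Notation E := (Rn R n).
Local Notation mu := (lebesgue_n R n).

Definition cubeT := {al : n.-tuple R * R | (0 < al.2)%R}.

Definition mkcube (a : n.-tuple R) (l : R) (l0 : (0 < l)%R) : cubeT := exist _ (a, l) l0.

Definition qb (c : cubeT) : set E := cube (sval c).1 (sval c).2.

Let tl0 (c : cubeT) : (0 < 3 * (sval c).2)%R.
Proof. by rewrite mulr_gt0// (svalP c). Qed.

Definition triple (c : cubeT) : cubeT :=
  mkcube [tuple (tnth (sval c).1 i - (sval c).2)%R | i < n] (tl0 c).

Definition unit_cube : cubeT := mkcube [tuple 0%R | i < n] ltr01.

(** Codes that decode to nothing, or to a side that is not positive, are sent to the unit cube. *)
Definition rat_cube (i : nat) : cubeT :=
  if unpickle i is Some br then
    insubd unit_cube ([tuple (ratr (tnth (br : n.-tuple rat * rat).1 i) : R) | i < n],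
                      ratr br.2 : R)
  else unit_cube.

Lemma qbP (c : cubeT) (x : n.-tuple R) : qb c x <->
  forall i, (tnth (sval c).1 i <= tnth x i <= tnth (sval c).1 i + (sval c).2)%R.
Proof. by []. Qed.

Lemma cubes_qb c : cubes (qb c).
Proof. by exists (sval c).1, (sval c).2; split => //; exact: (svalP c). Qed.

Lemma cubesP (P : set E) : cubes P -> exists c, P = qb c.
Proof. by move=> [a [l [l0 ->]]]; exists (mkcube a l0). Qed.

Lemma cube_basis_Rn : cube_basis mu qb triple rat_cube (3 ^+ n)%R.
Proof.
have l0 (c : cubeT) : (0 < (sval c).2)%R := svalP c.
have mq c : (mu : {measure set E -> \bar R}) (qb c) = ((sval c).2 ^+ n)%:E by exact: mu_cube.
split.
- by move=> c; exact: measurable_cube.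
- by move=> c; rewrite mq lte_fin exprn_gt0.
- by move=> c; rewrite mq ltry.
- move=> c x /qbP h; apply/qbP => i; rewrite /= tnth_mktuple.
  by have /andP[] := h i; have := l0 c; set l := (sval c).2; lra.
- by move=> c; rewrite !mq -EFinM lee_fin /= exprMn.
(* As n > 0, comparing volumes compares sides. *)
- move=> c c' [z [/qbP hz /qbP hz']]; rewrite !mq lee_fin ler_pXn2r ?nnegrE ?(ltW (l0 _))//.
  move=> ll x /qbP hx; apply/qbP => i; rewrite /= tnth_mktuple.
  move: (hz i) (hz' i) (hx i) ll (l0 c) (l0 c') => /andP[] + + /andP[] + + /andP[] + +.
  by set l := (sval c).2; set l' := (sval c').2; lra.
(* A rational corner less than l / 2 below [a] and a rational side between 3 l / 2 and 2 l: the cube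
   contains [c] since 3/2 - 1/2 = 1, and it stays in the triple. *)
- move=> c; set a := (sval c).1; set l := (sval c).2; have lp : (0 < l)%R := l0 c.
  have hb i : exists b : rat, (tnth a i - l / 2 < ratr b < tnth a i)%R.
    have /rat_in_itvoo[b] : (tnth a i - l / 2 < tnth a i)%R by lra.
    by rewrite in_itv/=; exists b.
  have [r hr] : exists r : rat, (3 * l / 2 < ratr r < 2 * l)%R.
    have /rat_in_itvoo[r] : (3 * l / 2 < 2 * l)%R by lra.
    by rewrite in_itv/=; exists r.
  have /choice[b hb'] := hb.
  exists (pickle ([tuple b i | i < n], r)).
  rewrite /rat_cube pickleK.
  have r0 : (0 < ratr r :> R)%R by lra.
  have e : sval (insubd unit_cube ([tuple (ratr (tnth [tuple b i | i < n] i) : R) | i < n],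
      ratr r : R)) = ([tuple (ratr (b i) : R) | i < n], ratr r).
    rewrite [LHS]insubdK//; congr pair; apply: eq_from_tnth => i.
    by rewrite !tnth_mktuple.
  split=> x /qbP hx; apply/qbP => i; move: (hx i) (hb' i); rewrite e/= !tnth_mktuple -/a -/l; lra.
- move=> c x; set a := (sval c).1; set l := (sval c).2; have lp : (0 < l)%R := l0 c.
  pose L := (\sum_(i < n) `|tnth (x : n.-tuple R) i - tnth a i|)%R.
  have hL i : (`|tnth (x : n.-tuple R) i - tnth a i| <= L)%R.
    by rewrite /L (bigD1 i)//= lerDl sumr_ge0.
  have L0 : (0 <= L)%R by rewrite sumr_ge0.
  have l'0 : (0 < l + 2 * L)%R by lra.
  exists (mkcube [tuple (tnth a i - L)%R | i < n] l'0); split.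
    move=> y /qbP hy; apply/qbP => i; move: (hy i); rewrite /= tnth_mktuple -/a -/l; lra.
  apply/qbP => i; move: (hL i); rewrite /= tnth_mktuple ler_norml; lra.
- by rewrite exprn_ege1// ler1n.
Qed.

End cubes.

(** * Quantitative A_oo *)

(* Every cube carries a system of dyadic cells, equal up to null sets to cubes of
   the family; [db_chain] joins a cell to its parent through cubes each of which
   exceeds the previous one by a small proportion. *)
Record dyadic_basis d (T : measurableType d) (R : realType)
    (mu : {measure set T -> \bar R}) (C : Type) (Q : C -> set T) (I : countType)
    (cx : C -> nat -> T -> I) (bx : C -> T) (sub : C -> nat -> T -> C) (D0 : R)
    (chain : R -> nat) : Prop := DyadicBasis {
  db_nested : forall c, nested_cells (cx c) ;
  db_outer : forall c, outer_approx mu (cx c) ;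
  db_base : forall c, sub c 0%N (bx c) = c ;
  db_sub : forall c k x, dcell (cx c) k x `<=` Q (sub c k x) ;
  db_null : forall c k x, mu (Q (sub c k x) `\` dcell (cx c) k x) = 0 ;
  db_half : forall c k x, mu (Q (sub c k x)) <= D0%:E * mu (Q (sub c k.+1 x)) ;
  db_D0 : (1 <= D0)%R ;
  db_chain : forall eps : R, (0 < eps)%R -> forall c k x, exists js : nat -> C,
    [/\ js 0%N = sub c k.+1 x, js (chain eps) = sub c k x &
     forall j, (j < chain eps)%N -> Q (js j) `<=` Q (js j.+1) /\
       mu (Q (js j.+1) `\` Q (js j)) <= eps%:E * mu (Q (js j.+1))]
}.

Section Ainfty.
Context d (T : measurableType d) (R : realType) (mu : {measure set T -> \bar R}).
Context (C : Type) (Q : C -> set T) (trip : C -> C) (rc : nat -> C) (K3 : R).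
Hypothesis CB : cube_basis mu Q trip rc K3.
Context (I : countType) (cx : C -> nat -> T -> I) (bx : C -> T)
  (sub : C -> nat -> T -> C) (D0 : R) (chain : R -> nat).
Hypothesis DB : dyadic_basis mu Q cx bx sub D0 chain.
Local Notation wint := (wint mu).
Local Notation cmass := (cmass mu Q).
Local Notation apw := (apw mu Q).
Local Notation one := (fun=> 1%R : R).
Let mQ c : measurable (Q c) := cb_meas CB c.
Let mcell c k x : measurable (dcell (cx c) k x) := (db_nested DB c).2 k x.

Lemma wint_one A : measurable A -> wint one A = mu A.
Proof. by move=> mA; rewrite /wint (integral_cst mu mA 1) mul1e. Qed.

Let pone : posw (one : T -> R). Proof. by split=> //; exact: measurable_cst. Qed.

Lemma wint_cell w c k x : nnw w -> wint w (Q (sub c k x)) = wint w (dcell (cx c) k x).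
Proof.
move=> nw; rewrite (wint_setD mu nw (mcell c k x) (mQ _) (@db_sub _ _ _ _ _ _ _ _ _ _ _ _ DB c k x)).
rewrite [X in _ + X]wint_null ?adde0//; first by apply: measurableD.
exact: db_null DB c k x.
Qed.

Definition absc (eps : R) (v : T -> R) : Prop := forall c A, measurable A ->
  A `<=` Q c -> mu A <= eps%:E * mu (Q c) -> wint v A <= (2^-1)%:E * wint v (Q c).

Section absc_weight.
Variables (eps : R) (v : T -> R).
Hypotheses (eps0 : (0 < eps)%R) (eps1 : (eps < 1)%R) (pv : posw v)
  (vfin : forall c, wint v (Q c) < +oo) (av : absc eps v).
Let nv := posw_nnw pv.

Lemma wintSE c A : measurable A -> A `<=` Q c -> exists2 r : R, (0 <= r)%R & wint v A = r%:E.
Proof.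
move=> mA sA; exists (fine (wint v A)); first by rewrite fine_ge0// wint_ge0.
exact: wint_fin (vfin c).
Qed.

(* Each cube of the chain has at most twice the mass of the previous one. *)
Lemma absc_doubling c k x :
  wint v (dcell (cx c) k x) <= (2 ^+ (chain eps).+1)%:E * wint v (dcell (cx c) k.+1 x).
Proof.
rewrite -!wint_cell//; have [js [j0 jJ jS]] := db_chain DB eps0 c k x.
rewrite -j0 -jJ.
have : forall j, (j <= chain eps)%N -> wint v (Q (js j)) <= (2 ^+ j)%:E * wint v (Q (js 0%N)).
  elim=> [|j IH] jl; first by rewrite expr0 mul1e.
  have [s h] := jS j jl.
  have := av (measurableD (mQ (js j.+1)) (mQ (js j))) (@subDsetl _ _ _) h.
  have := wint_setD mu nv (mQ (js j)) (mQ (js j.+1)) s.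
  have := IH (ltnW jl).
  have [V V0 ->] := wintQE CB pv vfin (js j.+1).
  have [U U0 ->] := wintQE CB pv vfin (js j).
  have [Z Z0 ->] := wintQE CB pv vfin (js 0%N).
  have [W W0 ->] := wintSE (measurableD (mQ (js j.+1)) (mQ (js j))) (@subDsetl _ _ _).
  rewrite -!EFinM -EFinD !lee_fin => h1 [->] h2.
  by rewrite exprS -mulrA; lra.
move=> /(_ (chain eps) (leqnn _)) => h; apply: (le_trans h).
apply: lee_wpmul2r; first exact: wint_ge0.
by rewrite lee_fin exprS ler_peMl ?exprn_ge0// ler1n.
Qed.

(** The parameters of [reverse_hoelder] for [w1 = 1] and [w2 = v]. The doubling constant is that of
    [absc_doubling]. A set with at most a third of the mass leaves two thirds to its complement,
    more than the half allowed to a set of proportion [eps]; so its own proportion is at most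
    [1 - eps]. *)
Definition absc_exp : R := rh_exp (2 ^+ (chain eps).+1) 3^-1 (1 - eps).
Definition absc_cst : R := rh_cst (1 - eps).

Lemma absc_exp_gt0 : (0 < absc_exp)%R.
Proof.
apply: rh_exp_gt0; rewrite ?subr_gt0 ?invr_gt0 ?ltr0n ?gtrBl//; last by lra.
by rewrite exprS ler_peMr// exprn_ege1// ler1n.
Qed.

Lemma absc_cst_gt0 : (0 < absc_cst)%R.
Proof.
have h0 : (0 < 1 - eps)%R by rewrite subr_gt0.
rewrite /absc_cst /rh_cst ltr_wpDr// mulr_ge0 ?powR_ge0// invr_ge0 subr_ge0.
have e : (1 = 1 `^ 2^-1 :> R)%R by rewrite powR1.
rewrite [leRHS]e; apply: ge0_ler_powR; rewrite ?nnegrE ?(ltW h0) ?gerBl ?(ltW eps0)//.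
Qed.

(** With [w1 = 1] the reverse Hoelder inequality bounds the average of a negative power of [v] by
    that power of the average of [v]: it is the A_r condition for r = 1 + 1 / absc_exp. *)
Lemma absc_inv c : exists2 V : R, (0 < V)%R & wint v (Q c) = V%:E /\ wint (fun x => v x `^ (- absc_exp))%R (Q c) <=
    (absc_cst * (cmass c / V) `^ absc_exp * cmass c)%:E.
Proof.
have [V V0 eV] := wintQE CB pv vfin c; exists V => //; split => //.
have m0 := cmass_gt0 CB c; have em := cmassE CB c.
pose x0 := bx c; have eb : sub c 0%N x0 = c := db_base DB c.
have cE w : nnw w -> wint w (dcell (cx c) 0 x0) = wint w (Q c).
  by move=> nw; rewrite -wint_cell// eb.
have n1 := posw_nnw pone.
have rho0 : (0 < cmass c / V)%R by rewrite divr_gt0.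
have th0 : (0 < 1 - eps)%R by rewrite subr_gt0.
have th1 : (1 - eps < 1)%R by rewrite gtrBl.
have D2 : (2 <= 2 ^+ (chain eps).+1 :> R)%R by rewrite exprS ler_peMr// exprn_ege1// ler1n.
have o0 : (0 < 3^-1 :> R)%R by lra.
have o1 : (3^-1 <= 1 :> R)%R by lra.
have eQ1 : wint one (Q c) = (cmass c)%:E by rewrite wint_one.
have cQ w : nnw w -> wint w (Q c) < +oo -> wint w (dcell (cx c) 0 x0) < +oo.
  by move=> nw; rewrite cE.
have h1oo : wint one (dcell (cx c) 0 x0) < +oo by apply: cQ => //; rewrite eQ1 ltry.
have h0oo : mu (dcell (cx c) 0 x0) < +oo by rewrite -wint_one.
have h2oo : wint v (dcell (cx c) 0 x0) < +oo by exact: cQ.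
have w12 : wint one (dcell (cx c) 0 x0) = (cmass c / V)%:E * wint v (dcell (cx c) 0 x0).
  by rewrite (cE _ n1) (cE _ nv) eQ1 eV -EFinM divfK ?gt_eqF.
have ain k x A : dcell (cx c) 0 x0 x -> measurable A -> A `<=` dcell (cx c) k x ->
    wint v A <= (3^-1)%:E * wint v (dcell (cx c) k x) ->
    wint one A <= (1 - eps)%:E * wint one (dcell (cx c) k x).
  move=> _ mA sA hA; rewrite !wint_one//.
  have [V1 V10 eV1] := wintQE CB pv vfin (sub c k x).
  have mP := mcell c k x.
  rewrite -wint_cell// eV1 in hA.
  have sP := @db_sub _ _ _ _ _ _ _ _ _ _ _ _ DB c k x.
  have sD : dcell (cx c) k x `\` A `<=` Q (sub c k x) by move=> y [h _]; exact: sP.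
  have eP : mu (Q (sub c k x)) = (cmass (sub c k x))%:E by exact: (cmassE CB).
  have muP : mu (dcell (cx c) k x) = (cmass (sub c k x))%:E.
    by rewrite -eP -wint_one// -wint_cell// wint_one.
  have mD : measurable (dcell (cx c) k x `\` A) by exact: measurableD.
  have := wint_setD mu n1 mA mP sA; rewrite !wint_one// muP.
  have := wint_setD mu nv mA mP sA; rewrite -wint_cell// eV1.
  have sA' : A `<=` Q (sub c k x) by apply: (subset_trans sA).
  have := av mD sD; rewrite eP eV1.
  move: hA; have [a1 a10 ->] := wintSE mA sA'; have [a2 a20 ->] := wintSE mD sD.
  have muE B : measurable B -> B `<=` Q (sub c k x) -> mu B = (fine (mu B))%:E.
    move=> mB sB; rewrite fineK// ge0_fin_numE// (le_lt_trans _ (cb_fin CB (sub c k x)))//.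
    by apply: le_measure; rewrite ?inE.
  rewrite (muE _ mA sA') (muE _ mD sD) -!EFinM -!EFinD !lee_fin.
  set A2 := fine _; set A1 := fine _; set M := cmass _.
  move=> h1 h2 [h3] [h4]; rewrite leNgt; apply/negP => h5.
  have : (A2 <= eps * M)%R by lra.
  by move=> /h2; lra.
have := reverse_hoelder (db_nested DB c) (db_outer DB c) pone pv h0oo h1oo h2oo
  D2 o0 o1 th0 th1 rho0 (fun k x _ => absc_doubling c k x) ain w12.
rewrite (cE _ n1) eQ1 -/absc_exp -/absc_cst -EFinM.
have -> : (fun x => (1 / v x) `^ absc_exp * 1)%R = (fun x => v x `^ (- absc_exp))%R.
  by apply/funext => x; rewrite mulr1 div1r powRV ?pv.2// powRN.
by rewrite (cE (fun x => v x `^ (- absc_exp))%R)//; apply: posw_nnw; exact: posw_powR.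
Qed.

End absc_weight.
End Ainfty.

Section Ainfty_characterisations.
Context d (T : measurableType d) (R : realType) (mu : {measure set T -> \bar R}).
Context (C : Type) (Q : C -> set T) (trip : C -> C) (rc : nat -> C) (K3 : R).
Hypothesis CB : cube_basis mu Q trip rc K3.
Context (I : countType) (cx : C -> nat -> T -> I) (bx : C -> T)
  (sub : C -> nat -> T -> C) (D0 : R) (chain : R -> nat).
Hypothesis DB : dyadic_basis mu Q cx bx sub D0 chain.
Local Notation wint := (wint mu).
Local Notation cmass := (cmass mu Q).
Local Notation apw := (apw mu Q).
Local Notation absc := (absc mu Q).
Local Notation one := (fun=> 1%R : R).
Let mQ c : measurable (Q c) := cb_meas CB c.
Let mcell c k x : measurable (dcell (cx c) k x) := (db_nested DB c).2 k x.

Lemma pmeanE A m a f c : a != 0%R ->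
  pmean mu A m a f c = (wint (fun x => f x `^ a^-1)%R A <= (c `^ a^-1 * m)%:E).
Proof. by move=> a0; rewrite /pmean (negbTE a0). Qed.

Lemma absc_pmean (eps al : R) (w : T -> R) c :
  let v := (fun x => w x `^ al^-1)%R in
  let del := absc_exp chain eps in
  (0 < eps)%R -> (eps < 1)%R -> (0 < al)%R -> posw w ->
  (forall c, wint v (Q c) < +oo) -> absc eps v ->
  pmean mu (Q c) (cmass c) (al / del) (fun x => (w x)^-1)%R
    (absc_cst eps `^ (al / del) * (cmass c / fine (wint v (Q c))) `^ al)%R.
Proof.
move=> v del eps0 eps1 al0 pw vfin av.
have pv : posw v by exact: posw_powR.
have d0 : (0 < del)%R by exact: absc_exp_gt0.
have c0 := absc_cst_gt0 eps0 eps1.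
have [V V0 [-> h]] := absc_inv CB DB eps0 eps1 pv vfin av c.
rewrite -/del in h; clearbody del.
have m0 := cmass_gt0 CB c.
rewrite pmeanE ?gt_eqF ?divr_gt0//=.
have -> : (fun x => (w x)^-1 `^ (al / del)^-1)%R = (fun x => v x `^ (- del))%R.
  apply/funext => x; rewrite /v -powRrM powRV ?pw.2// -powRN; congr (_ `^ _)%R.
  by field; rewrite !gt_eqF.
apply: (le_trans h); rewrite lee_fin [leRHS](_ : _ =
  (absc_cst eps `^ (al / del)) `^ (al / del)^-1 *
  ((cmass c / V) `^ al) `^ (al / del)^-1 * cmass c)%R; last first.
  by rewrite powRM ?powR_ge0.
rewrite -!powRrM (_ : al * (al / del)^-1 = del)%R; last by field; rewrite !gt_eqF.
by rewrite mulfV ?powRr1 ?(ltW c0)// gt_eqF// divr_gt0.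
Qed.

(** Hoelder's inequality gives v(A) / v(Q) <= K (|A| / |Q|)^(1 - sg) for every part A of a cube Q;
    the right side is 1/2 at the proportion [rh_eps]. *)
Definition rh_eps (sg K : R) : R := ((2 * K) `^ (- (1 - sg)^-1))%R.

Lemma absc_rh (sg K : R) (v : T -> R) : (0 <= sg)%R -> (sg < 1)%R -> (0 < K)%R -> posw v ->
  (forall c, wint v (Q c) < +oo) ->
  (forall c, pmean mu (Q c) (cmass c) sg v (K * (fine (wint v (Q c)) / cmass c))%R) ->
  absc (rh_eps sg K) v.
Proof.
move=> sg0 sg1 K0 pv vfin RH c A mA sA hA.
have nv := posw_nnw pv.
have [V V0 eV] := wintQE CB pv vfin c; have m0 := cmass_gt0 CB c.
have := RH c; rewrite eV /= => RHc.
have em := cmassE CB c.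
have Aoo : mu A < +oo.
  apply: le_lt_trans (cb_fin CB c); apply: le_measure; rewrite ?inE//.
have [t t0 et] : exists2 t : R, (0 <= t)%R & mu A = t%:E.
  by exists (fine (mu A)); rewrite ?fine_ge0// fineK// ge0_fin_numE.
have [tz|tn] := eqVneq t 0%R.
  by rewrite wint_null// ?et ?tz// -EFinM lee_fin; lra.
have tp : (0 < t)%R by rewrite lt0r tn.
have sgp : (0 < 1 - sg)%R by rewrite subr_gt0.
rewrite et em -EFinM lee_fin in hA.
pose B := (K * (V / cmass c))%R; have B0 : (0 < B)%R by rewrite mulr_gt0// divr_gt0.
have mt0 : (0 < cmass c / t)%R by rewrite divr_gt0.
have B10 : (0 < B * (cmass c / t) `^ sg)%R by rewrite mulr_gt0// powR_gt0.
(* Restricting the mean of exponent 1 / sg from the cube to [A] costs the ratio of volumes to the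
   power [sg]. *)
have h : pmean mu A t sg v (B * (cmass c / t) `^ sg)%R.
  move: RHc; rewrite /pmean -/B; have [->|sgn] := eqVneq sg 0%R.
    rewrite powRr0 mulr1; apply: filterS => x h /sA; exact: h.
  have pvs : nnw (fun x => v x `^ sg^-1)%R by apply: posw_nnw; exact: posw_powR.
  move=> h; apply: (le_trans (wint_sub _ pvs mA (mQ c) sA)); apply: (le_trans h).
  rewrite lee_fin powRM ?powR_ge0 ?(ltW B0)// -powRrM mulfV// powRr1 ?(ltW mt0)//.
  by rewrite -mulrA divfK.
have muA : mu A <= t%:E by rewrite et.
have := pmean_mono mA muA sg0 (ltW sg1) B10 pv h.
rewrite pmeanE ?oner_eq0// invr1 powRr1 ?(ltW B10)//.
have -> : (fun x => v x `^ 1)%R = v by apply/funext => x; rewrite powRr1// ltW// pv.2.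
move=> h2; apply: (le_trans h2); rewrite -EFinM lee_fin.
have -> : (B * (cmass c / t) `^ sg * t = K * V * (t / cmass c) `^ (1 - sg))%R.
  rewrite /B -(invf_div t) powRV ?divr_gt0// powRB ?powRr1; last 2 first.
  - by rewrite divr_ge0 ?ltW.
  - by rewrite (gt_eqF (divr_gt0 tp m0)) implybT.
  by field; rewrite !gt_eqF ?powR_gt0 ?divr_gt0.
have -> : (2^-1 * V = K * V * (2 * K)^-1)%R by field; rewrite gt_eqF.
apply: ler_wpM2l; first by rewrite mulr_ge0 ?ltW.
have <- : (rh_eps sg K `^ (1 - sg) = (2 * K)^-1)%R.
  rewrite /rh_eps -powRrM mulNr mulVf ?gt_eqF// powR_inv1// mulr_ge0 ?ltW//.
apply: ge0_ler_powR; rewrite ?nnegrE ?powR_ge0 ?(ltW sgp) ?divr_ge0 ?(ltW m0)//.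
by rewrite ler_pdivrMr.
Qed.

(** Gehring's self-improvement: [reverse_hoelder] with [w1] the weight w^(1/a) and [w2 = 1]. It
    serves to exhibit some reverse Hoelder exponent above 1, so [K'] enters no later bound. *)
Lemma apw_rh (a b K : R) (w : T -> R) (i0 : C) : (0 < a)%R -> (0 < b)%R -> posw w ->
  apw a b w K -> exists a' K', [/\ (0 < a')%R, (a' < a)%R & apw a' b w K'].
Proof.
move=> a0 b0 pw AP; pose u x := (w x `^ a^-1)%R.
have pu : posw u by exact: posw_powR.
have nu := posw_nnw pu.
have K1 := apw_K1 CB a0 b0 pw AP i0; have K0 : (0 < K)%R by exact: lt_le_trans K1.
have ufin := apw_wint_fin a0 AP.
(* A set of at most half the volume leaves at least half to its complement, where the mean of 1/w is
   bounded by 2^b times the bound on the cube. As for doubling, this keeps at least the proportion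
   [1 - th] of the mass of [u] in the complement. *)
pose th := (1 - 2^-1 * (K * 2 `^ b) `^ (- a^-1))%R.
have K2 : (1 <= K * 2 `^ b)%R.
  by rewrite -[leLHS]mulr1; apply: ler_pM => //; rewrite -[leLHS](powRr0 2) ler_powR ?ler1n// ltW.
have y1 : ((K * 2 `^ b) `^ (- a^-1) <= 1)%R.
  rewrite -[leRHS](powRr0 (K * 2 `^ b)%R) ler_powR// oppr_le0 invr_ge0 ltW//.
have y0 : (0 < (K * 2 `^ b) `^ (- a^-1))%R by rewrite powR_gt0// (lt_le_trans _ K2).
have th0 : (0 < th)%R by rewrite /th; lra.
have th1 : (th < 1)%R by rewrite /th; lra.
have pone : posw (one : T -> R) by split=> //; exact: measurable_cst.
have n1 := posw_nnw pone.
pose D := Num.max D0 2%R.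
have D2 : (2 <= D)%R by rewrite le_max lexx orbT.
have h0 : (0 < 2^-1 :> R)%R by lra.
have h1 : (2^-1 <= 1 :> R)%R by lra.
pose del := rh_exp D 2^-1 th; have d0 : (0 < del)%R by exact: rh_exp_gt0.
pose Cst := rh_cst th.
have Cst0 : (0 < Cst)%R.
  rewrite /Cst /rh_cst ltr_wpDr// mulr_ge0 ?powR_ge0// invr_ge0 subr_ge0.
  have e : (1 = 1 `^ 2^-1 :> R)%R by rewrite powR1.
  by rewrite [leRHS]e; apply: ge0_ler_powR; rewrite ?nnegrE ?(ltW th0) ?(ltW th1)//.
have d1 : (0 < 1 + del)%R by rewrite addr_gt0.
exists (a / (1 + del))%R, (K * Cst `^ (a / (1 + del)))%R; split.
- by rewrite divr_gt0.
- by rewrite ltr_pdivrMr// ltr_pMr// ltrDl.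
move=> c; have [V V0 eV] := wintQE CB pu ufin c.
have m0 := cmass_gt0 CB c; have em := cmassE CB c.
have [g [e [g0 e0 ge hg he]]] := AP c.
exists (g * Cst `^ (a / (1 + del)))%R, e.
have gC0 : (0 < g * Cst `^ (a / (1 + del)))%R by rewrite mulr_gt0// powR_gt0.
split => //.
  by rewrite mulrAC ler_wpM2r ?powR_ge0.
have cE z : nnw z -> wint z (dcell (cx c) 0 (bx c)) = wint z (Q c).
  by move=> nz; rewrite -(wint_cell CB DB)// (db_base DB).
have rho0 : (0 < V / cmass c)%R by rewrite divr_gt0.
have eQ1 : wint one (Q c) = (cmass c)%:E by rewrite wint_one.
have h1oo : wint one (dcell (cx c) 0 (bx c)) < +oo by rewrite (cE _ n1) eQ1 ltry.
have h0oo : mu (dcell (cx c) 0 (bx c)) < +oo by rewrite -wint_one.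
have h2oo : wint u (dcell (cx c) 0 (bx c)) < +oo by rewrite (cE _ nu).
have w12 : wint u (dcell (cx c) 0 (bx c)) =
    (V / cmass c)%:E * wint one (dcell (cx c) 0 (bx c)).
  by rewrite (cE _ n1) (cE _ nu) eQ1 eV -EFinM divfK ?gt_eqF.
have dbl k x : dcell (cx c) 0 (bx c) x ->
    wint one (dcell (cx c) k x) <= D%:E * wint one (dcell (cx c) k.+1 x).
  move=> _; rewrite -!(wint_cell CB DB)// !wint_one//.
  apply: (le_trans (db_half DB c k x)); apply: lee_wpmul2r => //.
  by rewrite lee_fin le_max lexx.
have ain k x A : dcell (cx c) 0 (bx c) x -> measurable A -> A `<=` dcell (cx c) k x ->
    wint one A <= (2^-1)%:E * wint one (dcell (cx c) k x) ->
    wint u A <= th%:E * wint u (dcell (cx c) k x).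
  move=> _ mA sA; have mP := mcell c k x; rewrite (wint_one mu mA).
  rewrite -(wint_cell CB DB c k x n1) -(wint_cell CB DB c k x nu) (wint_one mu (mQ _)).
  set j := sub c k x.
  have sP : dcell (cx c) k x `<=` Q j by exact: (@db_sub _ _ _ _ _ _ _ _ _ _ _ _ DB c k x).
  have sA' : A `<=` Q j by exact: subset_trans sP.
  have mB : measurable (Q j `\` A) by exact: measurableD.
  have [U U0 eU] := wintQE CB pu ufin j.
  have mj := cmass_gt0 CB j.
  have muE B : measurable B -> B `<=` Q j -> mu B = (fine (mu B))%:E.
    move=> mB' sB; rewrite fineK// ge0_fin_numE// (le_lt_trans _ (cb_fin CB j))//.
    by apply: le_measure; rewrite ?inE.
  have eA := muE _ mA sA'; have eB := muE _ mB (@subDsetl _ _ _).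
  set A1 := fine _ in eA; set B1 := fine _ in eB.
  have := wint_setD mu n1 mA (mQ j) sA'; rewrite !wint_one// eA eB (cmassE CB).
  rewrite -EFinD -EFinM lee_fin => -[eM] hA.
  have B1m : (2^-1 * cmass j <= B1)%R by lra.
  have B10 : (0 < B1)%R by apply: lt_le_trans B1m; rewrite mulr_gt0.
  have := wint_setD mu nu mA (mQ j) sA'; rewrite eU.
  have [a1 a10 ->] := wintSE CB pu ufin mA sA'.
  have [b1 b10 eb1] := wintSE CB pu ufin mB (@subDsetl _ _ _).
  rewrite eb1 -EFinD -EFinM lee_fin => -[eUU].
  have bp : (0 < b1)%R.
    rewrite lt0r b10 andbT; apply/eqP => bz.
    by move: B10; rewrite -lte_fin -eB (posw_null pu mB) ?ltxx// eb1 bz.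
  suff : (2^-1 * (K * 2 `^ b) `^ (- a^-1) * U <= b1)%R by rewrite /th; lra.
  have [c' [e' [c'0 e'0 ce' hc' he']]] := AP j.
  pose c2 := ((b1 / B1) `^ a)%R; pose e2 := (e' * 2 `^ b)%R.
  have bB : (0 < b1 / B1)%R by rewrite divr_gt0.
  have c20 : (0 < c2)%R by rewrite powR_gt0.
  have e20 : (0 < e2)%R by rewrite mulr_gt0// powR_gt0.
  have k1 : pmean mu (Q j `\` A) B1 a w c2.
    rewrite pmeanE ?gt_eqF// eb1 lee_fin /c2 -powRrM mulfV ?gt_eqF// powRr1 ?(ltW bB)//.
    by rewrite divfK ?gt_eqF.
  have k2 : pmean mu (Q j `\` A) B1 b (fun x => (w x)^-1)%R e2.
    move: he'; rewrite !pmeanE ?gt_eqF// => he'.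
    have ps : nnw (fun x => (w x)^-1 `^ b^-1)%R.
      by apply: posw_nnw; apply: posw_powR; exact: posw_inv.
    apply: (le_trans (wint_sub mu ps mB (mQ j) (@subDsetl _ _ _))).
    apply: (le_trans he'); rewrite lee_fin /e2 powRM ?powR_ge0 ?(ltW e'0)//.
    rewrite -powRrM mulfV ?gt_eqF// powRr1// -mulrA ler_wpM2l ?powR_ge0//; lra.
  have := pmean_inv_ge1 mB B10 (ltW a0) (ltW b0) c20 e20 pw eB k1 k2 => ge1.
  move: hc'; rewrite pmeanE ?gt_eqF// -/u eU lee_fin => hU.
  have cle : (c' <= c2 * (K * 2 `^ b))%R.
    rewrite -(ler_pM2r e'0); apply: (le_trans ce').
    have -> : (c2 * (K * 2 `^ b) * e' = K * (c2 * e2))%R by rewrite /e2; ring.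
    by rewrite ler_peMr ?(ltW K0).
  have {hU} : (U <= b1 / B1 * (K * 2 `^ b) `^ a^-1 * cmass j)%R.
    apply: (le_trans hU); apply: ler_wpM2r; first exact: ltW.
    have -> : (b1 / B1 = c2 `^ a^-1)%R.
      by rewrite /c2 -powRrM mulfV ?gt_eqF// powRr1// ltW.
    rewrite -powRM ?(ltW c20) ?mulr_ge0 ?powR_ge0 ?(ltW K0)//.
    by apply: ge0_ler_powR; rewrite ?nnegrE ?invr_ge0 ?(ltW a0) ?(ltW c'0)// !mulr_ge0 ?powR_ge0 ?(ltW c20) ?(ltW K0).
  rewrite powRN; set Y := ((K * 2 `^ b) `^ a^-1)%R => hU.
  have Y0 : (0 < Y)%R by rewrite powR_gt0// (lt_le_trans _ K2).
  rewrite mulrAC ler_pdivrMr//.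
  have : (b1 / B1 * Y * cmass j <= b1 / B1 * Y * (2 * B1))%R.
    by apply: ler_wpM2l; [rewrite mulr_ge0 ?ltW|lra].
  have -> : (b1 / B1 * Y * (2 * B1) = 2 * (b1 * Y))%R by field; rewrite gt_eqF.
  lra.
have := reverse_hoelder (db_nested DB c) (db_outer DB c) pu pone h0oo h2oo h1oo
  D2 h0 h1 th0 th1 rho0 dbl ain w12.
rewrite (cE _ nu) eV -/del -/Cst -EFinM.
have -> : (fun x => (u x / 1) `^ del * u x)%R = (fun x => w x `^ (a / (1 + del))^-1)%R.
  apply/funext => x; rewrite divr1 -[X in (_ * X)%R](powRr1 (ltW (pu.2 x))).
  rewrite -powRD_gt0 ?pu.2// /u -powRrM; congr (_ `^ _)%R.
  by field; rewrite !gt_eqF.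
rewrite cE; last by apply: posw_nnw; exact: posw_powR.
rewrite pmeanE ?gt_eqF ?divr_gt0// => h; apply: (le_trans h); rewrite lee_fin.
have -> : ((g * Cst `^ (a / (1 + del))) `^ (a / (1 + del))^-1 =
    g `^ (a / (1 + del))^-1 * Cst)%R.
  rewrite powRM ?powR_ge0 ?(ltW g0)//; congr (_ * _)%R.
  by rewrite -powRrM mulfV ?gt_eqF ?divr_gt0// powRr1// ltW.
rewrite -[leLHS]mulrA [leRHS]mulrAC [leRHS]mulrC; apply: ler_wpM2l; first exact: ltW.
move: hg; rewrite pmeanE ?gt_eqF// -/u eV lee_fin => hg.
have hV : (V / cmass c <= g `^ a^-1)%R by rewrite ler_pdivrMr.
have -> : ((a / (1 + del))^-1 = a^-1 * (1 + del))%R by rewrite invf_div mulrC.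
rewrite [(g `^ _)%R]powRrM; have -> : ((V / cmass c) `^ del * V = (V / cmass c) `^ (1 + del) * cmass c)%R.
  rewrite powRD_gt0 ?divr_gt0// powRr1 ?(ltW rho0)// mulrAC divfK ?gt_eqF//.
  by rewrite mulrC.
rewrite ler_wpM2r ?(ltW m0)//.
by apply: ge0_ler_powR; rewrite ?nnegrE ?powR_ge0 ?(ltW d1) ?(ltW rho0).
Qed.

End Ainfty_characterisations.

(** * From the Fujii-Wilson constant to absolute continuity *)

Section fujii_wilson_absc.
Context d (T : measurableType d) (R : realType) (mu : {measure set T -> \bar R}).
Context (C : Type) (Q : C -> set T) (trip : C -> C) (rc : nat -> C) (K3 : R).
Hypothesis CB : cube_basis mu Q trip rc K3.
Context (I : countType) (cx : C -> nat -> T -> I) (bx : C -> T)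
  (sub : C -> nat -> T -> C) (D0 : R) (chain : R -> nat).
Hypothesis DB : dyadic_basis mu Q cx bx sub D0 chain.
Local Notation wint := (wint mu).
Local Notation cmass := (cmass mu Q).
Local Notation absc := (absc mu Q).
Local Notation one := (fun=> 1%R : R).
Let mQ c : measurable (Q c) := cb_meas CB c.
Let mcell c k x : measurable (dcell (cx c) k x) := (db_nested DB c).2 k x.

Lemma sum_layers (lam0 y : R) (P : nat -> bool) N : (0 <= lam0)%R -> (0 <= y)%R ->
  (forall k, P k -> lam0 * 2 ^+ k <= y)%R ->
  (\sum_(k < N) lam0 * 2 ^+ k * (P k)%:R <= 2 * y)%R.
Proof.
move=> l0 y0 h.
have full n : (\sum_(k < n) lam0 * 2 ^+ k * (P k)%:R <= lam0 * 2 ^+ n)%R.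
  elim: n => [|n IH]; first by rewrite big_ord0 mulr_ge0// exprn_ge0.
  rewrite big_ord_recr/= exprS; have : (0 <= lam0 * 2 ^+ n)%R by rewrite mulr_ge0// exprn_ge0.
  by move: IH; case: (P n); rewrite ?mulr1 ?mulr0; lra.
elim: N => [|N IH]; first by rewrite big_ord0 mulr_ge0.
rewrite big_ord_recr/=; case: (boolP (P N)) => [PN|_]; last by rewrite mulr0 addr0.
by have := full N; have := h N PN; rewrite mulr1; lra.
Qed.

Variables (K : R) (v : T -> R).
Hypotheses (K0 : (0 < K)%R) (pv : posw v) (vfin : forall c, wint v (Q c) < +oo).
Hypothesis fw : forall c,
  \int[mu]_(x in Q c) maxw mu Q rc one (fun y => ((v \_ (Q c)) y)%:E) x <=
  K%:E * wint v (Q c).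
Let nv := posw_nnw pv.
Let pone : posw (one : T -> R). Proof. by split=> //; exact: measurable_cst. Qed.
Let none := posw_nnw pone.
Let onefin c : wint one (Q c) < +oo.
Proof. by rewrite wint_one//; exact: cb_fin CB c. Qed.

Section one_cube.
Variables (c : C) (V : R).
Hypotheses (V0 : (0 < V)%R) (eV : wint v (Q c) = V%:E).
Let f y := ((v \_ (Q c)) y)%:E.
Let lam k := (V / cmass c * 2 ^+ k)%R.
Let Q0 := dcell (cx c) 0 (bx c).
Let bad k j := Q0 `&` bad_cell mu (cx c) v one (lam k) j.
Let Om k := \bigcup_j bad k j.
Let m0 := cmass_gt0 CB c.
Let em := cmassE CB c.

Let lam0 k : (0 < lam k)%R.
Proof. by rewrite /lam mulr_gt0 ?divr_gt0 ?exprn_gt0. Qed.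

Let sQ0 : Q0 `<=` Q c.
Proof. by have := @db_sub _ _ _ _ _ _ _ _ _ _ _ _ DB c 0%N (bx c); rewrite (db_base DB). Qed.

Let Q0_cell k x : Q0 x -> dcell (cx c) k x `<=` Q0.
Proof.
move=> Qx y; rewrite /Q0 -(dcell_eq Qx).
exact: (dcell_nest (db_nested DB c) (leq0n k)).
Qed.

Let badP k j x y : dcell (cx c) j x y -> bad k j x -> bad k j y.
Proof.
move=> xy [Qx b]; split; first exact: (Q0_cell Qx xy).
exact: bad_cellP xy b.
Qed.

Let mOm k : measurable (Om k).
Proof. exact: (measurable_stop (db_nested DB c) (@badP k)). Qed.

Let sOm k : Om k `<=` Q c.
Proof. by move=> x [j _ [Qx _]]; exact: sQ0. Qed.

Let Om_mono k N : (k <= N)%N -> Om N `<=` Om k.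
Proof.
move=> kN x [j _ [Qx b]]; exists j => //; split => //.
apply: le_lt_trans b; apply: lee_wpmul2r; first exact: (wint_ge0 mu _ none).
rewrite lee_fin /lam ler_wpM2l ?divr_ge0 ?(ltW V0) ?(ltW m0)//.
by rewrite ler_weXn2l// ler1n.
Qed.

(** A maximal bad cell has a parent that is not bad, because the top cell has exactly the ratio
    [lam 0]. Its mass is at most that of the parent, whose volume is at most [D0] times larger. *)
Let Om_le k : wint v (Om k) <= (D0 * lam k)%:E * mu (Om k).
Proof.
rewrite -(wint_one mu (mOm k)) -[Om k]setIT.
have D00 : (0 <= D0)%R by apply: le_trans (db_D0 DB).
apply: (stop_wint_le (db_nested DB c) (@badP k)) => //.
  by rewrite mulr_ge0// ltW.
case=> [|j] x [Qx b] nb; rewrite !setIT.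
  exfalso; move: b; rewrite /bad_cell /= -/(wint v _) -/(wint one _) (dcell_eq Qx).
  rewrite -!(wint_cell CB DB)// (db_base DB) eV wint_one// em -EFinM lte_fin.
  rewrite ltNge => /negP; apply.
  rewrite /lam mulrAC divfK ?gt_eqF// ler_peMr ?(ltW V0)//.
  by rewrite exprn_ege1// ler1n.
have nbj : ~ bad_cell mu (cx c) v one (lam k) j x.
  by move=> b'; apply: (nb j (ltnSn j)); split.
have h1 : wint v (dcell (cx c) j x) <= (lam k)%:E * wint one (dcell (cx c) j x).
  by rewrite leNgt; apply/negP => b'; apply: nbj.
apply: (@le_trans _ _ (wint v (dcell (cx c) j x))).
  apply: wint_sub => //; exact: (dcell_nest (db_nested DB c) (leqnSn j)).
apply: (le_trans h1).
rewrite -!(wint_cell CB DB)// !wint_one// (mulrC D0) (EFinM (lam k)) -muleA; apply: lee_wpmul2l.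
  by rewrite lee_fin ltW.
exact: (db_half DB).
Qed.

(** Replacing a bad cell by a member of the countable family that contains it divides the average by
    at most [K3]. *)
Let maxw_Om k x : Om k x -> (lam k / K3)%:E <= maxw mu Q rc one f x.
Proof.
move=> [j _ [Qx b]]; set P := dcell (cx c) j x; set Qj := sub c j x.
have sP : P `<=` Q Qj by exact: (@db_sub _ _ _ _ _ _ _ _ _ _ _ _ DB c j x).
have [i [s1 s2]] := cb_count CB Qj.
have K30 : (0 < K3)%R by apply: lt_le_trans (cb_K3 CB).
have lK : (0 <= lam k / K3)%R by rewrite divr_ge0 ?ltW.
apply: (@le_trans _ _ (avgw mu Q one f (rc i))); last first.
  by apply: ereal_sup_ubound; exists i => //; apply: s1; exact: sP.
apply: ltW; rewrite (avgw_gt CB pone onefin)// wint_one//.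
have mf : measurable_fun setT f.
  apply/measurable_EFinP; apply/(measurable_restrictT _ (mQ c)).
  by apply: measurable_funTS; exact: pv.1.
have f0 y : 0 <= f y by rewrite /f /patch lee_fin; case: ifPn => // _; exact: ltW (pv.2 y).
have mf1 A : measurable_fun A (fun y => f y * 1%:E).
  by apply: emeasurable_funM; [exact: measurable_funTS|exact: measurable_cst].
have f10 y : 0 <= f y * 1%:E by rewrite mule1.
apply: (@le_lt_trans _ _ ((lam k)%:E * wint one P)).
  rewrite -(wint_cell CB DB c j x none) (wint_one mu (mQ _)).
  have h : mu (Q (rc i)) <= K3%:E * mu (Q Qj).
    by apply: le_trans (cb_trip_le CB Qj); apply: le_measure; rewrite ?inE.
  apply: (le_trans (lee_wpmul2l _ h)); first by rewrite lee_fin.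
  by rewrite muleA -EFinM divfK ?gt_eqF.
apply: (lt_le_trans b).
apply: (@le_trans _ _ (\int[mu]_(y in P) (f y * 1%:E))).
  apply: ge0_le_integral => //.
  - by move=> y _; exact: nnw_ge0.
  - exact: nnw_mE.
  move=> y Py; rewrite mule1 /f /patch ifT ?lexx// inE; apply: sQ0.
  exact: (Q0_cell Qx Py).
apply: ge0_subset_integral => //.
  exact: mcell.
exact: (subset_trans sP s1).
Qed.

Let g N x : R := (\sum_(k < N) lam k * (x \in Om k)%:R)%R.

Let mOmk k : nnw (fun x => lam k * (x \in Om k)%:R)%R.
Proof.
split; last by move=> x; rewrite mulr_ge0 ?ler0n// ltW.
apply: measurable_funM; first exact: measurable_cst.
have -> : (fun x => (x \in Om k)%:R : R) = \1_(Om k) by apply/funext => x; rewrite indicE.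
exact: measurable_indic.
Qed.

Let nng N : nnw (g N).
Proof.
elim: N => [|N [IH1 IH2]].
  have -> : g 0%N = fun=> 0%R by apply/funext => x; rewrite /g big_ord0.
  by split => //; exact: measurable_cst.
have -> : g N.+1 = (fun x => g N x + lam N * (x \in Om N)%:R)%R.
  by apply/funext => x; rewrite /g big_ord_recr.
split; last by move=> x; rewrite addr_ge0 ?IH2 ?(mOmk N).2.
by apply: measurable_funD => //; exact: (mOmk N).1.
Qed.

(* The layers [lam k] on [Om k] add up to at most a multiple of the maximal
   function, whence [v (Om N) = O(1 / N)]. *)
Let Om_sum M N : (N <= M)%N -> N%:R%:E * wint v (Om M) <= D0%:E * wint (g N) (Q c).
Proof.
have D00 : (0 <= D0)%R by apply: le_trans (db_D0 DB).
elim: N => [|N IH] NM.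
  by rewrite mul0e mule_ge0 ?lee_fin// wint_ge0.
have -> : wint (g N.+1) (Q c) = wint (g N) (Q c) + (lam N)%:E * mu (Om N).
  rewrite /wint; under eq_integral do rewrite /g big_ord_recr /= EFinD.
  rewrite ge0_integralD//; last 4 first.
  - by move=> x _; exact: nnw_ge0 (nng N) x.
  - exact: nnw_mE (nng N) _.
  - by move=> x _; exact: nnw_ge0 (mOmk N) x.
  - exact: nnw_mE (mOmk N) _.
  congr (_ + _); under eq_integral do rewrite EFinM -indicE.
  rewrite (ge0_integralZl_EFin mu (mQ c))//; last 2 first.
  - by apply/measurable_EFinP; apply: measurable_funTS; exact: measurable_indic.
  - exact: ltW.
  by rewrite (integral_indic mu (mQ c) (mOm N)) setIidl.
have h1 : 0 <= wint (g N) (Q c) by exact: wint_ge0.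
have h2 : 0 <= (lam N)%:E * mu (Om N) by rewrite mule_ge0// lee_fin ltW.
have h3 : wint v (Om M) <= D0%:E * ((lam N)%:E * mu (Om N)).
  rewrite muleA -EFinM; apply: le_trans (Om_le N).
  by apply: wint_sub => //; exact: Om_mono (ltnW NM).
have := IH (ltnW NM); move: h1 h2 h3 {IH}.
move: (wint v (Om M)) (wint (g N) (Q c)) (_ * mu (Om N)) => x y z y0 z0 xz xy.
rewrite ge0_muleDr// -natr1 (EFinD N%:R 1) ge0_muleDl ?lee_fin ?ler0n// mul1e.
exact: leeD.
Qed.

Let fw_level N : N%:R%:E * wint v (Om N) <= (2 * D0 * K3 * K)%:E * wint v (Q c).
Proof.
have D00 : (0 <= D0)%R by apply: le_trans (db_D0 DB).
have K30 : (0 < K3)%R by apply: lt_le_trans (cb_K3 CB).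
apply: (le_trans (Om_sum (leqnn N))).
have f0 y : 0 <= f y by rewrite /f /patch lee_fin; case: ifPn => // _; exact: ltW (pv.2 y).
have mM := measurable_maxw CB one f.
have M0 x : 0 <= maxw mu Q rc one f x by apply: (maxw_ge0 CB).
have -> (W : \bar R) : (2 * D0 * K3 * K)%:E * W = D0%:E * ((2 * K3)%:E * (K%:E * W)).
  by rewrite !muleA -!EFinM; congr (_%:E * _); ring.
have K20 : (0 <= 2 * K3)%R by rewrite mulr_ge0// ltW.
apply: lee_wpmul2l; first by rewrite lee_fin.
apply: (@le_trans _ _ ((2 * K3)%:E * \int[mu]_(x in Q c) maxw mu Q rc one f x)); last first.
  by apply: lee_wpmul2l; [rewrite lee_fin|exact: fw].
rewrite -(ge0_integralZl_EFin mu (mQ c)) //; last exact: measurable_funTS.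
apply: ge0_le_integral => //.
- by move=> x _; exact: nnw_ge0 (nng N) x.
- exact: nnw_mE (nng N) _.
- by apply: measurable_funeM; exact: measurable_funTS.
move=> x _; have := M0 x; have := @maxw_Om^~ x.
case: (maxw mu Q rc one f x) => [y| |]// h y0; last first.
  by rewrite gt0_muley ?leey// lte_fin mulr_gt0.
rewrite -EFinM lee_fin /g /lam -mulrA.
rewrite lee_fin in y0.
apply: (@sum_layers (V / cmass c) (K3 * y) (fun k => x \in Om k) N).
- by rewrite divr_ge0 ?ltW.
- by rewrite mulr_ge0// ltW.
move=> k; rewrite inE => /h; rewrite lee_fin ler_pdivrMr// [leRHS]mulrC; exact.
Qed.

Let fw_outside N : {ae mu, forall x, Q c x -> ~ Om N x -> (v x <= lam N)%R}.
Proof.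
have em0 : wint one Q0 < +oo by rewrite /Q0 -(wint_cell CB DB).
have ev0 : wint v Q0 < +oo by rewrite /Q0 -(wint_cell CB DB).
have mu0 : mu Q0 < +oo by rewrite -(wint_one mu (mcell _ _ _)).
have h := cell_differentiation (db_nested DB c) (db_outer DB c) pv.1 pone.1
  (fun x => ltW (pv.2 x)) (fun x => ltW (pone.2 x)) (ltW (lam0 N)) mu0 ev0 em0.
have h2 : {ae mu, forall x, ~ (Q c `\` Q0) x}.
  exists (Q c `\` Q0); split; first by apply: measurableD; [exact: mQ|exact: mcell].
    by have := db_null DB c 0%N (bx c); rewrite (db_base DB).
  by move=> x /= /contrapT.
apply: filterS2 h h2 => x hx nx Qx nO.
have Q0x : Q0 x by apply: contrapT => n0; apply: nx.
rewrite -[lam N]mulr1; apply: hx => // -[j _ b]; apply: nO; exists j => //.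
Qed.

Lemma fw_level_set N : exists Om, [/\ measurable Om, Om `<=` Q c,
  N%:R%:E * wint v Om <= (2 * D0 * K3 * K)%:E * wint v (Q c) &
  {ae mu, forall x, Q c x -> ~ Om x -> (v x <= V / cmass c * 2 ^+ N)%R}].
Proof.
exists (Om N); split; [exact: mOm|exact: sOm|exact: fw_level|exact: fw_outside].
Qed.

End one_cube.

(** For N = [fw_lev], above 8 D0 K3 K, the level set [Om N] carries at most a quarter of the mass of
    the cube. Off it [v] is at most 2^N times the average, so a part of proportion [fw_eps] carries
    at most another quarter. *)
Definition fw_lev : nat := (Num.truncn (8 * D0 * K3 * K)).+1.
Definition fw_eps : R := (4 * 2 ^+ fw_lev)^-1%R.

Lemma absc_fw : absc fw_eps v.
Proof.
move=> c A mA sA hA; have [V V0 eV] := wintQE CB pv vfin c.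
have m0 := cmass_gt0 CB c; have em := cmassE CB c.
have K30 : (0 < K3)%R by apply: lt_le_trans (cb_K3 CB).
have D00 : (0 <= D0)%R by apply: le_trans (db_D0 DB).
have [Om [mO sO hO ho]] : exists Om, [/\ measurable Om, Om `<=` Q c,
    fw_lev%:R%:E * wint v Om <= (2 * D0 * K3 * K)%:E * wint v (Q c) &
    {ae mu, forall x, Q c x -> ~ Om x -> (v x <= V / cmass c * 2 ^+ fw_lev)%R}].
  exact: (fw_level_set V0 eV fw_lev).
have mAO : measurable (A `\` Om) by exact: measurableD.
have mOA : measurable (A `&` Om) by exact: measurableI.
have hA1 : wint v A = wint v (A `&` Om) + wint v (A `\` Om).
  have := wint_setD mu nv mOA mA (@subIsetl _ A Om).
  by rewrite (_ : A `\` (A `&` Om) = A `\` Om)// setDIr setDv set0U.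
have hA2 : wint v (A `&` Om) <= wint v Om by exact: wint_sub.
have lamp : (0 <= V / cmass c * 2 ^+ fw_lev)%R.
  by rewrite mulr_ge0 ?exprn_ge0// divr_ge0 ?ltW.
have hA3 : wint v (A `\` Om) <= (V / cmass c * 2 ^+ fw_lev)%:E * mu A.
  apply: (@le_trans _ _ ((V / cmass c * 2 ^+ fw_lev)%:E * wint one (A `\` Om))).
    apply: le_wint => //; apply: filterS ho => x hx [Ax nO].
    by rewrite mulr1 hx//; exact: sA.
  apply: lee_wpmul2l; first by rewrite lee_fin.
  by rewrite wint_one//; apply: le_measure; rewrite ?inE// => x [].
have hA4 : (V / cmass c * 2 ^+ fw_lev)%:E * mu A <= (4^-1 * V)%:E.
  apply: (le_trans (lee_wpmul2l _ hA)); first by rewrite lee_fin.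
  rewrite em -!EFinM lee_fin /fw_eps.
  rewrite [leLHS](_ : _ = 4^-1 * V)%R//; field.
  by rewrite gt_eqF//= gt_eqF// exprn_gt0.
have hA5 : wint v Om <= (4^-1 * V)%:E.
  move: hO; have [z z0 ->] := wintSE CB pv vfin mO sO.
  rewrite eV -!EFinM !lee_fin => hO.
  have hN : (8 * D0 * K3 * K < fw_lev%:R)%R by exact: truncnS_gt.
  have P0 : (0 <= D0 * K3 * K)%R by rewrite !mulr_ge0// ltW.
  have N0 : (0 < fw_lev%:R :> R)%R by rewrite ltr0n.
  rewrite -(ler_pM2l N0); apply: (le_trans hO).
  have -> : (2 * D0 * K3 * K * V = 8 * D0 * K3 * K * (4^-1 * V))%R by field.
  by rewrite ler_wpM2r ?(ltW hN)// mulr_ge0// ltW.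
rewrite hA1 eV; apply: (le_trans (leeD (le_trans hA2 hA5) (le_trans hA3 hA4))).
by rewrite -EFinD -EFinM lee_fin; lra.
Qed.

End fujii_wilson_absc.

Lemma measure_setD_fin d (T : measurableType d) (R : realType) (mu : {measure set T -> \bar R})
    (A B : set T) (a b : R) : measurable A -> measurable B -> B `<=` A ->
  mu A = a%:E -> mu B = b%:E -> mu (A `\` B) = (a - b)%:E.
Proof.
move=> mA mB sBA ea eb; rewrite measureD//; last by rewrite [X in X < _]ea ltry.
by rewrite setIidr// [X in X - _]ea [X in _ - X]eb.
Qed.

Lemma bernoulli_sub (R : realDomainType) (x : R) n : (0 <= x <= 1)%R ->
  (1 - n%:R * x <= (1 - x) ^+ n)%R.
Proof.
move=> /andP[x0 x1]; elim: n => [|n IH]; first by rewrite mul0r subr0 expr0.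
rewrite exprS -natr1.
have : ((1 - n%:R * x) * (1 - x) <= (1 - x) ^+ n * (1 - x))%R.
  by rewrite ler_wpM2r// subr_ge0.
have : (0 <= n%:R * x * x)%R by rewrite !mulr_ge0.
by move: (n%:R)%R ((1 - x) ^+ n)%R => m y; lra.
Qed.

(** * Dyadic cells of the cubes of R^n *)

Section dyadic_cubes.
Context {R : realType} {n : nat}.
Local Notation E := (Rn R n).
Local Notation mu := (lebesgue_n R n).
Local Notation cubeT := (@cubeT R n).

Definition cube_idx (c : cubeT) : nat -> E -> n.-tuple int :=
  cell_idx (sval c).1 (sval c).2.
Definition cube_corner (c : cubeT) : E := (sval c).1.
Definition cube_cell (c : cubeT) (k : nat) (x : E) : cubeT :=
  mkcube (corner (sval c).1 (sval c).2 k x) (half_pow_gt0 k (svalP c)).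
(** Some J > n / eps, for which Bernoulli's inequality gives (1 - 1/J)^n >= 1 - eps. *)
Definition cube_chain (eps : R) : nat := (Num.truncn (n%:R / eps)%R).+1.

Lemma cube_eq (c c' : cubeT) : (forall i, tnth (sval c).1 i = tnth (sval c').1 i) ->
  (sval c).2 = (sval c').2 -> c = c'.
Proof.
case: c c' => [[a l] l0] [[a' l'] l'0] /= ea el; apply: val_inj => /=.
by congr pair => //; apply: eq_from_tnth.
Qed.

Let mq (c : cubeT) : (mu : {measure set E -> \bar R}) (qb c) = ((sval c).2 ^+ n)%:E.
Proof. exact: mu_cube (svalP c). Qed.

Lemma dyadic_basis_Rn :
  dyadic_basis mu qb cube_idx cube_corner cube_cell (2 ^+ n)%R cube_chain.
Proof.
have l0 (c : cubeT) : (0 < (sval c).2)%R := svalP c.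
split.
- by move=> c; exact: nested_cell (l0 c).
- by move=> c; exact: outer_approx_cell (l0 c).
- move=> c; apply: cube_eq => [i|] /=; last by rewrite expr0 divr1.
  by rewrite !tnth_mktuple subrr mul0r floor0 mul0r addr0.
- by move=> c k x; exact: cell_sub_cube (l0 c).
- by move=> c k x; exact: mu_cube_cell0 (l0 c).
- move=> c k x; rewrite !mq -EFinM lee_fin /= -exprMn.
  have -> // : (2 * ((sval c).2 / 2 ^+ k.+1) = (sval c).2 / 2 ^+ k)%R.
  by rewrite exprS; field; rewrite gt_eqF// exprn_gt0.
- by rewrite exprn_ege1// ler1n.
move=> eps eps0 c k x.
set a := (sval c).1; set l := (sval c).2; have lp : (0 < l)%R := l0 c.
pose J := cube_chain eps; pose h := (l / 2 ^+ k.+1)%R.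
have h0 : (0 < h)%R by exact: half_pow_gt0.
have hh : (l / 2 ^+ k = h + h)%R by rewrite /h exprS invfM; lra.
pose b := corner a l k.+1 x; pose b' := corner a l k x.
have bb' i : (tnth b' i <= tnth b i <= tnth b' i + h)%R.
  have s := @cube_cellS R n a l k x lp.
  have p1 : (cube b h : set E) b by move=> j; rewrite lexx lerDl ltW.
  have p2 : (cube b h : set E) [tuple (tnth b i + h)%R | i < n].
    by move=> j; rewrite (tnth_mktuple (fun i => tnth b i + h)%R) lerDl (ltW h0) /=.
  have /andP[q1 _] := s _ p1 i; have /andP[_] := s _ p2 i.
  by rewrite q1 hh (tnth_mktuple (fun i => tnth b i + h)%R) -/b'; lra.
have t0 (j : nat) : (0 <= j%:R / J%:R :> R)%R by rewrite divr_ge0.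
have s0 j : (0 < h + j%:R / J%:R * h)%R by rewrite ltr_pwDl// mulr_ge0// ltW.
have J0 : (0 < J%:R :> R)%R by rewrite ltr0n.
(* Corner and side are interpolated linearly, from the child at [j = 0] to the parent at [j = J]. *)
pose js j : cubeT :=
  mkcube [tuple (tnth b i + j%:R / J%:R * (tnth b' i - tnth b i))%R | i < n] (s0 j).
exists js; split.
- apply: cube_eq => [i|] /=; last by rewrite mul0r mul0r addr0.
  by rewrite (tnth_mktuple (fun i => _ + _ * (_ - _))%R) !mul0r addr0.
- apply: cube_eq => [i|] /=; last by rewrite divff ?gt_eqF// mul1r hh.
  by rewrite (tnth_mktuple (fun i => _ + _ * (_ - _))%R) -/J divff ?gt_eqF// mul1r addrC subrK.
move=> j jJ; pose t : R := (j%:R / J%:R)%R; pose t' : R := (j.+1%:R / J%:R)%R.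
have tt' : (t' = t + J%:R^-1)%R by rewrite /t' -natr1 mulrDl mul1r.
have V0 : (0 < J%:R^-1 :> R)%R by rewrite invr_gt0.
have sub : qb (js j) `<=` qb (js j.+1).
  move=> y /qbP hy; apply/qbP => i; have := hy i; rewrite /= !(tnth_mktuple (fun i => _ + _ * (_ - _))%R) -/t -/t' tt'.
  have /andP[] := bb' i; set u := tnth b i; set u' := tnth b' i => hu1 hu2.
  have : (0 <= J%:R^-1 * (u - u'))%R by rewrite mulr_ge0 ?(ltW V0)// subr_ge0.
  have : (0 <= J%:R^-1 * (u' - u + h))%R by rewrite mulr_ge0 ?(ltW V0)//; lra.
  by move: (J%:R^-1)%R => v; lra.
split => //.
have mQ (c' : cubeT) : measurable (qb c') by exact: measurable_cube.
rewrite (measure_setD_fin (mQ _) (mQ _) sub (mq _) (mq _)) mq -EFinM lee_fin /=.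
rewrite -/t -/t' lerBlDr -lerBlDl.
set s := (h + t * h)%R; set s' := (h + t' * h)%R.
have ss' : (s' * (1 - J%:R^-1) <= s)%R.
  (* A step enlarges the side by h / J, and h is at most [s']. *)
  have : (0 <= t' * J%:R^-1 * h)%R by rewrite !mulr_ge0 ?ltW.
  by rewrite /s /s' tt'; move: (J%:R^-1)%R => v; lra.
have V1 : (J%:R^-1 <= 1 :> R)%R by rewrite invf_le1// ler1n.
have s'0 : (0 < s')%R by exact: s0.
have : ((s' * (1 - J%:R^-1)) ^+ n <= s ^+ n)%R.
  by apply: lerXn2r; rewrite ?nnegrE ?(ltW (s0 j)) ?mulr_ge0 ?(ltW s'0) ?subr_ge0.
apply: le_trans; rewrite exprMn.
rewrite (_ : s' ^+ n - eps * s' ^+ n = s' ^+ n * (1 - eps))%R; last by ring.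
apply: ler_wpM2l; first by rewrite exprn_ge0 ?ltW.
have B := @bernoulli_sub R (J%:R^-1)%R n; apply: le_trans (B _); last by rewrite (ltW V0).
rewrite lerB// ler_pdivrMr// -ler_pdivrMl// mulrC ltW//; exact: truncnS_gt.
Qed.

End dyadic_cubes.

(** * The characteristics of a weight as power means *)

Section averages.
Context d (T : measurableType d) (R : realType) (mu : {measure set T -> \bar R}).
Context (C : Type) (Q : C -> set T) (trip : C -> C) (rc : nat -> C) (K3 : R).
Hypothesis CB : cube_basis mu Q trip rc K3.
Local Notation wint := (wint mu).
Local Notation cmass := (cmass mu Q).
Let mQ c : measurable (Q c) := cb_meas CB c.

(** With [gess], the counterpart of [avg] and [ess_sup_on] for an abstract measure, convertible to
    them on R^n; the passage to power means thus uses only [cube_basis]. *)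
Definition gav (u : T -> \bar R) A : \bar R := (mu A)^-1 * \int[mu]_(x in A) u x.
Definition gess (u : T -> \bar R) A : \bar R :=
  ereal_inf [set y | {ae mu, forall x, A x -> u x <= y}].

Lemma gavE f i : gav (fun x => (f x)%:E) (Q i) = ((cmass i)^-1)%:E * wint f (Q i).
Proof. by rewrite /gav (cmassE CB) inver gt_eqF ?(cmass_gt0 CB). Qed.

Lemma gav_ge0 f i : nnw f -> 0 <= gav (fun x => (f x)%:E) (Q i).
Proof.
by move=> nf; rewrite gavE mule_ge0 ?wint_ge0// lee_fin invr_ge0 ltW// (cmass_gt0 CB).
Qed.

Lemma gav_cong u u' i : measurable_fun setT u -> measurable_fun setT u' ->
  {ae mu, forall x, u x = u' x} -> gav u (Q i) = gav u' (Q i).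
Proof.
move=> mu1 mu2 h; rewrite /gav; congr (_ * _); apply: ae_eq_integral => //.
- exact: measurable_funTS.
- exact: measurable_funTS.
- by apply: filterS h => x + _.
Qed.

Lemma poweR_fun (f : T -> R) r : (fun x : T => (f x)%:E `^ r) = fun x => (f x `^ r)%:E.
Proof. by apply/funext => x; rewrite poweR_EFin. Qed.

Lemma pmean_gav a f c i : (0 < a)%R -> posw f -> (0 < c)%R ->
  pmean mu (Q i) (cmass i) a f c <->
  gav (fun x => (f x)%:E `^ a^-1) (Q i) `^ a <= c%:E.
Proof.
move=> a0 pf c0; rewrite pmeanE ?gt_eqF// poweR_fun gavE.
have m0 := cmass_gt0 CB i.
have : 0 <= wint (fun x => f x `^ a^-1)%R (Q i).
  by apply: wint_ge0; apply: posw_nnw; exact: posw_powR.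
move: (wint _ _) => X; case: X => [x| |]// x0; last first.
  by rewrite gt0_muley ?lte_fin ?invr_gt0// poweRyr ?gt_eqF.
rewrite -EFinM poweR_EFin !lee_fin in x0 *.
have y0 : (0 <= (cmass i)^-1 * x)%R by rewrite mulr_ge0// invr_ge0 ltW.
rewrite -[(_ <= c)%R](ge1_powR_le _ _ (ltW c0) (a := a^-1)) ?invr_gt0 ?powR_ge0//.
rewrite -powRrM mulfV ?gt_eqF// powRr1//.
by rewrite [(_^-1 * x)%R]mulrC ler_pdivrMr.
Qed.

Lemma gav1 f i : posw f -> (forall c, wint f (Q c) < +oo) ->
  gav (fun x => (f x)%:E) (Q i) = (fine (wint f (Q i)) / cmass i)%:E.
Proof.
move=> pf ffin; have [V V0 eV] := wintQE CB pf ffin i.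
by rewrite gavE eV -EFinM mulrC.
Qed.

Lemma pmean1_fin f c i : posw f -> pmean mu (Q i) (cmass i) 1 f c -> wint f (Q i) < +oo.
Proof.
move=> pf; rewrite pmeanE ?oner_eq0// invr1.
have -> : (fun x => f x `^ 1)%R = f by apply/funext => x; rewrite powRr1// ltW// pf.2.
by move=> h; apply: (le_lt_trans h); rewrite ltry.
Qed.

Lemma pmean1_gav f c i : posw f -> (0 < c)%R ->
  pmean mu (Q i) (cmass i) 1 f c <-> gav (fun x => (f x)%:E) (Q i) <= c%:E.
Proof.
move=> pf c0; rewrite pmean_gav// invr1 poweRe1; last by rewrite poweR_fun gav_ge0//; exact/posw_nnw/posw_powR.
have -> // : (fun x => (f x)%:E `^ 1) = (fun x => (f x)%:E).
by apply/funext => x; rewrite poweRe1// lee_fin ltW// pf.2.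
Qed.

Section outputs.
Variables (a b K c e : R) (v : T -> R) (i : C).
Hypotheses (a0 : (0 <= a)%R) (a1 : (a <= 1)%R) (b0 : (0 <= b)%R) (pv : posw v)
  (c0 : (0 < c)%R) (e0 : (0 < e)%R) (ce : (c * e <= K)%R)
  (hc : pmean mu (Q i) (cmass i) a v c)
  (he : pmean mu (Q i) (cmass i) b (fun x => (v x)^-1)%R e).
Let muQ : mu (Q i) <= (cmass i)%:E.
Proof. by rewrite (cmassE CB). Qed.
Let h1 : pmean mu (Q i) (cmass i) 1 v c.
Proof. exact: (pmean_mono (mQ i) muQ a0 a1 c0 pv hc). Qed.
Let g1 : gav (fun x => (v x)%:E) (Q i) <= c%:E.
Proof. exact/pmean1_gav. Qed.
Let g0 : 0 <= gav (fun x => (v x)%:E) (Q i).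
Proof. by apply: gav_ge0; exact: posw_nnw. Qed.

Lemma Ap_cube : (0 < b)%R -> gav (fun x => (v x)%:E) (Q i) *
  gav (fun x => (v x)%:E `^ (- b^-1)) (Q i) `^ b <= K%:E.
Proof.
move=> bp; apply: (@le_trans _ _ (c%:E * e%:E)); last by rewrite -EFinM lee_fin.
apply: lee_pmul => //; first exact: poweR_ge0.
have -> : (fun x => (v x)%:E `^ (- b^-1)) = (fun x => ((v x)^-1)%:E `^ b^-1).
  by apply/funext => x; rewrite !poweR_EFin powRV ?pv.2// powRN.
by apply/pmean_gav => //; exact: posw_inv.
Qed.

Lemma A1_cube : b = 0%R -> gav (fun x => (v x)%:E) (Q i) *
  gess (fun x => (v x)%:E^-1) (Q i) <= K%:E.
Proof.
move=> bz; apply: (@le_trans _ _ (c%:E * e%:E)); last by rewrite -EFinM lee_fin.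
move: he; rewrite bz /pmean eqxx => he1.
have h : gess (fun x => (v x)%:E^-1) (Q i) <= e%:E.
  apply: ereal_inf_lbound => /=; apply: filterS he1 => x hx Qx.
  by rewrite inver gt_eqF ?pv.2// lee_fin hx.
apply: (le_trans (lee_wpmul2l g0 h)).
by apply: lee_wpmul2r => //; rewrite lee_fin ltW.
Qed.

(** By Hoelder's inequality the average of [v] times [e] is at least 1, so the mean of 1/v controls
    the denominator of the reverse Hoelder quotient. *)
Let gV : (gav (fun x => (v x)%:E) (Q i))^-1 <= e%:E.
Proof.
have m0 := cmass_gt0 CB i.
have gp : 0 < gav (fun x => (v x)%:E) (Q i).
  rewrite gavE; apply: mule_gt0; first by rewrite lte_fin invr_gt0.
  exact: (wintQ_gt0 CB).
have [g gg0 eg] : exists2 g : R, (0 < g)%R & gav (fun x => (v x)%:E) (Q i) = g%:E.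
  move: g1 gp; case: (gav _ _) => [g| |]//= _ gp; first by exists g.
have k1 : pmean mu (Q i) (cmass i) 1 v g by apply/pmean1_gav => //; rewrite eg.
have := pmean_inv_ge1 (mQ i) m0 ler01 b0 gg0 e0 pv (cmassE CB i) k1 he.
by rewrite eg inver gt_eqF// lee_fin -ler_pdivrMl// mulr1.
Qed.

Let gV0 : 0 <= (gav (fun x => (v x)%:E) (Q i))^-1.
Proof. by rewrite inve_ge0. Qed.

Lemma RH_cube : (0 < a)%R -> gav (fun x => (v x)%:E `^ a^-1) (Q i) `^ a *
  (gav (fun x => (v x)%:E) (Q i))^-1 <= K%:E.
Proof.
move=> ap; apply: (@le_trans _ _ (c%:E * e%:E)); last by rewrite -EFinM lee_fin.
apply: lee_pmul => //; first exact: poweR_ge0.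
by apply/pmean_gav.
Qed.

Lemma RHoo_cube : a = 0%R -> gess (fun x => (v x)%:E) (Q i) *
  (gav (fun x => (v x)%:E) (Q i))^-1 <= K%:E.
Proof.
move=> az; apply: (@le_trans _ _ (c%:E * e%:E)); last by rewrite -EFinM lee_fin.
move: hc; rewrite az /pmean eqxx => hc1.
have h : gess (fun x => (v x)%:E) (Q i) <= c%:E.
  apply: ereal_inf_lbound => /=; apply: filterS hc1 => x hx Qx.
  by rewrite lee_fin hx.
apply: (le_trans (lee_wpmul2r gV0 h)).
by apply: lee_wpmul2l => //; rewrite lee_fin ltW.
Qed.

End outputs.

Section inputs.
Variables (K V : R) (v : T -> R) (u : T -> \bar R) (i : C).
Hypotheses (K0 : (0 < K)%R) (pv : posw v) (vfin : forall c, wint v (Q c) < +oo).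
Hypotheses (mu1 : measurable_fun setT u) (uv : {ae mu, forall x, u x = (v x)%:E}).
Hypothesis eV : wint v (Q i) = V%:E.

Let V0 : (0 < V)%R.
Proof. by rewrite -lte_fin -eV; exact: (wintQ_gt0 CB). Qed.

Let gavu : gav u (Q i) = (V / cmass i)%:E.
Proof.
rewrite (gav_cong (u' := fun x => (v x)%:E))//; first by rewrite gav1// eV.
by apply/measurable_EFinP; exact: pv.1.
Qed.

Let gavp r : gav (fun x => u x `^ r) (Q i) = gav (fun x => (v x)%:E `^ r) (Q i).
Proof.
apply: gav_cong.
- exact: (measurableT_comp (measurable_poweR _)).
- by rewrite poweR_fun; apply/measurable_EFinP; exact: (posw_powR _ pv).1.
- by apply: filterS uv => x ->.
Qed.

(** The average of [v] is the common pivot: it multiplies the bound for v here, divides the one for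
    1/v in [Ap_cube_pmean], and cancels in their product. *)
Lemma RH_cube_pmean a : (0 < a)%R ->
  gav (fun x => u x `^ a^-1) (Q i) `^ a * (gav u (Q i))^-1 <= K%:E ->
  pmean mu (Q i) (cmass i) a v (K * (V / cmass i))%R.
Proof.
have Vm0 : (0 < V / cmass i)%R by rewrite divr_gt0// (cmass_gt0 CB).
move=> a0; rewrite gavu gavp inver gt_eqF// => h.
apply/pmean_gav => //; first by rewrite mulr_gt0.
by rewrite EFinM -lee_pdivrMr.
Qed.

Lemma Ap_cube_pmean b : (0 < b)%R ->
  gav u (Q i) * gav (fun x => u x `^ (- b^-1)) (Q i) `^ b <= K%:E ->
  pmean mu (Q i) (cmass i) b (fun x => (v x)^-1)%R (K * (cmass i / V))%R.
Proof.
have m0 := cmass_gt0 CB i.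
have Vm0 : (0 < V / cmass i)%R by rewrite divr_gt0.
move=> b0; rewrite gavu gavp => h.
apply/pmean_gav => //; [exact: posw_inv|by rewrite mulr_gt0// divr_gt0|].
have <- : (fun x => (v x)%:E `^ (- b^-1)) = (fun x => ((v x)^-1)%:E `^ b^-1).
  by apply/funext => x; rewrite !poweR_EFin powRV ?pv.2// powRN.
by rewrite -(invf_div V) EFinM lee_pdivlMr// muleC.
Qed.

End inputs.
End averages.

(** The integral of a non-negative function is a supremum over the simple functions below it, hence
    monotone for arbitrary functions. The maximal function over all cubes is compared in this
    way. *)
Lemma ge0_le_integral_nonmeasurable d (T : measurableType d) (R : realType)
    (mu : {measure set T -> \bar R}) (D : set T) (f g : T -> \bar R) :
  (forall x, D x -> 0 <= f x) -> (forall x, D x -> f x <= g x) ->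
  \int[mu]_(x in D) f x <= \int[mu]_(x in D) g x.
Proof.
move=> f0 fg; have g0 x : D x -> 0 <= g x by move=> Dx; exact: le_trans (f0 _ Dx) (fg _ Dx).
rewrite !ge0_integralE//; apply: ereal_sup_le => _ [h hf <-]; exists h => // x.
apply: (le_trans (hf x)); rewrite /patch; case: ifPn => // /[!inE] Dx; exact: fg.
Qed.

(** * Maximal functions over all cubes and over the countable family *)

Section maximal_comparison.
Context d (T : measurableType d) (R : realType) (mu : {measure set T -> \bar R}).
Context (C : Type) (Q : C -> set T) (trip : C -> C) (rc : nat -> C) (K3 : R).
Hypothesis CB : cube_basis mu Q trip rc K3.
Local Notation wint := (wint mu).
Local Notation cmass := (cmass mu Q).
Local Notation gav := (gav mu).
Local Notation one := (fun=> 1%R : R).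
Let mQ c : measurable (Q c) := cb_meas CB c.
Let K30 : (0 < K3)%R. Proof. by apply: lt_le_trans (cb_K3 CB). Qed.
Let pone : posw (one : T -> R). Proof. by split=> //; exact: measurable_cst. Qed.

Definition gmax (f : T -> \bar R) (x : T) : \bar R :=
  ereal_sup [set gav (fun y => `|f y|) (Q c) | c in [set c | Q c x]].

Let avgw_one f c : avgw mu Q one f c = gav f (Q c).
Proof.
rewrite /avgw /gav wint_one//; congr (_ * _); apply: eq_integral => x _.
by rewrite mule1.
Qed.

Section one_function.
Variables (f : T -> \bar R).
Hypotheses (mf : measurable_fun setT f) (f0 : forall x, 0 <= f x).

Let absf : (fun y => `|f y|) = f.
Proof. by apply/funext => y; rewrite gee0_abs. Qed.

Lemma maxw_le_gmax x : maxw mu Q rc one f x <= gmax f x.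
Proof.
apply: ge_ereal_sup => _ [i Qx <-]; rewrite avgw_one /gmax absf.
by apply: ereal_sup_ubound; exists (rc i).
Qed.

Lemma gmax_le_maxw x : gmax f x <= K3%:E * maxw mu Q rc one f x.
Proof.
rewrite /gmax absf; apply: ge_ereal_sup => _ [c Qx <-].
have [i [s1 s2]] := cb_count CB c.
apply: (@le_trans _ _ (K3%:E * avgw mu Q one f (rc i))); last first.
  apply: lee_wpmul2l; first by rewrite lee_fin ltW.
  by apply: ereal_sup_ubound; exists i => //; exact: s1.
rewrite avgw_one /gav !(cmassE CB) !inver !gt_eqF ?(cmass_gt0 CB)// muleA -EFinM.
apply: (@le_trans _ _ (((cmass c)^-1)%:E * \int[mu]_(x in Q (rc i)) f x)).
  apply: lee_wpmul2l; first by rewrite lee_fin invr_ge0 ltW// (cmass_gt0 CB).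
  by apply: ge0_subset_integral => //; exact: measurable_funTS.
apply: lee_wpmul2r; first exact: integral_ge0.
have h : (cmass (rc i) <= K3 * cmass c)%R.
  rewrite -lee_fin EFinM -!(cmassE CB); apply: le_trans (cb_trip_le CB c).
  by apply: le_measure; rewrite ?inE.
by rewrite lee_fin ler_pdivlMr ?(cmass_gt0 CB)// mulrC ler_pdivrMr ?(cmass_gt0 CB).
Qed.

End one_function.

Let patchE (v : T -> R) c : (fun x => (v x)%:E) \_ (Q c) = fun x => ((v \_ (Q c)) x)%:E.
Proof. by apply/funext => x; rewrite /patch; case: ifP. Qed.

Let mpatch (v : T -> R) c : posw v -> measurable_fun setT (fun x => ((v \_ (Q c)) x)%:E).
Proof.
move=> pv; apply/measurable_EFinP; apply/(measurable_restrictT _ (mQ c)).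
by apply: measurable_funTS; exact: pv.1.
Qed.

Let patch0 (v : T -> R) c x : posw v -> 0 <= ((v \_ (Q c)) x)%:E.
Proof. by move=> pv; rewrite lee_fin /patch; case: ifPn => // _; exact: ltW (pv.2 x). Qed.

Lemma Ainfty_cube (b K : R) (v : T -> R) i : (0 < b)%R -> posw v -> apw mu Q 1 b v K ->
  (wint v (Q i))^-1 * \int[mu]_(x in Q i) gmax ((fun x => (v x)%:E) \_ (Q i)) x <=
  (K3 * (muck_cst K3 b 1 K + 1))%:E.
Proof.
move=> b0 pv AP; rewrite patchE.
have := fujii_wilson CB i ltr01 b0 pv AP; rewrite invr1.
have -> : (fun x => v x `^ 1)%R = v by apply/funext => x; rewrite powRr1// ltW// pv.2.
have vfin c : wint v (Q c) < +oo.
  have := apw_wint_fin ltr01 AP c; rewrite invr1.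
  by have -> : (fun x => v x `^ 1)%R = v by apply/funext => x; rewrite powRr1// ltW// pv.2.
have [V V0 ->] := wintQE CB pv vfin i; rewrite inver gt_eqF// => h.
rewrite lee_pdivrMl//.
have M0 x : 0 <= maxw mu Q rc one (fun y => ((v \_ (Q i)) y)%:E) x.
  apply: (maxw_ge0 CB) => //; last by move=> y; exact: patch0.
  by move=> c; rewrite wint_one//; exact: cb_fin CB c.
have mM := measurable_maxw CB one (fun y => ((v \_ (Q i)) y)%:E).
apply: (@le_trans _ _ (\int[mu]_(x in Q i)
    (K3%:E * maxw mu Q rc one (fun y => ((v \_ (Q i)) y)%:E) x))).
  apply: ge0_le_integral_nonmeasurable => x Qx.
    have le := @maxw_le_gmax _ (patch0 i ^~ pv) x.
    exact: le_trans (M0 x) le.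
  exact: gmax_le_maxw (mpatch i pv) (patch0 i ^~ pv) x.
rewrite (ge0_integralZl_EFin mu (mQ i))//; last 2 first.
- exact: measurable_funTS.
- exact: ltW.
apply: (le_trans (lee_wpmul2l _ h)); first by rewrite lee_fin ltW.
rewrite -!EFinM lee_fin [leLHS](_ : _ = V * (K3 * (muck_cst K3 b 1 K + 1)))%R //.
by rewrite [RHS]mulrC mulrA.
Qed.

Lemma Ainfty_cube_maxw (K V : R) (v : T -> R) (u : T -> \bar R) i : posw v ->
  (forall c, wint v (Q c) < +oo) -> measurable_fun setT u ->
  {ae mu, forall x, u x = (v x)%:E} -> wint v (Q i) = V%:E ->
  (\int[mu]_(x in Q i) u x)^-1 * \int[mu]_(x in Q i) gmax (u \_ (Q i)) x <= K%:E ->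
  \int[mu]_(x in Q i) maxw mu Q rc one (fun y => ((v \_ (Q i)) y)%:E) x <=
  K%:E * wint v (Q i).
Proof.
move=> pv vfin mu1 uv eV.
have V0 : (0 < V)%R by rewrite -lte_fin -eV; exact: (wintQ_gt0 CB).
have -> : \int[mu]_(x in Q i) u x = V%:E.
  rewrite -eV; apply: ae_eq_integral => //.
  - exact: measurable_funTS.
  - by apply/measurable_EFinP; apply: measurable_funTS; exact: pv.1.
  - by apply: filterS uv => x + _.
have -> : gmax (u \_ (Q i)) = gmax (fun y => ((v \_ (Q i)) y)%:E).
  apply/funext => x; rewrite /gmax; congr ereal_sup; apply: eq_imagel => c _.
  apply: (gav_cong CB).
  - apply: measurableT_comp => //.
    by apply/(measurable_restrictT _ (mQ i)); exact: measurable_funTS.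
  - by apply: measurableT_comp => //; exact: mpatch.
  - by apply: filterS uv => y e; rewrite /patch e; case: ifP.
rewrite inver gt_eqF// lee_pdivrMl// eV -EFinM mulrC => h; apply: le_trans h.
apply: ge0_le_integral_nonmeasurable => x Qx.
  apply: (maxw_ge0 CB) => //; last by move=> y; exact: patch0.
  by move=> c; rewrite wint_one//; exact: cb_fin CB c.
by apply: maxw_le_gmax => y; exact: patch0.
Qed.

End maximal_comparison.

(** * Extrapolation *)

Section extrapolation_core.
Context d (T : measurableType d) (R : realType) (mu : {measure set T -> \bar R}).
Context (C : Type) (Q : C -> set T) (trip : C -> C) (rc : nat -> C) (K3 : R).
Hypothesis CB : cube_basis mu Q trip rc K3.
Local Notation wint := (wint mu).
Local Notation apw := (apw mu Q).

Definition pint r (F : T -> R) : \bar R := wint (fun x => F x `^ r)%R setT.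

Lemma nnw_powR F r : nnw F -> nnw (fun x : T => F x `^ r : R)%R.
Proof.
move=> [mF F0]; split => [|x]; last exact: powR_ge0.
exact: (measurableT_comp (measurable_powR _)).
Qed.

Lemma nnw_mul F G : nnw F -> nnw G -> nnw (fun x : T => F x * G x : R)%R.
Proof.
move=> [mF F0] [mG G0]; split => [|x]; last exact: mulr_ge0.
exact: measurable_funM.
Qed.

Lemma pint_ge0 r F : nnw F -> 0 <= pint r F.
Proof. by move=> nF; apply: wint_ge0; exact: nnw_powR. Qed.

Let supp (F : T -> R) := [set x | (0 < F x)%R].
(** Power means are multiplied for positive functions, so [F] is restricted to its support and given
    the value 1 elsewhere. *)
Let fix1 (F : T -> R) (x : T) : R := if (0 < F x)%R then F x else 1%R.

Let msupp F : nnw F -> measurable (supp F).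
Proof.
move=> [mF _]; rewrite -[X in measurable X]setTI.
have -> : supp F = F @^-1` `]0%R, +oo[.
  by apply/seteqP; split => x /=; rewrite in_itv/= andbT.
exact: mF.
Qed.

Let pfix1 F : nnw F -> posw (fix1 F).
Proof.
move=> nF; split=> [|x]; last by rewrite /fix1; case: ifPn.
apply: measurable_fun_ifT; [|exact: nF.1|exact: measurable_cst].
apply: (measurable_fun_bool true); rewrite setTI.
by have := msupp nF; rewrite (_ : supp F = (fun x => (0 < F x)%R) @^-1` [set true])//.
Qed.

Let pint_supp r F (h : T -> R) : nnw F -> (0 < r)%R ->
  pint r (fun x => F x * h x)%R = wint (fun x => (fix1 F x * h x) `^ r)%R (supp F).
Proof.
move=> nF r0; rewrite /pint /wint [RHS]integral_mkcond; apply: eq_integral => x _.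
rewrite /patch; case: ifPn => [|n]; first by rewrite inE /fix1 => ->.
suff -> : F x = 0%R by rewrite mul0r powR0// gt_eqF.
apply/eqP; rewrite eq_le nF.2 andbT leNgt; apply/negP => h0.
by move/negP: n; apply; rewrite inE.
Qed.

(** With m = 1 power means over a set are plain norms, so this is [pmean_mul] on the support of [F].
    If [c = 0] the support is null. *)
Lemma hoelder_pint F kap r s c e : nnw F -> posw kap -> (0 < r)%R -> (0 < s)%R ->
  (0 <= c)%R -> (0 < e)%R -> pint r^-1 F <= (c `^ r^-1)%:E -> pint s^-1 kap <= (e `^ s^-1)%:E ->
  pint (r + s)^-1 (fun x => F x * kap x)%R <= ((c * e) `^ (r + s)^-1)%:E.
Proof.
move=> nF pk r0 s0 c0 e0 hF hk.
have rs0 : (0 < r + s)%R by rewrite addr_gt0.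
have mA := msupp nF; have pF := pfix1 nF.
rewrite pint_supp ?invr_gt0//.
have := pint_supp (fun=> 1%R) nF (r := (r^-1)%R); rewrite invr_gt0 => /(_ r0).
have e1 (G : T -> R) : (fun x => G x * 1)%R = G by apply/funext => x; rewrite mulr1.
rewrite !e1 => hF'.
have e2 : (fun x => (fix1 F x * 1) `^ r^-1)%R = (fun x => fix1 F x `^ r^-1)%R.
  by apply/funext => x; rewrite mulr1.
have [cz|cn] := eqVneq c 0%R.
  have A0 : mu (supp F) = 0.
    apply: (posw_null (posw_powR r^-1 pF) mA); apply/eqP; rewrite eq_le.
    rewrite (wint_ge0 mu _ (posw_nnw (posw_powR r^-1 pF))) andbT -e2.
    by move: hF; rewrite hF' cz powR0// gt_eqF// invr_gt0.
  have nFk : nnw (fun x => (fix1 F x * kap x) `^ (r + s)^-1)%R.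
    exact: posw_nnw (posw_powR _ (posw_mul pF pk)).
  by rewrite (wint_null nFk mA A0) lee_fin powR_ge0.
have cp : (0 < c)%R by rewrite lt0r cn.
have h1 : pmean mu (supp F) 1 r (fix1 F) c.
  by rewrite pmeanE ?gt_eqF// mulr1 -e2 -hF'.
have h2 : pmean mu (supp F) 1 s kap e.
  rewrite pmeanE ?gt_eqF// mulr1; apply: le_trans hk.
  exact: (wint_sub mu (posw_nnw (posw_powR s^-1 pk)) mA measurableT (@subsetT _ _)).
have := pmean_mul mA (ltW r0) (ltW s0) cp e0 pF pk h1 h2.
by rewrite pmeanE ?gt_eqF// mulr1.
Qed.

Lemma pint_le r (F G : T -> R) c : (0 <= c)%R -> nnw F -> nnw G ->
  {ae mu, forall x, (F x `^ r <= c * G x)%R} -> pint r F <= c%:E * wint G setT.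
Proof.
move=> c0 nF nG h; apply: le_wint => //; first exact: nnw_powR.
by apply: filterS h => x + _.
Qed.

Section data.
Variables (a b t K p q p0 q0 C0 : R) (w f g : T -> R).
Hypotheses (a0 : (0 < a)%R) (b0 : (0 < b)%R) (t0 : (0 < t)%R)
  (pp : (0 < p)%R) (qq : (0 < q)%R) (pp0 : (0 < p0)%R) (qq0 : (0 < q0)%R) (C00 : (0 < C0)%R)
  (pw : posw w) (AP : apw a b w K) (nf : nnw f) (ng : nnw g).
Let F x := (f x * w x)%R.
Let G x := (g x * w x)%R.
Hypotheses (Ffin : pint q F < +oo).

Let nF : nnw F. Proof. by apply: nnw_mul => //; exact: posw_nnw. Qed.
Let nG : nnw G. Proof. by apply: nnw_mul => //; exact: posw_nnw. Qed.
Let w0 x : (0 < w x)%R := pw.2 x.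

Let pintR r H : (0 < r)%R -> nnw H -> pint r H < +oo ->
  exists2 h : R, (0 <= h)%R & pint r H = (h `^ r)%:E /\ (h = 0%R -> {ae mu, forall x, H x = 0%R}).
Proof.
move=> r0 nH Hoo; have H0 := pint_ge0 r nH.
have [v v0 ev] : exists2 v : R, (0 <= v)%R & pint r H = v%:E.
  by exists (fine (pint r H)); rewrite ?fine_ge0// fineK// ge0_fin_numE.
exists (v `^ r^-1)%R; first exact: powR_ge0.
rewrite ev -powRrM mulVf ?gt_eqF// powRr1//; split => // vz.
have vz' : v = 0%R by move: vz => /eqP; rewrite powR_eq0 => /andP[/eqP].
have : pint r (fun x => H x * 1)%R = 0.
  by rewrite (_ : (fun x => H x * 1)%R = H) ?ev ?vz'//; apply/funext => x; rewrite mulr1.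
rewrite pint_supp// => h.
have hs := posw_null (posw_powR r (posw_mul (pfix1 nH) (_ : posw (fun=> 1%R)))) (msupp nH) h.
have h0 : mu (supp H) = 0 by apply: hs; split => //; exact: measurable_cst.
exists (supp H); split; [exact: msupp|exact: h0|].
move=> x /= hx; rewrite /supp /= lt0r nH.2 andbT; exact/eqP.
Qed.

(* [kap] majorises [k = (F / |F|_q)^(q t)], so that [F kap] has a larger norm than
   [F], while Hoelder's inequality bounds [G kap]. *)
Lemma extrapolate_up : (t <= b)%R -> (p0^-1 = p^-1 + t)%R -> (q0^-1 = q^-1 + t)%R ->
  (forall W, posw W -> apw (a + t) (b - t) W (core_cst K3 b a t K) ->
    pint q0 (fun x => f x * W x)%R < +oo ->
    pint q0 (fun x => f x * W x)%R `^ q0^-1 <=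
    C0%:E * pint p0 (fun x => g x * W x)%R `^ p0^-1) ->
  pint q F `^ q^-1 <= (C0 * (2 `^ ((b + a) / b + 1)) `^ t)%:E * pint p G `^ p^-1.
Proof.
move=> tb ep eq Hyp.
pose A : R := (2 `^ ((b + a) / b + 1))%R; have A0 : (0 < A)%R by rewrite powR_gt0.
have cst0 : (0 < C0 * A `^ t)%R by rewrite mulr_gt0// powR_gt0.
have [h h0 [eF hz]] := pintR qq nF Ffin.
have hF : pint q F `^ q^-1 = h%:E.
  by rewrite eF poweR_EFin -powRrM mulfV ?gt_eqF// powRr1.
rewrite hF -/A.
have rhs0 : 0 <= (C0 * A `^ t)%:E * pint p G `^ p^-1.
  by rewrite mule_ge0 ?poweR_ge0// lee_fin ltW.
have [hz0|hn] := eqVneq h 0%R; first by rewrite hz0.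
have hp : (0 < h)%R by rewrite lt0r hn.
have [Goo|Goo] := eqVneq (pint p G) +oo.
  by rewrite Goo poweRyr ?gt_eqF ?invr_gt0// gt0_muley ?leey// lte_fin.
rewrite -ltey in Goo.
have [z z0 [eG _]] := pintR pp nG Goo.
have hG : pint p G `^ p^-1 = z%:E.
  by rewrite eG poweR_EFin -powRrM mulfV ?gt_eqF// powRr1.
rewrite hG.
pose k x := ((F x / h) `^ (q * t))%R.
have nFh : nnw (fun x => F x / h)%R.
  split => [|x]; last by rewrite divr_ge0 ?nF.2.
  by apply: measurable_funM; [exact: nF.1|exact: measurable_cst].
have nk : nnw k by exact: nnw_powR.
have kI : wint (fun x => k x `^ t^-1)%R setT = 1.
  have -> : (fun x => k x `^ t^-1)%R = (fun x => (h `^ q)^-1 * F x `^ q)%R.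
    apply/funext => x; rewrite /k -powRrM mulfK ?gt_eqF//.
    by rewrite powRM ?nF.2 ?invr_ge0// powRV// mulrC.
  rewrite /wint; under eq_integral do rewrite EFinM.
  rewrite (ge0_integralZl_EFin mu measurableT)//; last 3 first.
  - by move=> x _; rewrite lee_fin powR_ge0.
  - exact: nnw_mE (nnw_powR q nF) _.
  - by rewrite invr_ge0 powR_ge0.
  by rewrite -/(wint _ _) -/(pint q F) eF -EFinM mulVf// gt_eqF// powR_gt0.
have kpos : 0 < wint (fun x => k x `^ t^-1)%R setT by rewrite kI.
have kfin : wint (fun x => k x `^ t^-1)%R setT < +oo by rewrite kI ltry.
have [kap [pk hk kapI APk]] := factor_up CB a0 b0 t0 tb pw AP nk kpos kfin.
move: kapI; rewrite kI mule1 -/A => kapI.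
have kapI' : pint t^-1 kap <= ((A `^ t) `^ t^-1)%:E.
  by rewrite -powRrM mulfV ?gt_eqF// powRr1 ?(ltW A0).
have At0 : (0 < A `^ t)%R by rewrite powR_gt0.
pose W x := (w x * kap x)%R.
have fW : (fun x => f x * W x)%R = (fun x => F x * kap x)%R.
  by apply/funext => x; rewrite /W /F mulrA.
have gW : (fun x => g x * W x)%R = (fun x => G x * kap x)%R.
  by apply/funext => x; rewrite /W /G mulrA.
have qV0 : (0 < q^-1)%R by rewrite invr_gt0.
have pV0 : (0 < p^-1)%R by rewrite invr_gt0.
have hq : pint q0 (fun x => f x * W x)%R <= ((h * A `^ t) `^ q0)%:E.
  rewrite fW -[q0]invrK eq.
  apply: hoelder_pint => //; by rewrite invrK eF.
have hgp : pint p0 (fun x => g x * W x)%R <= ((z * A `^ t) `^ p0)%:E.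
  rewrite gW -[p0]invrK ep.
  apply: hoelder_pint => //; by rewrite invrK eG.
have pW : posw W by exact: posw_mul.
have := Hyp W pW APk (le_lt_trans hq (ltry _)).
have nfW : nnw (fun x => f x * W x)%R by apply: nnw_mul => //; exact: posw_nnw.
have ngW : nnw (fun x => g x * W x)%R by apply: nnw_mul => //; exact: posw_nnw.
(* Since q t q0 = q - q0, the factor [k] alone gives the equality F^q = h^(q - q0) (F k)^q0, and
   [kap] is above [k]. *)
have lo : h%:E <= pint q0 (fun x => f x * W x)%R `^ q0^-1.
  have ae1 : {ae mu, forall x, (F x `^ q <= h `^ (q - q0) * (f x * W x) `^ q0)%R}.
    apply: filterS hk => x; rewrite /k => hkx.
    have [Fz|Fn] := eqVneq (F x) 0%R.
      by rewrite Fz powR0 ?gt_eqF// mulr_ge0 ?powR_ge0.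
    have Fp : (0 < F x)%R by rewrite lt0r Fn nF.2.
    have -> : (f x * W x = F x * kap x)%R by rewrite /W /F mulrA.
    apply: (@le_trans _ _ (h `^ (q - q0) * (F x * (F x / h) `^ (q * t)) `^ q0)%R).
      rewrite powRM ?powR_ge0 ?(ltW Fp)// -powRrM.
      have -> : (q * t * q0 = q - q0)%R.
        have -> : (t = q0^-1 - q^-1)%R by rewrite eq; ring.
        by field; rewrite !gt_eqF.
      rewrite powRM ?(ltW Fp) ?invr_ge0 ?(ltW hp)// powRV//.
      rewrite [leRHS](_ : _ = F x `^ q0 * F x `^ (q - q0))%R; last first.
        by field; rewrite gt_eqF// powR_gt0.
      by rewrite -powRD_gt0// addrC subrK.
    rewrite ler_wpM2l ?powR_ge0// ge0_ler_powR ?nnegrE ?(ltW qq0)//.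
    - by rewrite mulr_ge0 ?powR_ge0 ?(ltW Fp).
    - by rewrite mulr_ge0 ?(ltW Fp) ?(ltW (pk.2 x)).
    - by rewrite ler_wpM2l ?(ltW Fp).
  have := pint_le (powR_ge0 h (q - q0)) nF (nnw_powR q0 nfW) ae1.
  rewrite eF -/(pint q0 (fun x => f x * W x)%R).
  have := pint_ge0 q0 nfW; move: (pint q0 _) (le_lt_trans hq (ltry _)) => [v| |]// _.
  rewrite -EFinM poweR_EFin !lee_fin => v0 hv.
  have hqq : (0 < h `^ (q - q0))%R by rewrite powR_gt0.
  have : (h `^ q0 <= v)%R.
    rewrite -(ler_pM2l hqq) -powRD_gt0// subrK; exact: hv.
  rewrite -(ge1_powR_le _ _ _ (a := (q0^-1)%R)) ?invr_gt0 ?powR_ge0//.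
  by rewrite -powRrM mulfV ?gt_eqF// powRr1 ?(ltW hp).
move=> H; apply: (le_trans lo); apply: (le_trans H).
rewrite EFinM -muleA; apply: lee_wpmul2l; first by rewrite lee_fin ltW.
apply: (le_trans (le_poweR _ _ hgp)).
- by rewrite invr_ge0 ltW.
- exact: pint_ge0.
rewrite poweR_EFin -powRrM mulfV ?gt_eqF// powRr1 ?mulr_ge0 ?powR_ge0//.
by rewrite -EFinM mulrC.
Qed.

(** Since r t r0 = r0 - r, dividing H by (H / y)^(r t) in place of [kap] and raising to [r0] gives
    exactly y^(r0 - r) H^r. The case [y = 0] is included because the norm of G may vanish. *)
Let pint_div (H kap : T -> R) (r r0 y : R) : (0 < r)%R -> (0 < r0)%R ->
  (r^-1 = r0^-1 + t)%R -> nnw H -> posw kap -> (0 <= y)%R -> pint r H = (y `^ r)%:E ->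
  (y = 0%R -> {ae mu, forall x, H x = 0%R}) ->
  {ae mu, forall x, ((H x / y) `^ (r * t) <= kap x)%R} ->
  pint r0 (fun x => H x * (kap x)^-1)%R <= (y `^ r0)%:E.
Proof.
move=> rp r0p er nH pk y0 eH yz hk.
have nHk : nnw (fun x => H x * (kap x)^-1)%R.
  by apply: nnw_mul => //; exact/posw_nnw/posw_inv.
have ae1 : {ae mu, forall x, ((H x * (kap x)^-1) `^ r0 <= y `^ (r0 - r) * H x `^ r)%R}.
  have triv x : H x = 0%R -> ((H x * (kap x)^-1) `^ r0 <= y `^ (r0 - r) * H x `^ r)%R.
    by move=> ->; rewrite mul0r (powR0 (lt0r_neq0 r0p)) mulr_ge0 ?powR_ge0.
  have [y00|yn] := eqVneq y 0%R; first by apply: filterS (yz y00) => x; exact: triv.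
  have yp : (0 < y)%R by rewrite lt0r yn.
  apply: filterS hk => x hkx.
  have [Hz|Hn] := eqVneq (H x) 0%R; first exact: triv.
  have Hp : (0 < H x)%R by rewrite lt0r Hn nH.2.
  have Hy : (0 < H x / y)%R by rewrite divr_gt0.
  apply: (@le_trans _ _ ((H x / (H x / y) `^ (r * t)) `^ r0)%R).
    apply: ge0_ler_powR; rewrite ?nnegrE ?(ltW r0p)//.
    - by rewrite divr_ge0 ?(ltW Hp)// ltW// pk.2.
    - by rewrite divr_ge0 ?(ltW Hp)// powR_ge0.
    rewrite ler_wpM2l ?(ltW Hp)// lef_pV2 ?posrE ?powR_gt0// ?pk.2//.
  rewrite -powRN powRM ?powR_ge0 ?(ltW Hp)// -powRrM.
  have -> : (- (r * t) * r0 = r - r0)%R.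
    have -> : (t = r^-1 - r0^-1)%R by rewrite er; ring.
    by field; rewrite !gt_eqF.
  rewrite powRM ?(ltW Hp) ?invr_ge0 ?(ltW yp)// powRV// -powRN opprB mulrA.
  by rewrite -powRD_gt0// addrC subrK mulrC.
apply: (le_trans (pint_le (powR_ge0 y (r0 - r)) nHk (nnw_powR r nH) ae1)).
rewrite -/(pint r H) eH -EFinM lee_fin.
have [y00|yn] := eqVneq y 0%R; first by rewrite y00 (powR0 (lt0r_neq0 rp)) mulr0 powR_ge0.
by rewrite -powRD_gt0 ?subrK// lt0r yn.
Qed.

(* [kap] majorises [(F / |F|_q)^(q t)] and [(G / |G|_p)^(p t)], which bounds [F / kap]
   and [G / kap]; [F] is recovered from [F / kap] by Hoelder's inequality. *)
Lemma extrapolate_down : (t <= a)%R -> (p^-1 = p0^-1 + t)%R -> (q^-1 = q0^-1 + t)%R ->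
  (forall W, posw W -> apw (a - t) (b + t) W (core_cst K3 a b t K) ->
    pint q0 (fun x => f x * W x)%R < +oo ->
    pint q0 (fun x => f x * W x)%R `^ q0^-1 <=
    C0%:E * pint p0 (fun x => g x * W x)%R `^ p0^-1) ->
  pint q F `^ q^-1 <= (C0 * (2 `^ ((a + b) / a + 1) * 2) `^ t)%:E * pint p G `^ p^-1.
Proof.
move=> ta ep eq Hyp.
pose A : R := (2 `^ ((a + b) / a + 1))%R; have A0 : (0 < A)%R by rewrite powR_gt0.
(* The 2 bounds the mass of the sum of the two normalised functions. *)
pose A2 : R := (A * 2)%R; have A20 : (0 < A2)%R by rewrite mulr_gt0.
have cst0 : (0 < C0 * A2 `^ t)%R by rewrite mulr_gt0// powR_gt0.
have [h h0 [eF hz]] := pintR qq nF Ffin.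
have hF : pint q F `^ q^-1 = h%:E.
  by rewrite eF poweR_EFin -powRrM mulfV ?gt_eqF// powRr1.
rewrite hF -/A -/A2.
have rhs0 : 0 <= (C0 * A2 `^ t)%:E * pint p G `^ p^-1.
  by rewrite mule_ge0 ?poweR_ge0// lee_fin ltW.
have [hz0|hn] := eqVneq h 0%R; first by rewrite hz0.
have hp : (0 < h)%R by rewrite lt0r hn.
have [Goo|Goo] := eqVneq (pint p G) +oo.
  by rewrite Goo poweRyr ?gt_eqF ?invr_gt0// gt0_muley ?leey// lte_fin.
rewrite -ltey in Goo.
have [z z0 [eG zz]] := pintR pp nG Goo.
have hG : pint p G `^ p^-1 = z%:E.
  by rewrite eG poweR_EFin -powRrM mulfV ?gt_eqF// powRr1.
rewrite hG.
have nscale (H : T -> R) (y : R) : nnw H -> (0 <= y)%R -> nnw (fun x => H x / y)%R.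
  move=> nH y0; split => [|x]; last by rewrite divr_ge0 ?nH.2.
  by apply: measurable_funM; [exact: nH.1|exact: measurable_cst].
have Iscale (H : T -> R) (y r : R) : nnw H -> (0 < y)%R -> pint r H = (y `^ r)%:E ->
    wint (fun x => (H x / y) `^ r)%R setT = 1.
  move=> nH y0 eH.
  have -> : (fun x => (H x / y) `^ r)%R = (fun x => (y `^ r)^-1 * H x `^ r)%R.
    by apply/funext => x; rewrite powRM ?nH.2 ?invr_ge0 ?(ltW y0)// powRV// mulrC.
  rewrite /wint; under eq_integral do rewrite EFinM.
  rewrite (ge0_integralZl_EFin mu measurableT)//; last 3 first.
  - by move=> x _; rewrite lee_fin powR_ge0.
  - exact: nnw_mE (nnw_powR r nH) _.
  - by rewrite invr_ge0 powR_ge0.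
  by rewrite -/(wint _ _) -/(pint r H) eH -EFinM mulVf// gt_eqF// powR_gt0.
pose X x := ((F x / h) `^ q)%R; pose Y x := ((G x / z) `^ p)%R.
have nX : nnw X by apply/nnw_powR/nscale.
have nY : nnw Y by apply/nnw_powR/nscale.
have IX : wint X setT = 1 by exact: Iscale.
(* If [z = 0], division by [z] makes [Y] vanish, hence an inequality. *)
have IY : wint Y setT <= 1.
  have [zz0|zn] := eqVneq z 0%R; last by rewrite (Iscale _ _ _ nG _ eG)// lt0r zn.
  have -> : Y = fun=> 0%R.
    by apply/funext => x; rewrite /Y zz0 invr0 mulr0 powR0// gt_eqF.
  by rewrite /wint integral0.
pose k x := ((X x + Y x) `^ t)%R.
have nXY : nnw (fun x => X x + Y x)%R.
  by split => [|x]; [exact: measurable_funD nX.1 nY.1|rewrite addr_ge0 ?nX.2 ?nY.2].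
have nk : nnw k by exact: nnw_powR.
have kI : wint (fun x => k x `^ t^-1)%R setT = 1 + wint Y setT.
  have -> : (fun x => k x `^ t^-1)%R = (fun x => X x + Y x)%R.
    by apply/funext => x; rewrite /k -powRrM mulfV ?gt_eqF// powRr1// nXY.2.
  rewrite -IX /wint; under eq_integral do rewrite EFinD.
  rewrite ge0_integralD//; first by move=> x _; exact: nnw_ge0 nX x.
  - exact: nnw_mE nX _.
  - by move=> x _; exact: nnw_ge0 nY x.
  - exact: nnw_mE nY _.
have Y0 : 0 <= wint Y setT by exact: wint_ge0.
have kpos : 0 < wint (fun x => k x `^ t^-1)%R setT.
  by rewrite kI (lt_le_trans lte01)// leeDl.
have k2 : wint (fun x => k x `^ t^-1)%R setT <= 2%:E.
  by rewrite kI (_ : 2%:E = 1 + 1 :> \bar R) ?leeD// -EFinD.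
have [kap [pk hk kapI APk]] :=
  factor_down CB a0 b0 t0 ta pw AP nk kpos (le_lt_trans k2 (ltry _)).
have kapI' : pint t^-1 kap <= ((A2 `^ t) `^ t^-1)%:E.
  rewrite -powRrM mulfV ?gt_eqF// powRr1 ?(ltW A20)//.
  apply: (le_trans kapI); rewrite -/A /A2 (EFinM A); apply: lee_wpmul2l => //.
  by rewrite lee_fin ltW.
have At0 : (0 < A2 `^ t)%R by rewrite powR_gt0.
pose W x := (w x / kap x)%R.
have pW : posw W by apply: posw_mul => //; exact: posw_inv.
have fW : (fun x => f x * W x)%R = (fun x => F x * (kap x)^-1)%R.
  by apply/funext => x; rewrite /W /F mulrA.
have gW : (fun x => g x * W x)%R = (fun x => G x * (kap x)^-1)%R.
  by apply/funext => x; rewrite /W /G mulrA.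
have hkF : {ae mu, forall x, ((F x / h) `^ (q * t) <= kap x)%R}.
  apply: filterS hk => x; apply: le_trans; rewrite powRrM /k.
  by apply: ge0_ler_powR; rewrite ?nnegrE ?(ltW t0) ?powR_ge0 ?nXY.2// lerDl nY.2.
have hkG : {ae mu, forall x, ((G x / z) `^ (p * t) <= kap x)%R}.
  apply: filterS hk => x; apply: le_trans; rewrite powRrM /k.
  by apply: ge0_ler_powR; rewrite ?nnegrE ?(ltW t0) ?powR_ge0 ?nXY.2// lerDr nX.2.
have hq : pint q0 (fun x => f x * W x)%R <= (h `^ q0)%:E.
  by rewrite fW; exact: (pint_div qq qq0 eq nF pk h0 eF hz hkF).
have hgp : pint p0 (fun x => g x * W x)%R <= (z `^ p0)%:E.
  by rewrite gW; exact: (pint_div pp pp0 ep nG pk z0 eG zz hkG).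
have nfW : nnw (fun x => f x * W x)%R by apply: nnw_mul => //; exact: posw_nnw.
have ngW : nnw (fun x => g x * W x)%R by apply: nnw_mul => //; exact: posw_nnw.
have fWfin := le_lt_trans hq (ltry _).
have := Hyp W pW APk fWfin.
have [v v0 [ev _]] := pintR qq0 nfW fWfin.
rewrite ev poweR_EFin -powRrM mulfV ?gt_eqF// powRr1// => hv.
have hv' : (v <= C0 * z)%R.
  rewrite -lee_fin EFinM; apply: (le_trans hv); apply: lee_wpmul2l.
    by rewrite lee_fin ltW.
  apply: (le_trans (le_poweR _ _ hgp)); first by rewrite invr_ge0 ltW.
    exact: pint_ge0.
  by rewrite poweR_EFin -powRrM mulfV ?gt_eqF// powRr1.
have hh : pint q F <= ((v * A2 `^ t) `^ q)%:E.
  have -> : F = fun x => (f x * W x * kap x)%R.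
    by apply/funext => x; rewrite /W /F mulrA divfK// gt_eqF// pk.2.
  rewrite -[q]invrK eq; apply: hoelder_pint => //; first by rewrite invr_gt0.
  by rewrite invrK ev.
have {hh} : (h <= v * A2 `^ t)%R.
  have vA : (0 <= v * A2 `^ t)%R by rewrite mulr_ge0// ltW.
  by move: hh; rewrite eF lee_fin ge1_powR_le.
rewrite -EFinM lee_fin => hh; apply: (le_trans hh).
by rewrite mulrAC ler_wpM2r// ltW.
Qed.

End data.
End extrapolation_core.

(** * Real-valued representatives of weights and functions *)

Section real_representatives.
Context d (T : measurableType d) (R : realType) (mu : {measure set T -> \bar R}).

Lemma posw_representative (w : T -> \bar R) : measurable_fun setT w ->
  {ae mu, forall x, 0 < w x < +oo} ->
  exists2 wr : T -> R, posw wr & {ae mu, forall x, w x = (wr x)%:E}.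
Proof.
move=> mw hw; pose oo : \bar R := +oo; pose B := w @^-1` `]0, oo[%classic.
have mB : measurable B by rewrite -[B]setTI; apply: mw => //; exact: emeasurable_itv.
exists (fun x => if x \in B then fine (w x) else 1%R).
  split=> [|x]; last first.
    case: ifPn => //; rewrite inE /B /= in_itv/= => /andP[w0 woo].
    by apply: fine_gt0; rewrite w0 woo.
  apply: measurable_fun_ifT; last exact: measurable_cst.
    apply: (measurable_fun_bool true); rewrite setTI.
    suff -> : (fun x => x \in B) @^-1` [set true] = B by [].
    by apply/seteqP; split=> x /= Bx; [exact: set_mem|exact: mem_set].
  exact: measurableT_comp (fine_measurable measurableT) mw.
apply: filterS hw => x hx.
rewrite ifT; last by rewrite inE /B /= in_itv/=.
by case/andP: hx => w0 woo; rewrite fineK// gt0_fin_numE.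
Qed.

Section norms.
Variables (q : R) (f w : T -> \bar R) (wr : T -> R).
Hypotheses (q0 : (0 < q)%R) (mf : measurable_fun setT f) (f0 : forall x, 0 <= f x)
  (mw : measurable_fun setT w) (pw : posw wr) (ww : {ae mu, forall x, w x = (wr x)%:E}).

Let m1 : measurable_fun setT (fun x => `|f x| `^ q * w x `^ q).
Proof.
apply: emeasurable_funM.
  by apply: (measurableT_comp (measurable_poweR _)); exact: measurableT_comp.
exact: (measurableT_comp (measurable_poweR _)).
Qed.

(** The value +oo of [f] survives multiplication by a positive weight, so a finite norm excludes it
    almost everywhere; [fine] then loses nothing. *)
Lemma norm_lty_ae_fin : \int[mu]_x (`|f x| `^ q * w x `^ q) < +oo ->
  {ae mu, forall x, f x \is a fin_num}.
Proof.
move=> h.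
have int1 : mu.-integrable setT (fun x => `|f x| `^ q * w x `^ q).
  apply/integrableP; split; first exact: m1.
  under eq_integral do rewrite gee0_abs ?mule_ge0 ?poweR_ge0//.
  exact: h.
have := integrable_ae measurableT int1.
move=> h2; apply: filterS2 ww h2 => x wx /(_ Logic.I).
rewrite wx poweR_EFin gee0_abs//; have := f0 x; case: (f x) => [y| |]// _.
by rewrite poweRyr ?gt_eqF// gt0_mulye// lte_fin powR_gt0// pw.2.
Qed.

Lemma norm_pint : {ae mu, forall x, f x \is a fin_num} ->
  \int[mu]_x (`|f x| `^ q * w x `^ q) = pint mu q (fun x => fine (f x) * wr x)%R.
Proof.
move=> ffin; apply: ae_eq_integral => //.
- apply/measurable_EFinP; apply: (measurableT_comp (measurable_powR _)).
  apply: measurable_funM; last exact: pw.1.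
  exact: measurableT_comp (fine_measurable measurableT) mf.
- apply: filterS2 ww ffin => x wx fx _.
  rewrite wx gee0_abs//; have := f0 x; rewrite -(fineK fx) lee_fin => fx0.
  by rewrite !poweR_EFin -EFinM powRM// ltW// pw.2.
Qed.

End norms.

Lemma nnw_fine (f : T -> \bar R) : measurable_fun setT f -> (forall x, 0 <= f x) ->
  nnw (fun x => fine (f x)).
Proof.
move=> mf f0; split => [|x]; last exact: fine_ge0.
exact: measurableT_comp (fine_measurable measurableT) mf.
Qed.

Lemma integrable_wint (u : T -> \bar R) (v : T -> R) A : posw v -> measurable A ->
  {ae mu, forall x, u x = (v x)%:E} -> mu.-integrable A u -> wint mu v A < +oo.
Proof.
move=> pv mA uv /integrableP[mu1 h].
rewrite /wint (_ : \int[mu]_(x in A) (v x)%:E = \int[mu]_(x in A) `|u x|)//.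
apply: ae_eq_integral => //.
- by apply/measurable_EFinP; apply: measurable_funTS; exact: pv.1.
- by apply: measurableT_comp.
- by apply: filterS uv => x -> _; rewrite gee0_abs// lee_fin ltW// pv.2.
Qed.

Lemma wint_integrable (v : T -> R) A : posw v -> measurable A -> wint mu v A < +oo ->
  mu.-integrable A (fun x => (v x)%:E).
Proof.
move=> pv mA h; apply/integrableP; split.
  by apply/measurable_EFinP; apply: measurable_funTS; exact: pv.1.
by under eq_integral do rewrite gee0_abs ?lee_fin ?(ltW (pv.2 _))//.
Qed.

End real_representatives.

(** * Bounds for the characteristics of a weight in a power mean class *)

Section classes_of_weights.
Context {R : realType} {n : nat}.
Hypothesis n_gt0 : (0 < n)%N.
Local Notation E := (Rn R n).
Local Notation mu := (lebesgue_n R n : {measure set E -> \bar R}).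
Local Notation qb := (@qb R n).
Local Notation apw := (apw mu qb).
Local Notation cmass := (cmass mu qb).
Local Notation wint := (wint mu).
Local Notation K3 := (3 ^+ n : R)%R.
Let CB := @cube_basis_Rn R n n_gt0.

Lemma maximalE (f : E -> \bar R) : maximal f = gmax mu qb f.
Proof.
apply/funext => x; rewrite /maximal /gmax; congr ereal_sup; apply/seteqP; split => y.
  by move=> [P [cP cx] <-]; have [c e] := cubesP cP; exists c; [rewrite /= -e|rewrite -e].
by move=> [c cx <-]; exists (qb c) => //; split => //; exact: cubes_qb.
Qed.

Lemma sup_cubes_le (F : set E -> \bar R) (y : \bar R) :
  (forall c, F (qb c) <= y) -> ereal_sup [set F P | P in cubes] <= y.
Proof. by move=> h; apply: ge_ereal_sup => _ [P cP <-]; have [c ->] := cubesP cP. Qed.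

Lemma sup_cubes_ub (F : set E -> \bar R) (y : \bar R) c :
  ereal_sup [set F P | P in cubes] <= y -> F (qb c) <= y.
Proof.
by apply: le_trans; apply: ereal_sup_ubound; exists (qb c) => //; exact: cubes_qb.
Qed.

Lemma hoelder_exponent (b : R) : (0 < b)%R ->
  (1 - fine (hoelder_conjugate (1 + b)%:E) = - b^-1)%R.
Proof.
move=> b0; rewrite /hoelder_conjugate /= eqe gt_eqF ?addr_gt0// -EFinB inver.
have -> : (1 + b - 1 = b)%R by ring.
by rewrite gt_eqF// -EFinM /=; field; rewrite gt_eqF.
Qed.

Lemma hoelder_conjugate_fin (r : R) : (1 < r)%R ->
  hoelder_conjugate r%:E = ((1 - r^-1)^-1)%:E.
Proof.
move=> r1; have r0 : (0 < r)%R by exact: lt_trans r1.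
rewrite /hoelder_conjugate /= eqe gt_eqF// -EFinB inver gt_eqF ?subr_gt0// -EFinM.
by congr (_%:E); field; rewrite !gt_eqF ?subr_gt0.
Qed.

Section outputs.
Variables (v : E -> R) (K : R).
Hypothesis pv : posw v.
Local Notation vE := (fun x => (v x)%:E).

Lemma weight_posw : weight vE.
Proof.
split; first by apply/measurable_EFinP; exact: pv.1.
by apply: aeW => x; rewrite lte_fin pv.2 ltry.
Qed.

Lemma Ap_const_le b : (0 <= b)%R -> apw 1 b v K -> Ap_const_fin (1 + b) vE <= K%:E.
Proof.
move=> b0 AP; rewrite /Ap_const_fin; case: ifPn => [/eqP h|h]; apply: sup_cubes_le => c;
  have [k [e [k0 e0 ke hk he]]] := AP c.
  have bz : b = 0%R by lra.
  exact: (A1_cube CB ler01 (lexx 1%R) pv k0 e0 ke hk he bz).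
have bp : (0 < b)%R.
  by rewrite lt0r b0 andbT; apply: contra h => /eqP ->; rewrite addr0.
rewrite hoelder_exponent//.
have -> : (1 + b - 1 = b)%R by ring.
exact: (Ap_cube CB ler01 (lexx 1%R) pv k0 e0 ke hk he bp).
Qed.

Lemma RHs_const_le a b : (0 <= a)%R -> (a < 1)%R -> (0 <= b)%R -> apw a b v K ->
  RHs_const_gt1 (if a == 0%R then +oo else a^-1%:E) vE <= K%:E.
Proof.
move=> a0 a1 b0 AP; case: ifPn => [/eqP h|h]; apply: sup_cubes_le => c;
  have [k [e [k0 e0 ke hk he]]] := AP c.
  exact: (RHoo_cube CB a0 (ltW a1) b0 pv k0 e0 ke hk he h).
have ap : (0 < a)%R by rewrite lt0r h.
rewrite invrK; exact: (RH_cube CB a0 (ltW a1) b0 pv k0 e0 ke hk he ap).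
Qed.

Lemma Ainfty_const_le b : (0 < b)%R -> apw 1 b v K ->
  Ainfty_const vE <= (K3 * (muck_cst K3 b 1 K + 1))%:E.
Proof.
move=> b0 AP; apply: sup_cubes_le => c; rewrite maximalE.
exact: (Ainfty_cube CB c b0 pv AP).
Qed.

Lemma locally_int_posw a b : (0 <= a)%R -> (a <= 1)%R -> apw a b v K -> locally_int vE.
Proof.
move=> a0 a1 AP P cP; have [c ->] := cubesP cP; have [k [e [k0 e0 ke hk he]]] := AP c.
have mQ := cb_meas CB c.
apply: (wint_integrable pv mQ).
apply: (pmean1_fin pv (c := k)).
have muQ : mu (qb c) <= (cmass c)%:E by rewrite (cmassE CB).
exact: (pmean_mono mQ muQ a0 a1 k0 pv hk).
Qed.

End outputs.

End classes_of_weights.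

(** * Power means and absolute continuity from the characteristics *)

Section characteristics.
Context {R : realType} {n : nat}.
Hypothesis n_gt0 : (0 < n)%N.
Local Notation E := (Rn R n).
Local Notation mu := (lebesgue_n R n : {measure set E -> \bar R}).
Local Notation qb := (@qb R n).
Local Notation apw := (apw mu qb).
Local Notation cmass := (cmass mu qb).
Local Notation wint := (wint mu).
Local Notation K3 := (3 ^+ n : R)%R.
Local Notation D0 := (2 ^+ n : R)%R.
Let CB := @cube_basis_Rn R n n_gt0.
Let DB := @dyadic_basis_Rn R n.
Variables (v : E -> R) (u : E -> \bar R) (K : R).
Hypotheses (K0 : (0 < K)%R) (pv : posw v) (vfin : forall c, wint v (qb c) < +oo)
  (mu1 : measurable_fun setT u) (uv : {ae mu, forall x, u x = (v x)%:E}).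

Let vE c : wint v (qb c) = (fine (wint v (qb c)))%:E.
Proof. by have [V V0 ->] := wintQE CB pv vfin c. Qed.

Lemma RHs_pmean (a : R) c : (0 < a)%R -> RHs_const_gt1 (a^-1)%:E u <= K%:E ->
  pmean mu (qb c) (cmass c) a v (K * (fine (wint v (qb c)) / cmass c))%R.
Proof.
move=> a0 h; apply: (RH_cube_pmean CB K0 pv vfin mu1 uv (vE c) a0).
have := sup_cubes_ub (F := fun Q => (avg (fun x => u x `^ a^-1) Q) `^ a^-1^-1 * (avg u Q)^-1) c h.
by rewrite invrK.
Qed.

Lemma Ap_pmean (b : R) c : (0 < b)%R -> Ap_const_fin (1 + b) u <= K%:E ->
  pmean mu (qb c) (cmass c) b (fun x => (v x)^-1)%R (K * (cmass c / fine (wint v (qb c))))%R.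
Proof.
move=> b0; rewrite /Ap_const_fin; case: ifPn => [/eqP|_ h].
  by move=> h; exfalso; lra.
apply: (Ap_cube_pmean CB K0 pv vfin mu1 uv (vE c) b0).
move: h; rewrite hoelder_exponent// (_ : 1 + b - 1 = b)%R; last by ring.
by move=> /(sup_cubes_ub (F := fun Q => avg u Q * (avg (fun x => u x `^ (- b^-1)) Q) `^ b) c).
Qed.

Lemma Ainfty_maxw c : Ainfty_const u <= K%:E ->
  \int[mu]_(x in qb c) maxw mu qb rat_cube (fun=> 1%R) (fun y => ((v \_ (qb c)) y)%:E) x <=
  K%:E * wint v (qb c).
Proof.
move=> h; apply: (Ainfty_cube_maxw CB pv vfin mu1 uv (vE c)).
have := sup_cubes_ub (F := fun Q => (\int[mu]_(x in Q) u x)^-1 *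
  \int[mu]_(x in Q) maximal (u \_ Q) x) c h.
by rewrite maximalE.
Qed.

Lemma Ainfty_absc : Ainfty_const u <= K%:E -> absc mu qb (fw_eps K3 D0 K) v.
Proof. by move=> h; apply: (absc_fw CB DB K0 pv vfin) => c; exact: Ainfty_maxw. Qed.

Lemma RHs_absc (a : R) : (0 < a)%R -> (a < 1)%R -> RHs_const_gt1 (a^-1)%:E u <= K%:E ->
  absc mu qb (rh_eps a K) v.
Proof.
by move=> a0 a1 h; apply: (absc_rh CB (ltW a0) a1 K0 pv vfin) => c; exact: RHs_pmean.
Qed.

End characteristics.

Lemma fw_eps_gt0 (R : realType) (K3 D0 K : R) : (0 < fw_eps K3 D0 K)%R.
Proof. by rewrite invr_gt0 mulr_gt0// exprn_gt0. Qed.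

Lemma fw_eps_lt1 (R : realType) (K3 D0 K : R) : (fw_eps K3 D0 K < 1)%R.
Proof.
have h : (1 <= 2 ^+ fw_lev K3 D0 K :> R)%R by rewrite exprn_ege1// ler1n.
rewrite /fw_eps invf_lt1; last by rewrite mulr_gt0// (lt_le_trans _ h).
by move: (2 ^+ _)%R h => y; lra.
Qed.

Lemma rh_eps_gt0 (R : realType) (a K : R) : (0 < K)%R -> (0 < rh_eps a K)%R.
Proof. by move=> K0; rewrite powR_gt0// mulr_gt0. Qed.

Lemma rh_eps_lt1 (R : realType) (a K : R) : (a < 1)%R -> (1 <= K)%R -> (rh_eps a K < 1)%R.
Proof.
move=> a1 K1; have K0 : (0 < 2 * K)%R by rewrite mulr_gt0// (lt_le_trans _ K1).
rewrite /rh_eps powRN invf_lt1 ?powR_gt0//.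
have e : (1 = 1 `^ (1 - a)^-1 :> R)%R by rewrite powR1.
rewrite [ltLHS]e; apply: gt0_ltr_powR; rewrite ?nnegrE ?invr_gt0 ?subr_gt0//; lra.
Qed.

(** * From the limited range classes to power means *)

Section limited_range.
Context {R : realType} {n : nat}.
Hypothesis n_gt0 : (0 < n)%N.
Local Notation E := (Rn R n).
Local Notation mu := (lebesgue_n R n : {measure set E -> \bar R}).
Local Notation qb := (@qb R n).
Local Notation apw := (apw mu qb).
Local Notation cmass := (cmass mu qb).
Local Notation wint := (wint mu).
Local Notation K3 := (3 ^+ n : R)%R.
Local Notation D0 := (2 ^+ n : R)%R.
Let CB := @cube_basis_Rn R n n_gt0.
Let DB := @dyadic_basis_Rn R n.
Local Notation chain := (@cube_chain R n).
Variables (pm : R) (pp : \bar R).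
Hypotheses (pm0 : (0 <= pm)%R).

Definition inv_top : R := if pp is r%:E then r^-1%R else 0%R.

(** The proportion at which a part of a cube has at most half of the weight w^p: for finite p_+ it
    comes from the reverse Hoelder constant, whose exponent has inverse [1 - p / r], otherwise from
    the Fujii-Wilson constant. The maximum with 1 is there since [K2] is an arbitrary real
    number. *)
Definition range_eps (p K2 : R) : R :=
  if pp is r%:E then rh_eps (1 - p / r)%R (Num.max K2 1%R) else fw_eps K3 D0 (Num.max K2 1%R).

(* For [pm = 0] the A_oo condition only yields some exponent depending on the
   constants; it is enlarged to at least [m]. *)
Definition range_exp (p m K2 : R) : R :=
  if pm == 0%R then Num.max (p^-1 / absc_exp chain (range_eps p K2))%R m
  else (pm^-1 - p^-1)%R.

Definition range_cst (p K1 K2 : R) : R :=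
  (Num.max K2 1 `^ p^-1 *
   (if pm == 0%R then absc_cst (range_eps p K2) `^ (p^-1 / absc_exp chain (range_eps p K2))
    else Num.max K1 1 `^ p^-1))%R.

Section input.
Variables (p : R).
Hypotheses (p0 : (0 < p)%R) (pmp : (pm < p)%R) (ppp : p%:E < pp).

Lemma range_eps_gt0 K2 : (0 < range_eps p K2)%R.
Proof.
rewrite /range_eps; case: pp => [r| |]; rewrite ?fw_eps_gt0//.
by rewrite rh_eps_gt0// lt_max ltr01 orbT.
Qed.

Lemma range_eps_lt1 K2 : (range_eps p K2 < 1)%R.
Proof.
rewrite /range_eps; case: pp ppp => [r| |] h; rewrite ?fw_eps_lt1//.
rewrite lte_fin in h; apply: rh_eps_lt1; last by rewrite le_max lexx orbT.
by rewrite gtrBl divr_gt0// (lt_trans p0).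
Qed.

Lemma range_exp_gt0 m K2 : (0 < m)%R -> (0 < range_exp p m K2)%R.
Proof.
move=> m0; rewrite /range_exp; case: ifPn => pmn; first by rewrite lt_max m0 orbT.
by rewrite subr_gt0 ltf_pV2// posrE// lt0r pmn.
Qed.

Lemma inv_top_lt : (inv_top < p^-1)%R.
Proof.
rewrite /inv_top; case: pp ppp => [r| |] h; rewrite ?invr_gt0//.
by rewrite lte_fin in h; rewrite ltf_pV2// posrE// (lt_trans p0).
Qed.

(** Each characteristic compares a power mean of w^p or of its inverse with the average of w^p on
    the same cube, and the averages cancel in the product. For p_- = 0 the second mean comes from
    [absc_pmean], its index being then raised to at least [m]. *)
Lemma class_apw (m K1 K2 : R) (w : E -> \bar R) (wr : E -> R) : (0 < m)%R ->
  let wp := fun x => w x `^ p in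
  let a := p%:E / pm%:E in
  let s := hoelder_conjugate (pp / p%:E) in
  measurable_fun setT w -> RHs s wp -> Ap_const a wp <= K1%:E -> RHs_const s wp <= K2%:E ->
  posw wr -> {ae mu, forall x, w x = (wr x)%:E} ->
  apw (p^-1 - inv_top) (range_exp p m K2) wr (range_cst p K1 K2).
Proof.
move=> m0 wp a s mw [_ wloc _] hA hR pw ww.
pose v x := (wr x `^ p)%R; have pv : posw v by exact: posw_powR.
have mwp : measurable_fun setT wp by exact: (measurableT_comp (measurable_poweR _)).
have wv : {ae mu, forall x, wp x = (v x)%:E}.
  by apply: filterS ww => x e; rewrite /wp e poweR_EFin.
have vfin c : wint v (qb c) < +oo.
  exact: (integrable_wint pv (cb_meas CB c) wv (wloc _ (cubes_qb c))).
set K2' := Num.max K2 1%R; set K1' := Num.max K1 1%R.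
have K21 : (1 <= K2')%R by rewrite le_max lexx orbT.
have K11 : (1 <= K1')%R by rewrite le_max lexx orbT.
have K20 : (0 < K2')%R by exact: lt_le_trans K21.
have K10 : (0 < K1')%R by exact: lt_le_trans K11.
have hA' : Ap_const a wp <= K1'%:E by apply: (le_trans hA); rewrite lee_fin le_max lexx.
have hR' : RHs_const s wp <= K2'%:E by apply: (le_trans hR); rewrite lee_fin le_max lexx.
have itop := inv_top_lt.
have al0 : (0 < p^-1)%R by rewrite invr_gt0.
pose sg := (p * (p^-1 - inv_top))%R.
have sg0 : (0 < sg)%R by rewrite mulr_gt0// subr_gt0.
have topE r : pp = r%:E -> [/\ (sg = 1 - p / r)%R, (sg < 1)%R, s = sg^-1%:E & (s == 1) = false].
  move=> e; have pr : (p < r)%R by move: ppp; rewrite e lte_fin.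
  have r0 : (0 < r)%R by exact: lt_trans pr.
  have e1 : (sg = 1 - p / r)%R by rewrite /sg /inv_top e mulrBr mulfV// gt_eqF.
  have e2 : (sg < 1)%R by rewrite e1 gtrBl divr_gt0.
  have e3 : s = sg^-1%:E.
    rewrite /s e inver gt_eqF// -EFinM hoelder_conjugate_fin ?ltr_pdivlMr ?mul1r//.
    by rewrite e1 invf_div.
  by split => //; rewrite e3 eqe invr_eq1 lt_eqF.
have ytopE : pp = +oo -> sg = 1%R /\ s = 1.
  move=> e; rewrite /sg /inv_top /s e subr0 mulfV ?gt_eqF//; split => //.
  by rewrite inver gt_eqF// gt0_mulye ?hoelder_conjugatey// lte_fin.
have topNy : pp <> -oo by move=> e; move: ppp; rewrite e.
have hRc c : pmean mu (qb c) (cmass c) sg v (K2' * (fine (wint v (qb c)) / cmass c))%R.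
  move Epp : pp => t; case: t Epp => [r| |] e //.
    have [_ _ es s1] := topE r e.
    apply: (RHs_pmean n_gt0 K20 pv vfin mwp wv c sg0).
    by move: hR'; rewrite /RHs_const s1 es.
  (* For infinite p_+ the index is 1, and the mean of exponent 1 is the average itself. *)
  have [-> _] := ytopE e; have m1 := cmass_gt0 CB c.
  have [V V0 eV] := wintQE CB pv vfin c.
  apply: (pmean_le m1 ler01 (c := (V / cmass c)%R)); first by rewrite divr_gt0.
    by rewrite eV /= ler_peMl// divr_ge0 ?ltW.
  rewrite pmeanE ?oner_eq0// invr1 powRr1 ?divr_ge0 ?(ltW V0) ?(ltW m1)//.
  have -> : (fun x => v x `^ 1)%R = v by apply/funext => x; rewrite powRr1// ltW// pv.2.
  by rewrite eV lee_fin divfK// gt_eqF.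
have absv : pm = 0%R -> absc mu qb (range_eps p K2) v.
  move=> _; rewrite /range_eps; move Epp : pp => t; case: t Epp => [r| |] e //.
    have [e1 sg1 es s1] := topE r e; rewrite -e1.
    apply: (RHs_absc n_gt0 K20 pv vfin mwp wv sg0 sg1).
    by move: hR'; rewrite /RHs_const s1 es.
  have [_ es] := ytopE e.
  apply: (Ainfty_absc n_gt0 K20 pv vfin mwp wv).
  by move: hR'; rewrite /RHs_const es eqxx.
move=> c; have [V V0 eV] := wintQE CB pv vfin c; have m1 := cmass_gt0 CB c.
have mQ := cb_meas CB c.
have muQ : mu (qb c) <= (cmass c)%:E by rewrite (cmassE CB).
have vw : (fun x => v x `^ p^-1)%R = wr.
  by apply/funext => x; rewrite /v -powRrM mulfV ?gt_eqF// powRr1// ltW// pw.2.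
have Vm : (0 < V / cmass c)%R by rewrite divr_gt0.
have mV : (0 < cmass c / V)%R by rewrite divr_gt0.
have prod1 : ((V / cmass c) `^ p^-1 * (cmass c / V) `^ p^-1 = 1)%R.
  by rewrite -powRM ?(ltW Vm) ?(ltW mV)// mulrACA (mulrC _^-1%R) -mulrACA !mulfV ?gt_eqF// mulr1 powR1.
have hc1 : pmean mu (qb c) (cmass c) (p^-1 - inv_top) wr ((K2' * (V / cmass c)) `^ p^-1)%R.
  have := hRc c; rewrite eV /= => h.
  have k0 : (0 < K2' * (V / cmass c))%R by rewrite mulr_gt0.
  have := pmean_pow (ltW sg0) (ltW al0) k0 pv h.
  rewrite vw (_ : sg * p^-1 = p^-1 - inv_top)%R// /sg.
  by rewrite mulrAC mulfV ?gt_eqF// mul1r.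
have [e [e0 ee he]] : exists e : R, [/\ (0 < e)%R,
    (((K2' * (V / cmass c)) `^ p^-1) * e <= range_cst p K1 K2)%R &
    pmean mu (qb c) (cmass c) (range_exp p m K2) (fun x => (wr x)^-1)%R e].
  rewrite /range_cst /range_exp -/K2' -/K1'; case: ifPn => [/eqP pmz|pmn].
    have e0 := range_eps_gt0 K2; have e1 := range_eps_lt1 K2.
    have vE : v = (fun x => wr x `^ p^-1^-1)%R by rewrite invrK.
    have h := absc_pmean CB DB c e0 e1 al0 pw.
    rewrite -vE in h; have {h} := h vfin (absv pmz).
    rewrite eV /=; set del := absc_exp _ _; set cst := absc_cst _ => h.
    have d0 : (0 < del)%R by exact: absc_exp_gt0.
    have c0 : (0 < cst)%R by exact: absc_cst_gt0.
    exists (cst `^ (p^-1 / del) * (cmass c / V) `^ p^-1)%R; split.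
    - by rewrite mulr_gt0 ?powR_gt0.
    - by rewrite (powRM _ (ltW K20) (ltW Vm)) mulrACA prod1 mulr1.
    - apply: (pmean_mono mQ muQ _ _ _ (posw_inv pw) h).
      + by rewrite ltW// divr_gt0.
      + by rewrite le_max lexx.
      + by rewrite mulr_gt0 ?powR_gt0.
  have pmp0 : (0 < pm)%R by rewrite lt0r pmn.
  have b0 : (0 < p / pm - 1)%R by rewrite subr_gt0 ltr_pdivlMr// mul1r.
  have h : pmean mu (qb c) (cmass c) (p / pm - 1) (fun x => (v x)^-1)%R
      (K1' * (cmass c / fine (wint v (qb c))))%R.
    apply: (Ap_pmean n_gt0 K10 pv vfin mwp wv c b0).
    move: hA'; rewrite /a inver gt_eqF// -EFinM /Ap_const.
    by have -> : (1 + (p / pm - 1) = p / pm)%R by ring.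
  rewrite eV /= in h.
  have k0 : (0 < K1' * (cmass c / V))%R by rewrite mulr_gt0.
  exists ((K1' * (cmass c / V)) `^ p^-1)%R; split; first by rewrite powR_gt0.
    rewrite (powRM _ (ltW K20) (ltW Vm)) (powRM _ (ltW K10) (ltW mV)).
    by rewrite mulrACA prod1 mulr1.
  have := pmean_pow (ltW b0) (ltW al0) k0 (posw_inv pv) h.
  have -> : ((p / pm - 1) * p^-1 = pm^-1 - p^-1)%R by field; rewrite !gt_eqF.
  have -> // : (fun x => (v x)^-1 `^ p^-1)%R = (fun x => (wr x)^-1)%R.
  by apply/funext => x; rewrite powRV ?pv.2// -[in RHS]vw.
by exists ((K2' * (V / cmass c)) `^ p^-1)%R, e; split => //; rewrite powR_gt0// mulr_gt0.
Qed.

End input.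
End limited_range.

Lemma apw_mono d (T : measurableType d) (R : realType) (mu : {measure set T -> \bar R})
    (C : Type) (Q : C -> set T) (trip : C -> C) (rc : nat -> C) (K3 : R)
    (CB : cube_basis mu Q trip rc K3) (a b a' b' K : R) (w : T -> R) :
  (0 <= a)%R -> (a <= a')%R -> (0 <= b)%R -> (b <= b')%R -> posw w ->
  apw mu Q a b w K -> apw mu Q a' b' w K.
Proof.
move=> a0 aa b0 bb pw AP i; have [c [e [c0 e0 ce hc he]]] := AP i.
have mQ := cb_meas CB i.
have muQ : mu (Q i) <= (cmass mu Q i)%:E by rewrite (cmassE CB).
exists c, e; split => //; first exact: (pmean_mono mQ muQ a0 aa c0 pw hc).
exact: (pmean_mono mQ muQ b0 bb e0 (posw_inv pw) he).
Qed.

Lemma apw_pow d (T : measurableType d) (R : realType) (mu : {measure set T -> \bar R})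
    (C : Type) (Q : C -> set T) (a b t K : R) (w : T -> R) :
  (0 <= a)%R -> (0 <= b)%R -> (0 <= t)%R -> posw w ->
  apw mu Q a b w K -> apw mu Q (a * t) (b * t) (fun x => w x `^ t)%R (K `^ t)%R.
Proof.
move=> a0 b0 t0 pw AP i; have [c [e [c0 e0 ce hc he]]] := AP i.
exists (c `^ t)%R, (e `^ t)%R; split; rewrite ?powR_gt0//.
- have ce0 : (0 <= c * e)%R by rewrite mulr_ge0// ltW.
  rewrite -powRM ?(ltW c0) ?(ltW e0)//; apply: (ge0_ler_powR t0) => //.
  by rewrite nnegrE (le_trans ce0 ce).
- exact: pmean_pow.
- have := pmean_pow b0 t0 e0 (posw_inv pw) he.
  have -> // : (fun x => (w x)^-1 `^ t)%R = (fun x => (w x `^ t)^-1)%R.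
  by apply/funext => x; rewrite powRV// pw.2.
Qed.

(** * From power means back to the limited range classes *)

Section extrapolation.
Context {R : realType} {n : nat}.
Hypothesis n_gt0 : (0 < n)%N.
Local Notation E := (Rn R n).
Local Notation mu := (lebesgue_n R n : {measure set E -> \bar R}).
Local Notation qb := (@qb R n).
Local Notation apw := (apw mu qb).
Local Notation K3 := (3 ^+ n : R)%R.
Let CB := @cube_basis_Rn R n n_gt0.
Let DB := @dyadic_basis_Rn R n.
Variables (pm : R) (pp : \bar R).

(** When [p] equals p_- the exponent [b * p] is 0, while Muckenhoupt's theorem wants a positive one;
    adding 1 only enlarges the class. *)
Definition fw_cst (p b K : R) : R := (K3 * (muck_cst K3 (b * p + 1) 1 (K `^ p) + 1))%R.
Definition Ap_bound (p b K : R) : R := if pm == 0%R then fw_cst p b K else (K `^ p)%R.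
Definition RH_bound (p b K : R) : R := if pp is _%:E then (K `^ p)%R else fw_cst p b K.

(** Raising [w] to the power [p] multiplies both indices by [p]. The first becomes the inverse of
    (p_+/p)': it is 0, for RH_oo, when p = p_+, and 1, for RH_1, when p_+ is infinite. For p_- > 0
    the second makes 1 + b p equal to p/p_-. *)
Lemma apw_class (p b K : R) (w : E -> R) :
  let wp := fun x => (w x)%:E `^ p in
  let a := p%:E / pm%:E in
  let s := hoelder_conjugate (pp / p%:E) in
  (0 < p)%R -> (pm <= p)%R -> p%:E <= pp -> posw w -> (0 <= b)%R ->
  (pm = 0%R -> 0 < b)%R -> (pm != 0%R -> b = pm^-1 - p^-1)%R ->
  apw (p^-1 - inv_top pp) b w K ->
  [/\ Ap a wp, RHs s wp, Ap_const a wp <= (Ap_bound p b K)%:E &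
      RHs_const s wp <= (RH_bound p b K)%:E].
Proof.
move=> wp a s p0 pmp ppp pw b0 bz bn AP.
pose v x := (w x `^ p)%R; have pv : posw v by exact: posw_powR.
have wpE : wp = fun x => (v x)%:E by apply/funext => x; rewrite /wp poweR_EFin.
have it0 : (0 <= inv_top pp)%R.
  rewrite /inv_top; case: pp ppp => [r| |]// h.
  by rewrite lee_fin in h; rewrite invr_ge0 (le_trans (ltW p0)).
have itp : (inv_top pp <= p^-1)%R.
  rewrite /inv_top; case: pp ppp => [r| |] h; rewrite ?invr_ge0 ?(ltW p0)//.
  by rewrite lee_fin in h; rewrite lef_pV2// posrE// (lt_le_trans p0).
pose sg := ((p^-1 - inv_top pp) * p)%R.
have sg0 : (0 <= sg)%R by rewrite mulr_ge0 ?(ltW p0)// subr_ge0.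
have sgE : (sg = 1 - inv_top pp * p)%R by rewrite /sg mulrBl mulVf// gt_eqF.
have sg1 : (sg <= 1)%R by rewrite sgE gerBl mulr_ge0// ltW.
have a0 : (0 <= p^-1 - inv_top pp)%R by rewrite subr_ge0.
have APv : apw sg (b * p) v (K `^ p)%R := apw_pow a0 b0 (ltW p0) pw AP.
have bp0 : (0 <= b * p)%R by rewrite mulr_ge0// ltW.
have AP1 : apw 1 (b * p) v (K `^ p)%R := apw_mono CB sg0 sg1 bp0 (lexx _) pv APv.
have bp1 : (0 < b * p + 1)%R by rewrite ltr_wpDl.
have bpl : (b * p <= b * p + 1)%R by rewrite lerDl.
have APf : apw 1 (b * p + 1) v (K `^ p)%R := apw_mono CB sg0 sg1 bp0 bpl pv APv.
have hAp : Ap_const_fin (1 + b * p) wp <= (K `^ p)%:E.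
  by rewrite wpE; exact: (Ap_const_le n_gt0).
have hFW : Ainfty_const wp <= (fw_cst p b K)%:E.
  by rewrite wpE; exact: (Ainfty_const_le n_gt0).
have hw : weight wp by rewrite wpE; exact: weight_posw.
have hloc : locally_int wp.
  by rewrite wpE; exact: (locally_int_posw n_gt0 pv sg0 sg1 APv).
have apE : a = if pm == 0%R then +oo else (1 + b * p)%:E.
  rewrite /a inver; case: ifPn => pmn; first by rewrite gt0_muley// lte_fin.
  rewrite -EFinM; congr (_%:E); rewrite bn//; field.
  by rewrite pmn gt_eqF.
have hA1 : Ap a wp /\ Ap_const a wp <= (Ap_bound p b K)%:E.
  rewrite apE /Ap_bound; case: ifPn => [pmz|pmn].
    split => //; split => //; exists (1 + b * p)%R; first by rewrite lerDl.
    by apply: (le_lt_trans hAp); rewrite ltry.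
  by split => //; split => //=; apply: (le_lt_trans hAp); rewrite ltry.
have hR1 : RHs s wp /\ RHs_const s wp <= (RH_bound p b K)%:E.
  rewrite /RH_bound; move Epp : pp => t; case: t Epp => [r| |] e; last 2 first.
  - have -> : s = 1.
      by rewrite /s e inver gt_eqF// gt0_mulye ?hoelder_conjugatey// lte_fin invr_gt0.
    split; last by rewrite /RHs_const eqxx.
    split => //; rewrite eqxx.
    (* Membership in RH_1 needs an actual exponent above 1, which Gehring's lemma supplies. *)
    have [a' [K' [a'0 a'1 AP']]] := apw_rh CB DB unit_cube ltr01 bp1 pv APf.
    exists (a'^-1)%:E; first by rewrite lte_fin invf_gt1.
    have := RHs_const_le n_gt0 pv (ltW a'0) a'1 (ltW bp1) AP'.
    by rewrite gt_eqF// -wpE => h; apply: (le_lt_trans h); rewrite ltry.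
  - by move: ppp; rewrite e.
  have pr : (p <= r)%R by move: ppp; rewrite e lee_fin.
  have r0 : (0 < r)%R by exact: lt_le_trans pr.
  have ite : inv_top pp = (r^-1)%R by rewrite /inv_top e.
  have sgl : (sg < 1)%R by rewrite sgE ite gtrBl mulr_gt0// invr_gt0.
  have sE : s = if sg == 0%R then +oo else (sg^-1)%:E.
    rewrite /s e inver gt_eqF// -EFinM.
    case: ifPn => [/eqP sgz|sgn].
      have -> : (r / p = 1)%R.
        by move: sgz; rewrite sgE ite => h; rewrite (_ : r = p) ?mulfV ?gt_eqF//;
           apply/(@mulfI _ r^-1%R); rewrite ?gt_eqF ?invr_gt0// mulVf ?gt_eqF//; lra.
      by rewrite hoelder_conjugate1.
    have rp : (1 < r / p)%R.
      rewrite ltr_pdivlMr// mul1r lt_neqAle pr andbT; apply: contra sgn => /eqP pe.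
      by rewrite sgE ite pe (mulVf (lt0r_neq0 r0)) subrr.
    by rewrite hoelder_conjugate_fin// sgE ite invf_div mulrC.
  have s1 : (s == 1) = false.
    rewrite sE; case: ifPn => // sgn; rewrite eqe invr_eq1 lt_eqF//.
  have h : RHs_const_gt1 s wp <= (K `^ p)%:E.
    by rewrite wpE sE; exact: (RHs_const_le n_gt0 pv sg0 sgl bp0 APv).
  split; last by rewrite /RHs_const s1.
  by split => //; rewrite s1; apply: (le_lt_trans h); rewrite ltry.
by split; [exact: hA1.1|exact: hR1.1|exact: hA1.2|exact: hR1.2].
Qed.

End extrapolation.

(** * Extrapolation with explicit constants *)

Section theorem.
Context {R : realType} {n : nat}.
Hypothesis n_gt0 : (0 < n)%N.
Local Notation E := (Rn R n).
Local Notation mu := (lebesgue_n R n : {measure set E -> \bar R}).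
Local Notation qb := (@qb R n).
Local Notation apw := (apw mu qb).
Local Notation K3 := (3 ^+ n : R)%R.
Let CB := @cube_basis_Rn R n n_gt0.
Variables (pm : R) (pp : \bar R) (pm_ge0 : (0 <= pm)%R) (p0 q0 p q : R).
Hypotheses (p0_gt0 : (0 < p0)%R) (q0_gt0 : (0 < q0)%R) (pm_le_p0 : (pm <= p0)%R)
  (p0_le_pp : p0%:E <= pp) (pm_lt_p : (pm < p)%R) (p_lt_pp : p%:E < pp)
  (q_gt0 : (0 < q)%R) (pq_gap : (p^-1 - q^-1 = p0^-1 - q0^-1)%R).
Variable C0 : R -> R -> R.

Definition bound_at (b K : R) : R :=
  C0 (@Ap_bound R n pm p0 b K) (@RH_bound R n pp p0 b K).

(** Built from [C0], the parameters and the bounds alone, so that one function serves all families.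
    The factor next to [bound_at] bounds the norm of [kap] in L^(1/t). *)
Definition extrapolation_cst (K1 K2 : R) : R :=
  let a := (p^-1 - inv_top pp)%R in
  let b := @range_exp R n pm pp p p0^-1 K2 in
  let K := @range_cst R n pm pp p K1 K2 in
  if p0^-1%R == p^-1%R then C0 K1 K2
  else if (p0^-1 < p^-1)%R then
    let t := (p^-1 - p0^-1)%R in
    (bound_at (b + t) (core_cst K3 a b t K) * (2 `^ ((a + b) / a + 1) * 2) `^ t)%R
  else
    let t := (p0^-1 - p^-1)%R in
    (bound_at (b - t) (core_cst K3 b a t K) * (2 `^ ((b + a) / b + 1)) `^ t)%R.

Variable F : set ((E -> \bar R) * (E -> \bar R)).
Hypotheses (nmF : nonneg_measurable_pairs F) (H0 : limited_range_bound pm pp p0 q0 F C0).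

Let p_gt0 : (0 < p)%R. Proof. exact: le_lt_trans pm_lt_p. Qed.
Let C0_gt0 K1 K2 : (0 < C0 K1 K2)%R. Proof. exact: (H0 K1 K2).1. Qed.

Lemma extrapolation_cst_gt0 K1 K2 : (0 < extrapolation_cst K1 K2)%R.
Proof.
rewrite /extrapolation_cst; case: ifPn => _; first exact: C0_gt0.
by case: ifPn => _; rewrite mulr_gt0// ?C0_gt0// powR_gt0// ?mulr_gt0// powR_gt0.
Qed.

Let apply_bound (b K : R) (W : E -> R) f g : posw W -> (0 <= b)%R ->
  (pm = 0%R -> 0 < b)%R -> (pm != 0%R -> b = pm^-1 - p0^-1)%R ->
  apw (p0^-1 - inv_top pp) b W K -> F (f, g) ->
  {ae mu, forall x, f x \is a fin_num} -> {ae mu, forall x, g x \is a fin_num} ->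
  pint mu q0 (fun x => fine (f x) * W x)%R < +oo ->
  pint mu q0 (fun x => fine (f x) * W x)%R `^ q0^-1 <=
  (bound_at b K)%:E * pint mu p0 (fun x => fine (g x) * W x)%R `^ p0^-1.
Proof.
move=> pW b0 bz bn AP Ffg ffin gfin hfin.
have [mf mg f0 g0] := nmF Ffg.
have [hA hR hA' hR'] :=
  apw_class n_gt0 p0_gt0 pm_le_p0 p0_le_pp pW b0 bz bn AP.
have mW : measurable_fun setT (fun x => (W x)%:E) by apply/measurable_EFinP; exact: pW.1.
have WW : {ae mu, forall x, (W x)%:E = (W x)%:E} by exact: aeW.
have := (H0 _ _).2 (fun x => (W x)%:E) (weight_posw pW) hA hR hA' hR' f g Ffg.
rewrite /wnorm.
have -> : \int[lebesgue_n R n]_x (`|f x| `^ q0 * (W x)%:E `^ q0) =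
    pint mu q0 (fun x => fine (f x) * W x)%R := norm_pint q0 mf f0 mW pW WW ffin.
have -> : \int[lebesgue_n R n]_x (`|g x| `^ p0 * (W x)%:E `^ p0) =
    pint mu p0 (fun x => fine (g x) * W x)%R := norm_pint p0 mg g0 mW pW WW gfin.
by apply; exact: poweR_lty.
Qed.

Lemma extrapolation : limited_range_bound pm pp p q F extrapolation_cst.
Proof.
move=> K1 K2; split; first exact: extrapolation_cst_gt0.
move=> w hw wp wq a s hA hR hA' hR' f g Ffg hfin.
have [mf mg f0 g0] := nmF Ffg.
have [e|ne] := eqVneq (p0^-1)%R (p^-1)%R.
  (* The gap condition then forces q0 = q, and the hypothesis is the claim. *)
  have pe : p0 = p by apply: invr_inj.
  have qe : q0 = q by apply: invr_inj; move: pq_gap; rewrite e; lra.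
  rewrite /extrapolation_cst e eqxx.
  move: H0; rewrite pe qe => H1.
  exact: ((H1 K1 K2).2 w hw hA hR hA' hR' f g Ffg hfin).
have [mw w0] := hw; have [wr pw ww] := posw_representative mw w0.
have al0 : (0 < p0^-1)%R by rewrite invr_gt0.
(* Taking 1/p0 as the least exponent leaves room for t < 1/p0 <= b when p_- = 0 and p_0 is below
   p. *)
have AP := class_apw n_gt0 pm_ge0 p_gt0 pm_lt_p p_lt_pp al0 mw hR hA' hR' pw ww.
set b := range_exp _ _ _ _ _ in AP; set K := range_cst _ _ _ _ _ in AP.
have b0 : (0 < b)%R by exact: range_exp_gt0.
have a0 : (0 < p^-1 - inv_top pp)%R by rewrite subr_gt0 inv_top_lt.
have bn : (pm != 0%R -> b = pm^-1 - p^-1)%R by move=> pmn; rewrite /b /range_exp (negbTE pmn).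
have bz : (pm = 0%R -> p0^-1 <= b)%R.
  by move=> pmz; rewrite /b /range_exp pmz eqxx le_max lexx orbT.
have al_pm : (pm != 0 -> p0^-1 <= pm^-1)%R.
  by move=> pmn; rewrite lef_pV2// posrE// lt0r pmn.
have it0 : (inv_top pp <= p0^-1)%R.
  rewrite /inv_top; case: pp p0_le_pp => [r| |] h; rewrite ?(ltW al0)//.
  by rewrite lee_fin in h; rewrite lef_pV2// posrE// (lt_le_trans p0_gt0).
have cst0 : 0 < (extrapolation_cst K1 K2)%:E by rewrite lte_fin extrapolation_cst_gt0.
(* An infinite right side is trivial; otherwise [f] and [g] are finite almost everywhere and can be
   replaced by real functions. *)
have [goo|goo] := eqVneq (\int[lebesgue_n R n]_x (`|g x| `^ p * wp x)) +oo.
  rewrite [X in _ <= _ * X](_ : _ = +oo) ?gt0_muley ?leey//.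
  by rewrite /wnorm goo poweRyr// gt_eqF// invr_gt0.
rewrite -ltey in goo.
have hfin' : \int[lebesgue_n R n]_x (`|f x| `^ q * w x `^ q) < +oo.
  by apply: lty_poweRy hfin; rewrite gt_eqF// invr_gt0.
have ffin : {ae mu, forall x, f x \is a fin_num}.
  exact: (norm_lty_ae_fin q_gt0 mf f0 mw pw ww hfin').
have gfin : {ae mu, forall x, g x \is a fin_num}.
  exact: (norm_lty_ae_fin p_gt0 mg g0 mw pw ww goo).
have ef : \int[lebesgue_n R n]_x (`|f x| `^ q * w x `^ q) =
    pint mu q (fun x => fine (f x) * wr x)%R := norm_pint q mf f0 mw pw ww ffin.
have eg : \int[lebesgue_n R n]_x (`|g x| `^ p * w x `^ p) =
    pint mu p (fun x => fine (g x) * wr x)%R := norm_pint p mg g0 mw pw ww gfin.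
rewrite /wnorm ef eg /extrapolation_cst -/b -/K (negbTE ne).
have Ffin : pint mu q (fun x => fine (f x) * wr x)%R < +oo by rewrite -ef.
have nf : nnw (fun x => fine (f x)) by exact: nnw_fine.
have ng : nnw (fun x => fine (g x)) by exact: nnw_fine.
case: ifPn => [lt|]; last rewrite -leNgt le_eqVlt eq_sym (negbTE ne) /= => lt.
- set t := (p^-1 - p0^-1)%R.
  have t0 : (0 < t)%R by rewrite subr_gt0.
  have bt0 : (0 < b + t)%R by rewrite addr_gt0.
  apply: (extrapolate_down CB a0 b0 t0 p_gt0 q_gt0 p0_gt0 q0_gt0 _ pw AP nf ng Ffin).
  + exact: C0_gt0.
  + by rewrite /t lerD2l lerN2.
  + by rewrite /t; ring.
  + by move: pq_gap; rewrite /t; lra.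
  move=> W pW APW WW; apply: (apply_bound pW _ _ _ _ Ffg ffin gfin WW).
  + exact: ltW.
  + by [].
  + by move=> /bn ->; rewrite /t; ring.
  + by move: APW; rewrite (_ : p^-1 - inv_top pp - t = p0^-1 - inv_top pp)%R// /t; ring.
- set t := (p0^-1 - p^-1)%R.
  have t0 : (0 < t)%R by rewrite subr_gt0.
  have tb : (t <= b)%R.
    have [pmz|pmn] := eqVneq pm 0%R.
      apply: le_trans (bz pmz); rewrite /t gerBl invr_ge0; exact: ltW.
    by rewrite bn// /t lerD2r al_pm.
  apply: (extrapolate_up CB a0 b0 t0 p_gt0 q_gt0 p0_gt0 q0_gt0 _ pw AP nf ng Ffin).
  + exact: C0_gt0.
  + exact: tb.
  + by rewrite /t; ring.
  + by move: pq_gap; rewrite /t; lra.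
  move=> W pW APW WW; apply: (apply_bound pW _ _ _ _ Ffg ffin gfin WW).
  + by rewrite subr_ge0.
  + move=> pmz; rewrite subr_gt0; apply: lt_le_trans (bz pmz).
    by rewrite /t gtrBl invr_gt0.
  + by move=> /bn ->; rewrite /t; ring.
  + by move: APW; rewrite (_ : p^-1 - inv_top pp + t = p0^-1 - inv_top pp)%R// /t; ring.
Qed.

End theorem.

Local Close Scope ereal_scope.

Theorem theorem1p8 (R : realType) (n : nat) (n_gt0 : (0 < n)%N)
    (pm : R) (pp : \bar R) (pm_ge0 : 0 <= pm) (pm_lt_pp : (pm%:E < pp)%E)
    (p0 q0 : R) (p0_gt0 : 0 < p0) (q0_gt0 : 0 < q0)
    (pm_le_p0 : pm <= p0) (p0_le_pp : (p0%:E <= pp)%E)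
    (gap : (0 <= q0^-1%:E - p0^-1%:E + pp^-1)%E)
    (C0 : R -> R -> R)
    (p q : R) (pm_lt_p : pm < p) (p_lt_pp : (p%:E < pp)%E) (q_gt0 : 0 < q)
    (pq_gap : p^-1 - q^-1 = p0^-1 - q0^-1) :
  exists C : R -> R -> R,
    forall F : set ((Rn R n -> \bar R) * (Rn R n -> \bar R)),
      nonneg_measurable_pairs F ->
      limited_range_bound pm pp p0 q0 F C0 ->
      limited_range_bound pm pp p q F C.
Proof.
exists (@extrapolation_cst R n pm pp p0 p C0) => F nmF HF.
exact: (extrapolation n_gt0 pm_ge0 p0_gt0 q0_gt0 pm_le_p0 p0_le_pp pm_lt_p p_lt_pp
  q_gt0 pq_gap nmF HF).
Qed.
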